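(* Let $(S,M,P,T)$ be a triangulated punctured surface and $\gamma_1$ a self-intersecting (singly or doubly notched generalized) arc, not notched at a puncture enclosed by a self-folded triangle of $T$. Let $c_1$ and $c_2$ be the two multicurves obtained by smoothing the crossing, suitably ordered. Then $$x_{\gamma_1}=x_{c_1}+Y^{+}x_{c_2},$$ where $Y^{+}$ is a monomial in the $y$-variables.
   Context: **Surface.** $S$ is a compact oriented Riemann surface with boundary, $M\subset\partial S$ a finite set of marked points with at least one on each boundary component, $P$ a finite non-empty set of interior points (punctures). Excluded: once-punctured monogons, digons, triangles, and spheres with at most three punctures. A generalized arc is a curve up to isotopy joining points of $M\cup P$, possibly crossing itself; each end is tagged plain or notched (plain on $\partial S$; equal tags if the two ends coincide). $T=\{\tau_1,\dots,\tau_n\}$ is a triangulation. A multicurve is a finite collection $c$ of arcs, tagged arcs and closed curves; $x_c=\prod_{\gamma\in c}x_\gamma$. **Smoothing.** At a self-crossing point of $\gamma_1$ the two strands $\times$ are replaced by $\asymp$ or by $)($; each choice gives a multicurve, and the ends keep their tagging. **Cluster algebra.** It has initial seed $(\{x_1,\dots,x_n\},\{y_1,\dots,y_n\},Q_T)$ with principal coefficients; $Q_T$ has an arrow $i\to j$ for each triangle in which $\tau_i$ follows $\tau_j$ clockwise (a self-folded radius behaves like its enclosing loop); exchange relation $x_k'=(y_k\prod_{i\to k}x_i+\prod_{k\to i}x_i)/((y_k\oplus1)x_k)$. **Elements $x_\gamma$.** $x_\gamma=\frac1{\mathrm{cross}(\gamma,T)}\sum_P x(P)y(P)$ (the cluster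 variable for a simple tagged arc), the sum over perfect matchings of the graph $\mathcal G_\gamma$: for a plain curve crossing $\tau_{i_1},\dots,\tau_{i_d}$ it is the snake graph whose tile $G_j$ is the quadrilateral of $T$ with diagonal $\tau_{i_j}$ (deleted), embedded with the first triangle entered as lower left half, consecutive tiles glued along the third side of the triangle traversed; for a notched end at $q$, replace that end by a hook going once around $q$ crossing each arc of $T$ incident to $q$ once, and in the resulting snake graph glue the end tile of the hook to the tile adjacent to the hook (loop graph); for a closed curve it is the band graph obtained by gluing first and last tile (good matchings), and for a closed curve around a single puncture with incident arcs $\tau_{a_1},\dots,\tau_{a_r}$ one sets $x_\gamma=1+y_{a_1}\cdots y_{a_r}$. $\mathrm{cross}(\gamma,T)$ is the product of the $x_{\tau_{i_j}}$ over the tiles, $x(P)$ the product of the variables of the edges in $P$, $y(P)$ the product of the $y$ of the tiles enclosed by the symmetric difference of $P$ with the minimal matching (boundary edges only, containing the West edge of the first tile).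
   Formalization: A contractible kink left in a smoothed curve counts as a factor -1; Y^+ is a monomial in the weights of the tiles, so when T has a self-folded triangle with radius r at puncture p it may contain y_r/y_{r^(p)} (a Laurent monomial in the y-variables). *)

(* Defs.v *)
From mathcomp Require Import all_boot all_order all_algebra.
From mathcomp Require Import mpoly.

Set Implicit Arguments.
Unset Strict Implicit.
Unset Printing Implicit Defensive.

Import GRing.Theory.
Local Open Scope ring_scope.

(* A surface with an ideal triangulation {tau_0, .., tau_(n-1)} is given by    *)
(* its triangles, with the three sides 0, 1, 2 of each triangle listed         *)
(* counterclockwise (interior on the left).  A side is labelled by an arc      *)
(* tau_k, or by None when it lies on the boundary; every arc labels exactly    *)
(* two sides, which are glued so as to respect the orientation.  Two sides of  *)
(* one triangle may carry the same arc: the triangle is then self-folded.      *)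
Record tsurface := TSurface {
  ntri : nat;
  narc : nat;
  label : 'I_ntri * 'I_3 -> option 'I_narc;
  labelP : forall k : 'I_narc, #|[set d | label d == Some k]| = 2%N }.

Section Surface.
Variable T : tsurface.

Definition side := ('I_(ntri T) * 'I_3)%type.
Implicit Types (d a b c : side) (w u v : seq side).

Definition nx d : side := (d.1, ordS d.2).
Definition pv d : side := nx (nx d).

(* The side glued to d; boundary sides are their own opposite. *)
Definition opp d : side :=
  if label d is Some k then odflt d [pick e | (label e == Some k) && (e != d)]
  else d.

Definition interior d := label d != None.

(* Sides are oriented counterclockwise around their triangle, and a corner is  *)
(* named by the side that starts at it.  [rho] turns clockwise around the      *)
(* corner as long as it meets no boundary; in general its cycles are the       *)
(* punctures (no boundary side met) and the boundary components.               *)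
Definition rho d := nx (opp d).
Definition puncture c := all interior (orbit rho c).

Definition npunctures := fcard rho puncture.
Definition nboundaries := fcard rho [predC puncture].
Definition nmarked := #|[pred d | ~~ interior d]|.

(* Genus 0, from the Euler characteristic of the surface with its boundary     *)
(* components capped: vertices - edges + faces = 2, where                      *)
(* vertices = npunctures + nmarked and edges = narc + nmarked.                 *)
Definition planar :=
  (npunctures + ntri T + nboundaries == narc T + 2)%N.

Definition connected_surface :=
  forall d e, connect [rel a b : side | (a.1 == b.1) || (b == opp a)] d e.

(* Unpunctured digons and triangles are excluded by [0 < npunctures]. *)
Definition admissible_surface :=
  [/\ connected_surface,
      (0 < npunctures)%N,
      ~~ [&& planar, nboundaries == 0 & (npunctures <= 3)%N] &
      ~~ [&& planar, nboundaries == 1, nmarked == 1 & npunctures == 1]]%N.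

(* An ideal path: it leaves the corner [org], crosses the sides of [word] in   *)
(* turn (a side d being crossed from its own triangle into that of [opp d])    *)
(* and ends at the corner [dst] of the last triangle.                          *)
Record ipath := IPath { org : side; word : seq side; dst : side }.

Definition inv w := rev (map opp w).

Definition turn d e := (e == nx (opp d)) || (e == pv (opp d)).

(* Isotopy classes of generalized arcs, oriented, are the taut paths: no       *)
(* backtracking, and neither end runs along a side incident to its endpoint.   *)
(* When no side is crossed the arc is a side of a triangle.                    *)
Definition generalized_arc (g : ipath) :=
  if word g is d :: w' then
    [&& all interior (word g), path turn d w', org g == pv d
      & dst g == pv (opp (last d w'))]
  else (dst g == nx (org g)) || (org g == nx (dst g)).

Definition reduce w : seq side :=
  foldr (fun d s => if s is e :: s' then
                      if e == opp d then s' else d :: s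
                    else [:: d]) [::] w.

(* Unwinding the end at corner c: crossings of sides incident to c. *)
Fixpoint unfan c w : side * seq side :=
  if w is d :: w' then
    if d == c then unfan (rho c) w'
    else if d == pv c then unfan (opp d) w'
    else (c, w)
  else (c, w).

(* The taut path isotopic to a given one. *)
Definition tighten (g : ipath) : ipath :=
  let r := unfan (org g) (reduce (word g)) in
  let r' := unfan (dst g) (inv r.2) in
  IPath r.1 (inv r'.2) r'.1.

(* Closed curves are cyclic words of crossed sides. *)
Definition cyc_reduce w : seq side :=
  let strip v := if v is d :: v' then
                   if opp (last d v') == d then behead (belast d v') else v
                 else v in
  let r := reduce w in iter (size r) strip r.

(* A unit-square tile: lower left vertex, whether the orientation of the       *)
(* surface is preserved, and the crossed side, which is the deleted diagonal   *)
(* from the upper left to the lower right vertex.  The triangle that is left   *)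
(* is the lower left half, the one that is entered the upper right half.       *)
Definition tile := (nat * nat * bool * side)%type.

(* A labelled edge: its lower or left vertex, [true] if it is horizontal, and  *)
(* the side of T that it carries.                                              *)
Definition edge := (nat * nat * bool * side)%type.

Definition lower_half (t : tile) : seq edge :=
  let: (i, j, s, d) := t in
  [:: (i, j, false, if s then nx d else pv d);
      (i, j, true, if s then pv d else nx d)].

Definition upper_half (t : tile) : seq edge :=
  let: (i, j, s, d) := t in let e := opp d in
  [:: (i.+1, j, false, if s then nx e else pv e);
      (i, j.+1, true, if s then pv e else nx e)].

(* The next tile is glued along the side of the common triangle that is        *)
(* neither crossed on entering nor on leaving: the East or the North edge.     *)
Fixpoint tiles_from i j (s : bool) w : seq tile :=
  if w is d :: w' then
    (i, j, s, d) ::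
      (if w' is e :: _ then
         if e == (if s then nx (opp d) else pv (opp d))
         then tiles_from i j.+1 (~~ s) w' else tiles_from i.+1 j (~~ s) w'
       else [::])
  else [::].

Definition tiles := tiles_from 0 0 true.
Definition tile_edges w : seq edge :=
  flatten [seq lower_half t ++ upper_half t | t <- tiles w].

(* The edge type identifies the two copies of a shared edge. *)
Definition sedge w := seq_sub (tile_edges w).

Definition ends (e : edge) : seq (nat * nat) :=
  let: (i, j, h, _) := e in [:: (i, j); if h then (i.+1, j) else (i, j.+1)].

Definition perfect_matching w (P : {set sedge w}) :=
  all (fun p => #|[set e in P | p \in ends (ssval e)]| == 1%N)
      (flatten (map ends (tile_edges w))).

Definition has_edge w (P : {set sedge w}) (h : seq edge) c :=
  [exists e in P, (ssval e \in h) && ((ssval e).2 == c)].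

(* The perfect matching made of boundary edges that contains the West edge of  *)
(* the first tile.                                                             *)
Definition minimal_matching w : {set sedge w} :=
  odflt set0 [pick P : {set sedge w} |
    [&& perfect_matching P,
        [forall e in P, count_mem (ssval e) (tile_edges w) == 1%N]
      & [exists e in P, ssval e == head (ssval e) (tile_edges w)]]].

(* Point-in-polygon test: the horizontal ray going left from the tile meets    *)
(* an odd number of edges of D.                                                *)
Definition enclosed w (D : {set sedge w}) (t : tile) :=
  let: (i, j, _, _) := t in
  odd #|[set e in D | let: (i', j', h, _) := ssval e in
                      [&& ~~ h, j' == j & (i' <= i)%N]]|.

Definition tiles_enclosed w (P : {set sedge w}) : seq tile :=
  let M := minimal_matching w in
  [seq t <- tiles w | enclosed ((P :\: M) :|: (M :\: P)) t].

Section Expansion.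
Variables (F : fieldType) (x y : 'I_(narc T) -> F).

Definition xlab d : F := if label d is Some k then x k else 1.
Definition ylab d : F := if label d is Some k then y k else 1.

(* d is the outer side of a self-folded triangle. *)
Definition encloses d := opp (nx d) == pv d.

(* A loop l of T that encloses a radius r at the puncture p is not itself a    *)
(* tagged arc: its index carries the seed variables of r notched at p, with    *)
(* x_l = x_r * x_(r notched at p).  Boundary segments weigh 1.                 *)
Definition xside d : F :=
  xlab d * (if encloses d then xlab (nx d)
            else if encloses (opp d) then xlab (nx (opp d)) else 1).

(* Correspondingly the tile of the radius r weighs y_r / y_(r notched at p),   *)
(* and the tile of l weighs y_(r notched at p).                                *)
Definition yside d : F :=
  if opp d == nx d then ylab d / ylab (pv d)
  else if opp d == pv d then ylab d / ylab (nx d)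
  else ylab d.

Definition crossing_monomial w : F := \prod_(d <- w) xside d.
Definition xmatching w (P : {set sedge w}) : F := \prod_(e in P) xside (ssval e).2.
Definition ymatching w (P : {set sedge w}) : F :=
  \prod_(t <- tiles_enclosed P) yside t.2.

Definition matching_sum w (good : pred {set sedge w}) : F :=
  (\sum_(P : {set sedge w} | perfect_matching P && good P)
     xmatching P * ymatching P) / crossing_monomial w.

Definition xplain w : F := matching_sum (w := w) xpredT.

(* Good matchings of a graph glued from a snake graph along copies e, e' of    *)
(* one edge are the perfect matchings of the snake graph that contain e or e', *)
(* with this edge then counted once less.                                      *)
Definition good_glue w (P : {set sedge w}) (h h' : seq edge) c :=
  has_edge P h c || has_edge P h' c.

(* A hook at a puncture crosses, clockwise, the sides [orbit rho c] issued     *)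
(* from its corner c, back to the triangle it started from, and the word of    *)
(* the hooked curve begins (resp. ends) with it.  Its end tile and the tile    *)
(* next to the hook are glued along a side of that triangle.                   *)
Definition hook (n : bool) c := if n then orbit rho c else [::].

Definition xhooked (g : ipath) (n0 n1 : bool) : F :=
  let h0 := hook n0 (org g) in
  let h1 := hook n1 (dst g) in
  let w := h0 ++ word g ++ h1 in
  let lo k := nth [::] (map lower_half (tiles w)) k in
  let up k := nth [::] (map upper_half (tiles w)) k in
  let c0 := pv (org g) in
  let c1 := dst g in
  matching_sum (w := w) (fun P =>
    (n0 ==> good_glue P (lo 0%N) (lo (size h0)) c0) &&
    (n1 ==> good_glue P (up (size h0 + size (word g)).-1) (up (size w).-1) c1))
  / ((if n0 then xside c0 else 1) * (if n1 then xside c1 else 1)).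

(* The arc of T carried by the side a, run from the corner a to the next one.  *)
(* Since it crosses no arc of T, a hook has no adjacent tile, and the tagged   *)
(* cluster variables are obtained from the loop around the notched end, which  *)
(* crosses all other sides issued from it: x_loop = x_a * x_(a notched), and,  *)
(* when both ends p and q are notched,                                         *)
(*   x_a x_(a notched at p, q)                                                 *)
(*      = y_a x_(a notched at p) x_(a notched at q) + (1 - Y_p) (1 - Y_q)      *)
(* where Y_p is the product of the y of the arcs incident to p.                *)
Definition xaround a : F := xplain (behead (orbit rho a)).
Definition yaround a : F := \prod_(d <- orbit rho a) yside d.

Definition xarc_of_T a (n0 n1 : bool) : F :=
  let xp := xaround a / xside a in
  let xq := xaround (opp a) / xside a in
  match n0, n1 with
  | false, false => xside a
  | true, false => xp
  | false, true => xq
  | true, true =>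
    (yside a * xp * xq + (1 - yaround a) * (1 - yaround (opp a))) / xside a
  end.

(* The second argument says which ends are notched.  A path that contracts to  *)
(* a point has value 0.                                                        *)
Definition xarc (g : ipath) (n : bool * bool) : F :=
  let g' := tighten g in
  if word g' is [::] then
    if org g' == dst g' then 0
    else if dst g' == nx (org g') then xarc_of_T (org g') n.1 n.2
    else xarc_of_T (opp (dst g')) n.1 n.2
  else xhooked g' n.1 n.2.

(* The first and the last tile of a band graph are glued along the third side  *)
(* of the triangle in which the closed curve is cut.                           *)
Definition xband w : F :=
  if w is d :: w' then
    let a := opp (last d w') in
    let c := if d == pv a then nx a else pv a in
    let lo := head [::] (map lower_half (tiles w)) in
    let up := last [::] (map upper_half (tiles w)) in
    matching_sum (w := w) (fun P => good_glue P lo up c) / xside c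
  else 1.

Definition around_puncture w :=
  if w is d :: _ then puncture d && (w == orbit rho d) else false.

(* Contractible closed curves have value -2. *)
Definition xloop w : F :=
  let v := cyc_reduce w in
  if v is [::] then - 2%:R
  else if around_puncture v || around_puncture (inv v)
  then 1 + \prod_(d <- v) yside d
  else xband v.

(* A contractible kink contributes a factor -1. *)
Inductive component :=
  | Arc of ipath & bool * bool & bool (* path, notched ends, odd kinks? *)
  | Loop of seq side.
Definition multicurve := seq component.

Definition xcomponent (c : component) : F :=
  match c with
  | Arc g n kink => (-1) ^+ kink * xarc g n
  | Loop w => xloop w
  end.

Definition xmulti (c : multicurve) : F := \prod_(g <- c) xcomponent g.

(* y_k, except for a radius r, whose tile weighs y_r / y_(r notched at p).     *)
(* Smoothings at strands that wind around such a puncture p involve            *)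
(* y_r / y_(r notched at p) alone, so that monomials are taken in the ytile.   *)
Definition ytile (k : 'I_(narc T)) : F :=
  if [pick d | label d == Some k] is Some d then yside d else 1.

End Expansion.

(* The places where a strand may leave a triangle, in counterclockwise order:  *)
(* corner d is (d, false), the interior of side d is (d, true).                *)
Definition place := (side * bool)%type.
Definition next_place (p : place) : place :=
  if p.2 then (nx p.1, false) else (p.1, true).
Definition ccw (p q r : place) :=
  [&& (0 < findex next_place p q)%N,
      (findex next_place p q < findex next_place p r)%N
    & fconnect next_place p r].

(* The part of a path that runs from inside one of the triangles it visits to  *)
(* one of its ends: the sides still to be crossed and the final corner.        *)
Definition ray := (seq side * side)%type.
Definition exit (r : ray) : place :=
  if r.1 is d :: _ then (d, true) else (r.2, false).

(* Two rays seen from the place b behind them: where they part, the first one  *)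
(* turns off to the right of the second.                                       *)
Fixpoint right_of (b : place) u cu v cv : bool :=
  match u, v with
  | d :: u', e :: v' =>
      if d == e then right_of (opp d, true) u' cu v' cv
      else ccw b (d, true) (e, true)
  | _, _ => ccw b (exit (u, cu)) (exit (v, cv))
  end.

Definition first_side (f f' : ray) : option side :=
  if ohead f.1 == ohead f'.1 then ohead f.1 else None.

(* Two strands in minimal position, cut in a common triangle into backward     *)
(* rays p, p' and forward rays f, f', part in that triangle going backward and *)
(* cross: either inside that triangle, or because they run in parallel from it *)
(* until they part again, having exchanged left and right.                     *)
Definition strands_cross (p f p' f' : ray) : bool :=
  if first_side f f' is Some d then
    let b := (d, true) in
    [|| ccw b (exit p) (exit p') && right_of b f.1 f.2 f'.1 f'.2
      | ccw b (exit p') (exit p) && right_of b f'.1 f'.2 f.1 f.2]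
  else
    let: (s, t) := (exit p, exit f) in
    let: (s', t') := (exit p', exit f') in
    [|| ccw s s' t && ccw t t' s | ccw s t' t && ccw t s' s].

(* Position i of a path is in the triangle visited after i crossings. *)
Definition backward (g : ipath) i : ray := (inv (take i (word g)), org g).
Definition forward (g : ipath) i : ray := (drop i (word g), dst g).

(* The strands of g at positions i < j cross, running in the same direction or *)
(* in opposite ones.  Every self-crossing of g in minimal position is          *)
(* represented by exactly one such pair.                                       *)
Definition self_crossing (g : ipath) i j :=
  (i < j <= size (word g))%N &&
  (strands_cross (backward g i) (forward g i) (backward g j) (forward g j)
   || strands_cross (backward g i) (forward g i) (forward g j) (backward g j)).

(* The crossing cuts g into initial, middle (closed) and final parts.  One     *)
(* smoothing detaches the middle part, the other one runs backward through it. *)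
Definition initial_part (g : ipath) i := take i (word g).
Definition middle_part (g : ipath) i j := drop i (take j (word g)).
Definition final_part (g : ipath) j := drop j (word g).

Definition smooth_detach (g : ipath) (n : bool * bool) i j : multicurve :=
  [:: Arc (IPath (org g) (initial_part g i ++ final_part g j) (dst g)) n false;
      Loop (middle_part g i j)].

(* When the two strands are parallel, running backward through the middle part *)
(* makes a U-turn on the common first side d, to the right iff the backward    *)
(* ray at i is to the left of that at j.  Pulling it tight leaves a kink iff   *)
(* the strand coming out of the U-turn parts from the strand going into it on  *)
(* the other side.                                                             *)
Definition kinked (g : ipath) i j : bool :=
  if first_side (forward g i) (forward g j) is Some d then
    ccw (d, true) (exit (backward g i)) (exit (backward g j)) !=
    right_of (d, true) (middle_part g i j ++ inv (initial_part g i)) (org g)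
                       (final_part g j) (dst g)
  else false.

Definition smooth_reverse (g : ipath) (n : bool * bool) i j : multicurve :=
  [:: Arc (IPath (org g)
             (initial_part g i ++ inv (middle_part g i j) ++ final_part g j)
             (dst g)) n (kinked g i j)].

(* Only punctures carry notches, coinciding ends are tagged equally, and no    *)
(* notch is at a puncture enclosed by a self-folded triangle of T, i.e. with a *)
(* single incident side.                                                       *)
Definition notchable c := puncture c && (rho c != c).
Definition tagging (g : ipath) (n : bool * bool) :=
  [/\ n.1 -> notchable (org g), n.2 -> notchable (dst g) &
      dst g \in orbit rho (org g) -> n.1 = n.2].

Definition ambient := {fraction {mpoly rat[narc T + narc T]}}.
Definition xvar (k : 'I_(narc T)) : ambient :=
  tofrac 'X_(lshift (narc T) k).
Definition yvar (k : 'I_(narc T)) : ambient :=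
  tofrac 'X_(rshift (narc T) k).

End Surface.

(* Main.v *)
(* Attach to each corner of a triangle a vector of the plane so that the two
   ends of a side c have determinant x_c, and to each side d a 2x2 matrix that
   glues the two triangles along d and carries y_d. Multiplying these matrices
   along a path sums over the perfect matchings of its snake graph: the states
   of the tiles (which pair of opposite edges is used) are the entries of the
   transfer matrices. Hence x_gamma is, up to a sign, det(a, A b) where A is the
   matrix of the word of gamma and a, b are the vectors of its end corners; a
   notched end is the vector obtained from the corners around the puncture
   ([hat]), and closed curves are traces. Writing A = A1 A2 A3 at the crossing,
   Cayley-Hamilton gives
     A1 A2 A3 = tr(A2) A1 A3 - A1 adj(A2) A3,
   the two terms being the two smoothings. The signs count turns and are settled
   by the cyclic order of the strands in a triangle; cancelling a backtrack
   d (opp d) multiplies by - y_d, so pulling a smoothing tight costs a monomial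
   in y, and a case analysis shows that one of the two costs nothing. *)

From Pilot Require Import Defs.
From mathcomp Require Import all_boot all_order all_algebra.
From mathcomp Require Import ring.

Set Implicit Arguments.
Unset Strict Implicit.
Unset Printing Implicit Defensive.

Import GRing.Theory Pilot.Defs.

(** * Sides, opposite sides, and words of crossed sides *)

Section Sides.
Variable T : tsurface.
Local Notation side := (side T).
Implicit Types (c d e : side) (u v w : seq side).

(** The obstacle is that [xarc] reads its value off a tight path, while Cayley-Hamilton yields the
    smoothings as they come out of the cut. Between the two lies unwinding at the ends. A gluing
    matrix matches one pair of shared end vectors exactly and the other only up to [- Y d], so
    unwinding a plain end is free in one direction and costs [Y d] per side in the other. The
    notched vector is the second eigenvector of the turn around the puncture, and for it the free
    direction is the opposite one. The given arc leaves its ends through the opposite sides, so at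
    an end only a smoothing that changes the first or last side can cost anything. If the strands
    run in parallel, one smoothing keeps both of these sides. If they cross inside one triangle,
    four distinct places do not fit on three sides, so an end lies at a corner there; the two
    smoothings turn off from it in opposite directions, one of which is free. Signs arise because
    the vectors of a triangle treat its corners alike and therefore surround the origin. *)

Lemma opp_boundary d : ~~ interior d -> opp d = d.
Proof. by rewrite /opp /interior; case: (label d). Qed.

Lemma opp_spec d : interior d ->
  [/\ label (opp d) = label d, opp d != d &
      forall e, label e = label d -> e = d \/ e = opp d].
Proof.
rewrite /opp /interior; case E: (label d) => [k|] // _.
have := labelP k; case: pickP => [e /andP[/eqP le ned] | no] /=.
  move=> card2; split=> // f lf.
  have [->|nfd] := eqVneq f d; first by left.
  have [->|nfe] := eqVneq f e; first by right.
  have : [set d; e; f] \subset [set d0 | label d0 == Some k].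
    by apply/subsetP=> z; rewrite !inE => /orP[/orP[]|] /eqP-> ; apply/eqP.
  move/subset_leq_card; rewrite card2 -setUA cardsU1 cards2 !inE.
  by rewrite eq_sym (negbTE ned) eq_sym (negbTE nfd) eq_sym (negbTE nfe).
have -> : [set d0 | label d0 == Some k] = [set d].
  apply/setP=> z; rewrite !inE; apply/idP/eqP=> [lz|->]; last by rewrite E.
  by move: (no z); rewrite lz /= => /negbFE/eqP.
by rewrite cards1.
Qed.

Lemma label_opp d : label (opp d) = label d.
Proof.
by have [/opp_spec[]|/opp_boundary->] := boolP (interior d).
Qed.

Lemma interior_opp d : interior (opp d) = interior d.
Proof. by rewrite /interior label_opp. Qed.

Lemma oppK : involutive (@opp T).
Proof.
move=> d; have [di|db] := boolP (interior d); last by rewrite !opp_boundary.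
have odi : interior (opp d) by rewrite interior_opp.
have [_ ne1 al1] := opp_spec di; have [l2 ne2 _] := opp_spec odi.
have /al1[->//|E] : label (opp (opp d)) = label d by rewrite !label_opp.
by rewrite E eqxx in ne2.
Qed.

Lemma opp_neq d : interior d -> (opp d == d) = false.
Proof. by case/opp_spec=> _ /negbTE. Qed.

Lemma neq_opp d : interior d -> (d == opp d) = false.
Proof. by rewrite eq_sym; apply: opp_neq. Qed.

Lemma nxE d : nx (nx (nx d)) = d.
Proof.
case: d => t [[|[|[|k]]] lk] //; rewrite /nx /=; congr (_, _); exact: val_inj.
Qed.

Lemma nx_neq d : (nx d == d) = false.
Proof.
by case: d => t [[|[|[|k]]] lk] //; rewrite /nx xpair_eqE /= andbC -val_eqE.
Qed.

Lemma pv_neq d : (pv d == d) = false.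
Proof.
by case: d => t [[|[|[|k]]] lk] //; rewrite /pv /nx xpair_eqE /= andbC -val_eqE.
Qed.

Lemma nxK : cancel (@nx T) (@pv T). Proof. exact: nxE. Qed.
Lemma pvK : cancel (@pv T) (@nx T). Proof. exact: nxE. Qed.
Lemma nx_inj : injective (@nx T). Proof. exact: can_inj nxK. Qed.
Lemma pv_pv d : pv (pv d) = nx d.
Proof. by rewrite /pv nxE. Qed.
Lemma nx_nx d : nx (nx d) = pv d. Proof. by []. Qed.
Lemma nx_pv d : nx (pv d) = d. Proof. exact: pvK. Qed.
Lemma pv_nx d : pv (nx d) = d. Proof. exact: nxK. Qed.
Lemma neq_nx d : (d == nx d) = false. Proof. by rewrite eq_sym nx_neq. Qed.
Lemma neq_pv d : (d == pv d) = false. Proof. by rewrite eq_sym pv_neq. Qed.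
Lemma nx_pv_neq d : (nx d == pv d) = false.
Proof. by rewrite /pv (inj_eq nx_inj) neq_nx. Qed.
Lemma pv_nx_neq d : (pv d == nx d) = false.
Proof. by rewrite eq_sym nx_pv_neq. Qed.
Lemma rho_inj : injective (@rho T).
Proof. by move=> c d /nx_inj/(can_inj oppK). Qed.

Lemma triangle_cases d e : e.1 = d.1 -> [\/ e = d, e = nx d | e = pv d].
Proof.
case: d e => [t [[|[|[|k]]] lk]] // [t' [[|[|[|k']]] lk']] //= ->;
  do ?[by apply: Or31; congr (_, _); apply: val_inj
      |by apply: Or32; congr (_, _); apply: val_inj
      |by apply: Or33; congr (_, _); apply: val_inj].
Qed.

Lemma nx1 d : (nx d).1 = d.1. Proof. by []. Qed.
Lemma pv1 d : (pv d).1 = d.1. Proof. by []. Qed.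

Lemma turnP d e : turn d e -> e = nx (opp d) \/ e = pv (opp d).
Proof. by case/orP=> /eqP; [left | right]. Qed.

Lemma turnE d e : turn d e = (e.1 == (opp d).1) && (e != opp d).
Proof.
apply/idP/andP=> [/turnP[]->|[/eqP/triangle_cases[]-> //]].
- by rewrite nx1 nx_neq.
- by rewrite pv1 pv_neq.
- by rewrite eqxx.
- by rewrite /turn eqxx.
by rewrite /turn eqxx orbT.
Qed.

Lemma turn_inv d e : turn d e -> turn (opp e) (opp d).
Proof.
by rewrite !turnE oppK => /andP[/eqP-> ne]; rewrite eqxx eq_sym.
Qed.

Lemma inv_cat u v : inv (u ++ v) = inv v ++ inv u.
Proof. by rewrite /inv map_cat rev_cat. Qed.
Lemma inv_cons d u : inv (d :: u) = rcons (inv u) (opp d).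
Proof. by rewrite /inv /= rev_cons. Qed.
Lemma inv_rcons u d : inv (rcons u d) = opp d :: inv u.
Proof. by rewrite /inv map_rcons rev_rcons. Qed.
Lemma invK : involutive (@inv T).
Proof.
by move=> u; rewrite /inv map_rev revK -map_comp map_id_in // => d _ /=; rewrite oppK.
Qed.
Lemma size_inv u : size (inv u) = size u.
Proof. by rewrite size_rev size_map. Qed.
Lemma all_interior_inv u : all (@interior T) (inv u) = all (@interior T) u.
Proof. by rewrite all_rev all_map; apply: eq_all => d /=; rewrite interior_opp. Qed.

(** The condition that [generalized_arc] puts on words, separated from the conditions at the two
    ends: smoothings and hooked words satisfy it piecewise. *)
Definition dualpath w := all (@interior T) w && (if w is d :: w' then path (@turn T) d w' else true).

Lemma dualpath_cons d e w :
  dualpath (d :: e :: w) = [&& interior d, turn d e & dualpath (e :: w)].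
Proof. by rewrite /dualpath /=; case: interior; case: (turn d e); rewrite ?andbF. Qed.

Lemma dualpath_cons1 d w : dualpath (d :: w) -> dualpath w.
Proof.
by case: w => [//|e w]; rewrite dualpath_cons => /and3P[].
Qed.

Lemma dualpath_catE d u e v :
  dualpath ((d :: u) ++ e :: v) =
  [&& dualpath (d :: u), turn (last d u) e & dualpath (e :: v)].
Proof.
rewrite /dualpath /= all_cat cat_path /=.
by case: interior; case: all; case: path; case: turn; rewrite ?andbF //.
Qed.

Lemma dualpath_catl u v : dualpath (u ++ v) -> dualpath u.
Proof.
case: u v => [//|d u] [|e v]; first by rewrite cats0.
by rewrite dualpath_catE => /and3P[].
Qed.

Lemma dualpath_catr u v : dualpath (u ++ v) -> dualpath v.
Proof. by elim: u => [//|d u IH] /dualpath_cons1. Qed.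

Lemma dualpath_inv w : dualpath (inv w) = dualpath w.
Proof.
rewrite /dualpath all_interior_inv; congr (_ && _).
wlog suff H : w / (if w is d :: w' then path (@turn T) d w' else true) ->
         (if inv w is d :: w' then path (@turn T) d w' else true).
  by apply/idP/idP => [/H|/H]; rewrite ?invK.
case: w => [//|d w]; rewrite /inv rev_cons -map_rev.
elim: w d => [|e w IH] d //= /andP[de pw].
have := IH _ pw; rewrite rev_cons.
case: (rev w) => [|f v] /=; rewrite ?turn_inv //.
by rewrite !map_rcons !rcons_path !last_rcons turn_inv // andbT.
Qed.

Lemma rev_last_inv d w e : last e (inv (d :: w)) = opp d.
Proof. by rewrite inv_cons last_rcons. Qed.

Lemma head_inv d w e : head e (inv (d :: w)) = opp (last d w).
Proof. by rewrite lastI inv_rcons. Qed.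

Lemma rho_opp d : rho (opp d) = nx d. Proof. by rewrite /rho oppK. Qed.

Lemma puncture_interior c : puncture c -> interior c.
Proof. by move/allP; apply; rewrite -fconnect_orbit connect0. Qed.

End Sides.

(** * Perfect matchings of a graph with one more tile attached *)

Section GluePerfect.
Variables (V E : eqType) (bd : E -> seq V).
Implicit Types (p : pred E) (L : seq E).

Definition degree p L v := count (fun f => p f && (v \in bd f)) L.
Arguments degree : simpl never.
Definition perfect p L := all (fun v => degree p L v == 1) (flatten (map bd L)).

Lemma eq_perfect p p' L : {in L, p =1 p'} -> perfect p L = perfect p' L.
Proof.
by move=> eqp; apply: eq_all => v; congr (_ == _); apply: eq_in_count => f /eqp->.
Qed.

Lemma degree_notin p L v : v \notin flatten (map bd L) -> degree p L v = 0.
Proof.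
move=> nv; apply/eqP; rewrite -leqn0 leqNgt -has_count; apply/hasPn => f fL.
by apply: contra nv => /andP[_ vf]; apply/flatten_mapP; exists f.
Qed.

(* The graph consists of [L] and a path [a], [m], [b] joining the ends of the  *)
(* edge [g] of [L] through two new vertices [o] and [r].                        *)
Lemma perfect_glue p p' L m a b g o r g1 g2 :
  uniq L -> g \in L -> o \notin flatten (map bd L) ->
  r \notin flatten (map bd L) -> o != r ->
  bd m =i [:: o; r] -> bd a =i [:: o; g1] -> bd b =i [:: r; g2] ->
  bd g =i [:: g1; g2] -> g1 != g2 ->
  {in L, forall f, f != g -> p' f = p f} -> p' g = p g || p a ->
  perfect p [:: m, a, b & L] =
    [&& p a == ~~ p m, p b == ~~ p m, ~~ (p g && p a) & perfect p' L].
Proof.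
move=> uL gL oL rL or_ bm ba bb bg g12 p'E p'g.
have inL v : v \in flatten (map bd L) -> (v != o) && (v != r).
  by move=> vL; rewrite (memPn oL) // (memPn rL).
have gVL v : v \in bd g -> v \in flatten (map bd L).
  by move=> vg; apply/flatten_mapP; exists g.
have [g1L g2L] : g1 \in flatten (map bd L) /\ g2 \in flatten (map bd L).
  by split; apply: gVL; rewrite bg !inE eqxx ?orbT.
have degE v : degree p [:: m, a, b & L] v =
   ((p m && (v \in [:: o; r])) + ((p a && (v \in [:: o; g1])) +
     ((p b && (v \in [:: r; g2])) + degree p L v)))%N.
  by rewrite /degree /= bm ba bb.
have dego : degree p [:: m, a, b & L] o = (p m + p a)%N.
  rewrite degE (degree_notin _ oL) !inE eqxx (negbTE or_) /= !andbT.
  have /andP[/negbTE] := inL _ g2L; rewrite eq_sym => -> _.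
  by rewrite andbF !addn0.
have degr : degree p [:: m, a, b & L] r = (p m + p b)%N.
  rewrite degE (degree_notin _ rL) !inE eqxx orbT eq_sym (negbTE or_) /= !andbT.
  have /andP[_ /negbTE] := inL _ g1L; rewrite eq_sym => ->.
  by rewrite andbF !addn0.
have degL v : v \in flatten (map bd L) -> degree p [:: m, a, b & L] v =
   ((p a && (v == g1)) + ((p b && (v == g2)) + degree p L v))%N.
  by move=> /inL/andP[/negbTE vo /negbTE vr]; rewrite degE !inE vo vr /= andbF.
(* Choosing [a] and [b] covers the two ends of [g] exactly as choosing [g] would, so on [L] the
   predicate [p'] replaces this choice by [g]. *)
have deg' v : ~~ (p g && p a) ->
    degree p' L v = (degree p L v + (p a && (v \in bd g)))%N.
  move=> npp; rewrite /degree -(cat_take_drop (index g L) L).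
  have gs : (index g L < size L)%N by rewrite index_mem.
  rewrite (drop_nth g gs) nth_index // !count_cat /= p'g.
  have ut : g \notin take (index g L) L.
    by rewrite in_take // ltnn.
  have ud : g \notin drop (index g L).+1 L.
    move: uL; rewrite -{1}(cat_take_drop (index g L) L) (drop_nth g gs) nth_index //.
    by rewrite cat_uniq /= => /and3P[_ _ /andP[]].
  have cE (s : seq E) : {subset s <= L} -> g \notin s ->
      count (fun f => p' f && (v \in bd f)) s =
      count (fun f => p f && (v \in bd f)) s.
    move=> sL gs'; apply: eq_in_count => f fs; rewrite p'E ?sL //.
    by apply: contraNneq gs' => <-.
  rewrite !cE //; last 2 first.
  - exact: mem_drop.
  - exact: mem_take.
  rewrite -addnA; congr (_ + _)%N; rewrite addnAC; congr (_ + _)%N.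
  by move: npp; case: (p g); case: (p a); case: (v \in bd g).
have allE : perfect p [:: m, a, b & L] =
   [&& (p m + p a == 1)%N, (p m + p b == 1)%N &
       all (fun v => degree p [:: m, a, b & L] v == 1%N) (flatten (map bd L))].
  rewrite /perfect; apply/allP/and3P => [H | [H1 H2 H3] v].
    split; [rewrite -dego | rewrite -degr |]; try apply: H.
    - by apply/flatten_mapP; exists m; rewrite ?bm !inE eqxx.
    - by apply/flatten_mapP; exists m; rewrite ?bm !inE eqxx ?orbT.
    apply/allP=> v /flatten_mapP[f fL vf]; apply: H.
    by apply/flatten_mapP; exists f; rewrite // !inE fL !orbT.
  rewrite /= !mem_cat bm ba bb !inE => vin.
  have {vin} : [|| v == o, v == r | v \in flatten (map bd L)].
    move: vin; case: (v == o); case: (v == r) => //=.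
    by case/or3P=> // /eqP->.
  by case/or3P=> [/eqP->|/eqP->|/(allP H3)//]; rewrite ?dego ?degr.
rewrite allE.
have -> : (p m + p a == 1)%N = (p a == ~~ p m) by case: (p m); case: (p a).
have -> : (p m + p b == 1)%N = (p b == ~~ p m) by case: (p m); case: (p b).
case pam: (p a == ~~ p m) => //=; case pbm: (p b == ~~ p m) => //=.
have pab : p b = p a by rewrite (eqP pam) (eqP pbm).
have [/andP[pg pa]|npp] /= := boolP (p g && p a).
  apply/negP => /allP/(_ _ g1L); rewrite degL // pa eqxx /= => /eqP[].
  move=> H; have : (degree p L g1 > 0)%N.
    by rewrite -has_count; apply/hasP; exists g; rewrite // pg bg !inE eqxx.
  by rewrite lt0n; case: (degree p L g1) H => // k; rewrite addnS.
apply: eq_in_all => v vL; rewrite degL // deg' // bg !inE pab addnA addnC.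
congr (_ + _ == _)%N; have [->|] := eqVneq v g1.
  by rewrite (negbTE g12) andbF andbT addn0.
by rewrite andbF.
Qed.

End GluePerfect.

Arguments degree : simpl never.

Definition succ_eqF n := (gtn_eqF (ltnSn n), ltn_eqF (ltnSn n)).

(** * Perfect matchings of a snake graph encoded by one bit per tile *)

Section Snake.
Variable T : tsurface.
Local Notation side := (side T).
Local Notation edge := (edge T).
Implicit Types (c d e : side) (u v w : seq side) (z : bool) (zs : seq bool).

Definition westE i j s d : edge := (i, j, false, if s then nx d else pv d).
Definition southE i j s d : edge := (i, j, true, if s then pv d else nx d).
Definition eastE i j s d : edge :=
  (i.+1, j, false, if s then nx (opp d) else pv (opp d)).
Definition northE i j s d : edge :=
  (i, j.+1, true, if s then pv (opp d) else nx (opp d)).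

Definition north (s : bool) d e := e == (if s then nx (opp d) else pv (opp d)).

(* The edges of the snake graph without repetition: each tile contributes the  *)
(* edges that are not in the following tile.                                   *)
Fixpoint snake i j (s : bool) w : seq edge :=
  if w is d :: w' then
    if w' is e :: _ then
      if north s d e then
        [:: southE i j s d, westE i j s d, eastE i j s d & snake i j.+1 (~~ s) w']
      else [:: westE i j s d, southE i j s d, northE i j s d & snake i.+1 j (~~ s) w']
    else [:: westE i j s d; southE i j s d; eastE i j s d; northE i j s d]
  else [::].

(* In state [z], a tile contributes its vertical edges iff [s (+) z].          *)
Definition tile_has (s z h : bool) := h (+) s (+) z.

(** An edge common to two tiles is matched iff it belongs to the states of both. As the orientation
    [s] alternates, for linked states this happens exactly when the two bits differ, whence the
    exclusive or. *)
Fixpoint matching i j (s : bool) w zs (f : edge) : bool :=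
  if w is d :: w' then
    if w' is e :: _ then
      let nth := north s d e in
      let g := if nth then northE i j s d else eastE i j s d in
      let f3 := if nth then eastE i j s d else northE i j s d in
      if f == g then head false zs (+) head false (behead zs)
      else if f \in [:: westE i j s d; southE i j s d; f3]
      then tile_has s (head false zs) f.1.2
      else if nth then matching i j.+1 (~~ s) w' (behead zs) f
           else matching i.+1 j (~~ s) w' (behead zs) f
    else tile_has s (head false zs) f.1.2
  else false.

(* The common edge of consecutive tiles must belong to one of the two states.  *)
Definition link d e z z' := if e == nx (opp d) then z || ~~ z' else ~~ z || z'.
Fixpoint linked w zs :=
  if w is d :: w' then
    (if w' is e :: _ then link d e (head false zs) (head false (behead zs)) else true)
    && linked w' (behead zs)
  else true.

Lemma snake_cons2 i j s d e w : snake i j s [:: d, e & w] =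
  if north s d e then
    [:: southE i j s d, westE i j s d, eastE i j s d & snake i j.+1 (~~ s) (e :: w)]
  else [:: westE i j s d, southE i j s d, northE i j s d & snake i.+1 j (~~ s) (e :: w)].
Proof. by []. Qed.
Lemma snake1 i j s d : snake i j s [:: d] =
  [:: westE i j s d; southE i j s d; eastE i j s d; northE i j s d].
Proof. by []. Qed.
Arguments snake : simpl never.

Lemma matching_cons2 i j s d e w zs f : matching i j s [:: d, e & w] zs f =
  let g := if north s d e then northE i j s d else eastE i j s d in
  let f3 := if north s d e then eastE i j s d else northE i j s d in
  if f == g then head false zs (+) head false (behead zs)
  else if f \in [:: westE i j s d; southE i j s d; f3]
  then tile_has s (head false zs) f.1.2
  else if north s d e then matching i j.+1 (~~ s) (e :: w) (behead zs) f
       else matching i.+1 j (~~ s) (e :: w) (behead zs) f.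
Proof. by []. Qed.
Arguments matching : simpl never.

Lemma snake_pos i j s w f : f \in snake i j s w ->
  (i <= f.1.1.1)%N && (j <= f.1.1.2)%N.
Proof.
elim: w i j s => [//|d [|e w] IH] i j s.
  by rewrite snake1 !inE => /or4P[] /eqP-> /=; rewrite ?leqnn ?leqnSn.
rewrite snake_cons2; case: ifP => _; rewrite in_cons => /orP[/eqP->|];
  rewrite ?leqnn ?leqnSn // in_cons => /orP[/eqP->|];
  rewrite ?leqnn ?leqnSn // in_cons => /orP[/eqP->|];
  rewrite ?leqnn ?leqnSn // => /IH/andP[h1 h2]; apply/andP; split=> //; exact: ltnW.
Qed.

Lemma ends_pos (f : edge) x : x \in ends f -> (f.1.1.1 <= x.1)%N && (f.1.1.2 <= x.2)%N.
Proof.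
case: f => [[[i j] h] c]; rewrite /ends !inE => /orP[] /eqP-> /=; rewrite ?leqnn //.
by case: h; rewrite /= ?leqnn ?leqnSn.
Qed.

Lemma snake_vertex_pos i j s w x : x \in flatten (map (@ends T) (snake i j s w)) ->
  (i <= x.1)%N && (j <= x.2)%N.
Proof.
case/flatten_mapP=> f /snake_pos/andP[h1 h2] /ends_pos/andP[h3 h4].
by rewrite (leq_trans h1) ?(leq_trans h2).
Qed.

Lemma head_snake i j s d w :
  (westE i j s d \in snake i j s (d :: w)) /\ (southE i j s d \in snake i j s (d :: w)).
Proof.
by case: w => [|e w]; rewrite ?snake1 ?snake_cons2; [|case: ifP => _]; rewrite !inE !eqxx ?orbT.
Qed.

(** Reversing [s] from tile to tile is what makes both descriptions of the glued edge carry the same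
    side of the triangulation, so that it is one element of [edge]. *)
Lemma north_shared i j s d e : turn d e -> north s d e ->
  northE i j s d = southE i j.+1 (~~ s) e.
Proof.
rewrite /north /northE /southE => /turnP[]->; case: s; rewrite ?nx_pv_neq ?pv_nx_neq //=.
by move=> _; rewrite pv_pv.
Qed.

Lemma east_shared i j s d e : turn d e -> ~~ north s d e ->
  eastE i j s d = westE i.+1 j (~~ s) e.
Proof.
rewrite /north /eastE /westE => /turnP[]->; case: s; rewrite ?eqxx //=.
by move=> _; rewrite pv_pv.
Qed.

Lemma snake_uniq i j s w : dualpath w -> uniq (snake i j s w).
Proof.
elim: w i j s => [//|d [|e w] IH] i j s.
  by rewrite snake1 /= !inE /westE /southE /eastE /northE !xpair_eqE ?succ_eqF !andbF.
rewrite dualpath_cons => /and3P[_ de dp]; rewrite snake_cons2.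
case: ifP => _; rewrite !cons_uniq IH // andbT !inE;
  rewrite /westE /southE /eastE /northE !xpair_eqE ?succ_eqF !andbF /=;
  do ?[apply/andP; split]; by apply/negP=> /snake_pos; rewrite /= ltnn ?andbF.
Qed.

Lemma matching_low i j s d w zs f :
  f \in [:: westE i j s d; southE i j s d] ->
  matching i j s (d :: w) zs f = tile_has s (head false zs) f.1.2.
Proof.
case: w => [//|e w] fin; rewrite matching_cons2 /=.
have -> : (f == (if north s d e then northE i j s d else eastE i j s d)) = false.
  move: fin; rewrite !inE /westE /southE /northE /eastE; case: (north s d e) => /orP[] /eqP->;
  by rewrite !xpair_eqE ?succ_eqF ?andbF.
by move: fin; rewrite !inE orbA => ->.
Qed.

Lemma north_link s d e z z' : turn d e ->
  link d e z z' =
  tile_has s z (north s d e) || tile_has (~~ s) z' (north s d e).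
Proof.
rewrite /north /link /tile_has => /turnP[]->; rewrite ?eqxx ?pv_nx_neq ?nx_pv_neq;
 by case: s; rewrite ?eqxx ?pv_nx_neq ?nx_pv_neq; case: z; case: z'.
Qed.

Lemma matching_tail_north i j s d e w zs f : turn d e -> north s d e ->
  f \in snake i j.+1 (~~ s) (e :: w) -> f != northE i j s d ->
  matching i j s [:: d, e & w] zs f =
  matching i j.+1 (~~ s) (e :: w) (behead zs) f.
Proof.
move=> de nde fin fg; rewrite matching_cons2 /= nde (negbTE fg).
have /andP[_ pos] := snake_pos fin.
have /negbTE-> // : f \notin [:: westE i j s d; southE i j s d; eastE i j s d].
by apply/negP; rewrite !inE => /or3P[] /eqP E; rewrite E /= ltnn in pos.
Qed.

Lemma matching_tail_east i j s d e w zs f : turn d e -> ~~ north s d e ->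
  f \in snake i.+1 j (~~ s) (e :: w) -> f != eastE i j s d ->
  matching i j s [:: d, e & w] zs f =
  matching i.+1 j (~~ s) (e :: w) (behead zs) f.
Proof.
move=> de nde fin fg; rewrite matching_cons2 /= (negbTE nde) (negbTE fg).
have /andP[pos _] := snake_pos fin.
have /negbTE-> // : f \notin [:: westE i j s d; southE i j s d; northE i j s d].
by apply/negP; rewrite !inE => /or3P[] /eqP E; rewrite E /= ltnn in pos.
Qed.

(** The first tile hangs on the rest by its North edge; its three other edges form a path through
    the two bottom vertices, the situation of [perfect_glue]. *)
Lemma perfect_step_north (p : pred edge) i j s d e w :
  turn d e -> dualpath (e :: w) -> north s d e ->
  perfect (@ends T) p (snake i j s [:: d, e & w]) =
  let g := northE i j s d in
  let p' f := if f == g then p g || p (westE i j s d) else p f in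
  [&& p (westE i j s d) == ~~ p (southE i j s d),
      p (eastE i j s d) == ~~ p (southE i j s d),
      ~~ (p g && p (westE i j s d)) &
      perfect (@ends T) p' (snake i j.+1 (~~ s) (e :: w))].
Proof.
move=> de dp nde; rewrite snake_cons2 nde.
apply: (@perfect_glue _ _ (@ends T) p _ _ _ _ _ (northE i j s d)
          (i, j) (i.+1, j) (i, j.+1) (i.+1, j.+1)).
- exact: snake_uniq.
- by rewrite (north_shared _ _ de nde); case: (head_snake i j.+1 (~~ s) e w).
- by apply/negP=> /snake_vertex_pos; rewrite /= ltnn andbF.
- by apply/negP=> /snake_vertex_pos; rewrite /= ltnn andbF.
- by rewrite xpair_eqE (ltn_eqF (ltnSn _)).
- by move=> x; rewrite !inE.
- by move=> x; rewrite !inE.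
- by move=> x; rewrite !inE.
- by move=> x; rewrite !inE.
- by rewrite xpair_eqE (ltn_eqF (ltnSn _)).
- by move=> f _ /negbTE->.
- by rewrite eqxx.
Qed.

Lemma perfect_step_east (p : pred edge) i j s d e w :
  turn d e -> dualpath (e :: w) -> ~~ north s d e ->
  perfect (@ends T) p (snake i j s [:: d, e & w]) =
  let g := eastE i j s d in
  let p' f := if f == g then p g || p (southE i j s d) else p f in
  [&& p (southE i j s d) == ~~ p (westE i j s d),
      p (northE i j s d) == ~~ p (westE i j s d),
      ~~ (p g && p (southE i j s d)) &
      perfect (@ends T) p' (snake i.+1 j (~~ s) (e :: w))].
Proof.
move=> de dp nde; rewrite snake_cons2 (negbTE nde).
apply: (@perfect_glue _ _ (@ends T) p _ _ _ _ _ (eastE i j s d)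
          (i, j) (i, j.+1) (i.+1, j) (i.+1, j.+1)).
- exact: snake_uniq.
- by rewrite (east_shared _ _ de nde); case: (head_snake i.+1 j (~~ s) e w).
- by apply/negP=> /snake_vertex_pos; rewrite /= ltnn.
- by apply/negP=> /snake_vertex_pos; rewrite /= ltnn.
- by rewrite xpair_eqE (ltn_eqF (ltnSn _)) andbF.
- by move=> x; rewrite !inE.
- by move=> x; rewrite !inE.
- by move=> x; rewrite !inE.
- by move=> x; rewrite !inE.
- by rewrite xpair_eqE (ltn_eqF (ltnSn _)) andbF.
- by move=> f _ /negbTE->.
- by rewrite eqxx.
Qed.

Lemma perfect_tile (p : pred edge) i j s d :
  perfect (@ends T) p (snake i j s [:: d]) =
  [&& p (southE i j s d) == ~~ p (westE i j s d),
      p (eastE i j s d) == p (westE i j s d) &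
      p (northE i j s d) == ~~ p (westE i j s d)].
Proof.
rewrite /perfect snake1 /= /degree /= !inE !xpair_eqE !eqxx ?succ_eqF /= !andbT !andbF.
by case: (p (westE _ _ _ _)); case: (p (southE _ _ _ _));
   case: (p (eastE _ _ _ _)); case: (p (northE _ _ _ _)).
Qed.

Lemma matching_north i j s d e w z z' zs (g := northE i j s d) :
  turn d e -> north s d e -> let p := matching i j s [:: d, e & w] [:: z, z' & zs] in
  [/\ p (westE i j s d) = s (+) z, p (southE i j s d) = ~~ (s (+) z),
      p (eastE i j s d) = s (+) z, p g = z (+) z' &
      matching i j.+1 (~~ s) (e :: w) [:: z' & zs] g = s (+) z'].
Proof.
move=> de nde p; rewrite /p; split.
- by rewrite matching_low ?inE ?eqxx //.
- by rewrite matching_low ?inE ?eqxx ?orbT // /tile_has /=; case: (s) (z) => [] [].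
- rewrite matching_cons2 nde /= !inE !eqxx !orbT.
  by rewrite /eastE /northE !xpair_eqE ?succ_eqF.
- by rewrite matching_cons2 nde /= eqxx.
rewrite /g (north_shared _ _ de nde) matching_low ?inE ?eqxx ?orbT // /tile_has /=.
by case: (s) (z') => [] [].
Qed.

Lemma matching_east i j s d e w z z' zs (g := eastE i j s d) :
  turn d e -> ~~ north s d e -> let p := matching i j s [:: d, e & w] [:: z, z' & zs] in
  [/\ p (southE i j s d) = ~~ (s (+) z), p (westE i j s d) = s (+) z,
      p (northE i j s d) = ~~ (s (+) z), p g = z (+) z' &
      matching i.+1 j (~~ s) (e :: w) [:: z' & zs] g = ~~ (s (+) z')].
Proof.
move=> de nde p; rewrite /p; split.
- by rewrite matching_low ?inE ?eqxx ?orbT // /tile_has /=; case: (s) (z) => [] [].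
- by rewrite matching_low ?inE ?eqxx.
- rewrite matching_cons2 (negbTE nde) /= !inE !eqxx !orbT.
  by rewrite /eastE /northE !xpair_eqE ?succ_eqF /= ?andbF /= /tile_has /=; case: (s) (z) => [] [].
- by rewrite matching_cons2 (negbTE nde) /= eqxx.
rewrite /g (east_shared _ _ de nde) matching_low ?inE ?eqxx ?orbT // /tile_has /=.
by case: (s) (z') => [] [].
Qed.

Lemma matching1 i j s d zs f : matching i j s [:: d] zs f = tile_has s (head false zs) f.1.2.
Proof. by []. Qed.

Lemma linked_cons2 d e w z z' zs : linked [:: d, e & w] [:: z, z' & zs] =
  link d e z z' && linked (e :: w) (z' :: zs).
Proof. by []. Qed.

Lemma matching_perfect i j s w zs : dualpath w -> size zs = size w -> linked w zs ->
  perfect (@ends T) (matching i j s w zs) (snake i j s w).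
Proof.
elim: w i j s zs => [//|d [|e w] IH] i j s [|z zs] //.
  by case: zs => // _ _ _; rewrite perfect_tile !matching1 /tile_has /=; case: (s) (z) => [] [].
case: zs => [//|z' zs]; rewrite dualpath_cons => /and3P[di de dp] [sz].
rewrite linked_cons2 => /andP[lk lks].
rewrite (north_link s) // in lk.
case nde : (north s d e); rewrite nde in lk.
  rewrite perfect_step_north //=.
  have [-> -> -> -> pg'] := matching_north i j w z z' zs de nde.
  rewrite negbK eqxx /=; apply/andP; split.
    by move: lk; rewrite /tile_has; case: (s) (z) (z') => [] [] [].
  rewrite (@eq_perfect _ _ _ _ (matching i j.+1 (~~ s) (e :: w) [:: z' & zs])).
    by apply: IH => //=; rewrite sz.
  move=> f fin /=; case: eqP => [->|/eqP nf]; last by rewrite matching_tail_north.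
  by rewrite pg'; move: lk; rewrite /tile_has; case: (s) (z) (z') => [] [] [].
rewrite perfect_step_east ?nde //=.
have [-> -> -> -> pg'] := matching_east i j w z z' zs de (negbT nde).
rewrite eqxx /=; apply/andP; split.
  by move: lk; rewrite /tile_has; case: (s) (z) (z') => [] [] [].
rewrite (@eq_perfect _ _ _ _ (matching i.+1 j (~~ s) (e :: w) [:: z' & zs])).
  by apply: IH => //=; rewrite sz.
move=> f fin /=; case: eqP => [->|/eqP nf]; last by rewrite matching_tail_east ?nde.
by rewrite pg'; move: lk; rewrite /tile_has; case: (s) (z) (z') => [] [] [].
Qed.

(** The predicate is arbitrary because removing the first tile alters its value on the shared edge;
    the induction hypothesis is applied to the altered predicate. *)
Lemma perfect_matching_bits i j s w (p : pred edge) : dualpath w ->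
  perfect (@ends T) p (snake i j s w) ->
  exists zs, [/\ size zs = size w, linked w zs &
                 {in snake i j s w, p =1 matching i j s w zs}].
Proof.
elim: w i j s p => [|d [|e w] IH] i j s p; first by exists [::].
  move=> _; rewrite perfect_tile => /and3P[/eqP pS /eqP pE /eqP pN].
  (* The bit is read off the West edge, which is vertical and hence in state [z] iff [s (+) z]. *)
  exists [:: s (+) p (westE i j s d)]; split=> // f.
  rewrite snake1 !inE matching1 /tile_has /=.
  by case/or4P=> /eqP->; rewrite ?pS ?pE ?pN /=; case: (s); case: (p _).
rewrite dualpath_cons => /and3P[di de dp].
case nde : (north s d e).
  rewrite perfect_step_north // => /and4P[/eqP pW /eqP pE npp].
  case/(IH _ _ _ _ dp) => -[|z' zs] [] // [sz lks pe].
  exists [:: s (+) p (westE i j s d), z' & zs].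
  have [mW mS mE mg mg'] := matching_north i j w (s (+) p (westE i j s d)) z' zs de nde.
  have gin : northE i j s d \in snake i j.+1 (~~ s) (e :: w).
    by rewrite (north_shared _ _ de nde); case: (head_snake i j.+1 (~~ s) e w).
  have pg := pe _ gin; rewrite eqxx mg' in pg.
  split; first by rewrite /= -sz.
    rewrite linked_cons2 lks (north_link s) // nde andbT /tile_has.
    move: npp pg; rewrite pW; case: (p (southE i j s d)); case: (p (northE i j s d)); case: (s) (z') => [] [] //.
  move=> f; rewrite snake_cons2 nde 3!in_cons => /or4P[/eqP->|/eqP->|/eqP->|fin].
  - by rewrite mS pW; case: (s); case: (p _).
  - by rewrite mW addKb.
  - by rewrite mE pE pW addKb.
  have [->|nf] := eqVneq f (northE i j s d).
    rewrite mg; move: npp pg; rewrite pW.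
    by case: (p (southE i j s d)); case: (p (northE i j s d)); case: (s) (z') => [] [] //.
  by rewrite matching_tail_north // -pe // (negbTE nf).
rewrite perfect_step_east ?nde // => /and4P[/eqP pS /eqP pN npp].
case/(IH _ _ _ _ dp) => -[|z' zs] [] // [sz lks pe].
exists [:: s (+) p (westE i j s d), z' & zs].
have [mS mW mN mg mg'] := matching_east i j w (s (+) p (westE i j s d)) z' zs de (negbT nde).
have gin : eastE i j s d \in snake i.+1 j (~~ s) (e :: w).
  by rewrite (east_shared _ _ de (negbT nde)); case: (head_snake i.+1 j (~~ s) e w).
have pg := pe _ gin; rewrite eqxx mg' in pg.
split; first by rewrite /= -sz.
  rewrite linked_cons2 lks (north_link s) // nde andbT /tile_has.
  move: npp pg; rewrite pS; case: (p (westE i j s d)); case: (p (eastE i j s d)); case: (s) (z') => [] [] //.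
move=> f; rewrite snake_cons2 nde 3!in_cons => /or4P[/eqP->|/eqP->|/eqP->|fin].
- by rewrite mW addKb.
- by rewrite mS pS addKb.
- by rewrite mN pN addKb.
have [->|nf] := eqVneq f (eastE i j s d).
  rewrite mg; move: npp pg; rewrite pS.
  by case: (p (westE i j s d)); case: (p (eastE i j s d)); case: (s) (z') => [] [] //.
by rewrite matching_tail_east ?nde // -pe // (negbTE nf).
Qed.

Lemma matching_inj i j s w zs zs' : dualpath w -> size zs = size w -> size zs' = size w ->
  {in snake i j s w, matching i j s w zs =1 matching i j s w zs'} -> zs = zs'.
Proof.
elim: w i j s zs zs' => [|d [|e w] IH] i j s [|z zs] [|z1 zs'] //.
  case: zs zs' => [|//] [|//] _ _ _ /(_ (westE i j s d)).
  by rewrite snake1 !inE eqxx !matching1 /tile_has /= => /(_ isT)/addbI->.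
case: zs zs' => [//|z' zs] [//|z1' zs']; rewrite dualpath_cons => /and3P[di de dp] [sz] [sz'] eqm.
have [wL sL] := head_snake i j s d (e :: w).
have := eqm _ wL; rewrite !matching_low ?inE ?eqxx //= /tile_has => /addbI zz; subst z1.
congr (_ :: _).
case nde : (north s d e).
  have gin : northE i j s d \in snake i j.+1 (~~ s) (e :: w).
    by rewrite (north_shared _ _ de nde); case: (head_snake i j.+1 (~~ s) e w).
  have inc f : f \in snake i j.+1 (~~ s) (e :: w) -> f \in snake i j s [:: d, e & w].
    by rewrite snake_cons2 nde 3!in_cons => ->; rewrite !orbT.
  have := eqm _ (inc _ gin).
  have [_ _ _ -> mg] := matching_north i j w z z' zs de nde.
  have [_ _ _ -> mg'] := matching_north i j w z z1' zs' de nde.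
  move/addbI => zz; subst z1'.
  apply: (IH i j.+1 (~~ s)) => //=; rewrite ?sz ?sz' // => f fin.
  have [->|nf] := eqVneq f (northE i j s d); first by rewrite mg mg'.
  by have := eqm _ (inc _ fin); rewrite !matching_tail_north.
have gin : eastE i j s d \in snake i.+1 j (~~ s) (e :: w).
  by rewrite (east_shared _ _ de (negbT nde)); case: (head_snake i.+1 j (~~ s) e w).
have inc f : f \in snake i.+1 j (~~ s) (e :: w) -> f \in snake i j s [:: d, e & w].
  by rewrite snake_cons2 nde 3!in_cons => ->; rewrite !orbT.
have := eqm _ (inc _ gin).
have [_ _ _ -> mg] := matching_east i j w z z' zs de (negbT nde).
have [_ _ _ -> mg'] := matching_east i j w z z1' zs' de (negbT nde).
move/addbI => zz; subst z1'.
apply: (IH i.+1 j (~~ s)) => //=; rewrite ?sz ?sz' // => f fin.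
have [->|nf] := eqVneq f (eastE i j s d); first by rewrite mg mg'.
by have := eqm _ (inc _ fin); rewrite !matching_tail_east ?nde.
Qed.

(** Here shared edges occur twice. This multiplicity is how [minimal_matching] recognizes boundary
    edges, so [snake] cannot replace it everywhere. *)
Definition tedges i j s w : seq edge :=
  flatten [seq lower_half t ++ upper_half t | t <- tiles_from i j s w].

Lemma tedges_cons2 i j s d e w : tedges i j s [:: d, e & w] =
  [:: westE i j s d, southE i j s d, eastE i j s d, northE i j s d &
      if north s d e then tedges i j.+1 (~~ s) (e :: w)
      else tedges i.+1 j (~~ s) (e :: w)].
Proof. by rewrite /tedges /= -/(north s d e); case: (north s d e). Qed.

Lemma tedges1 i j s d : tedges i j s [:: d] =
  [:: westE i j s d; southE i j s d; eastE i j s d; northE i j s d].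
Proof. by []. Qed.

Lemma tile_edgesE w : tile_edges w = tedges 0 0 true w. Proof. by []. Qed.

Lemma mem_tedges i j s w : dualpath w -> tedges i j s w =i snake i j s w.
Proof.
elim: w i j s => [|d [|e w] IH] i j s //.
rewrite dualpath_cons => /and3P[di de dp] f; rewrite tedges_cons2 snake_cons2.
case nde : (north s d e); rewrite 4!in_cons IH // 3![in RHS]in_cons.
  have := head_snake i j.+1 (~~ s) e w; rewrite -(north_shared _ _ de nde) => -[_ gin].
  have [->|_] := eqVneq f (northE _ _ _ _); first by rewrite gin !orbT.
  by rewrite orbCA.
have := head_snake i.+1 j (~~ s) e w; rewrite -(east_shared _ _ de (negbT nde)) => -[gin _].
have [->|_] := eqVneq f (eastE _ _ _ _); first by rewrite gin !orbT.
by [].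
Qed.

End Snake.

Arguments snake : simpl never.
Arguments matching : simpl never.
Arguments tedges : simpl never.

(** * From the finite type of edges to a list without repetition *)

Section SeqSub.
Variables (A : choiceType) (S E : seq A).
Hypotheses (uE : uniq E) (eqSE : S =i E).

(** Repetitions in [S] do not produce several elements of [seq_sub S]; hence cardinals and products
    over that type can be computed along [E]. *)
Lemma perm_ssval : perm_eq (map (@ssval A S) (enum {: seq_sub S})) E.
Proof.
apply: uniq_perm => //; first by rewrite map_inj_uniq ?enum_uniq //; exact: val_inj.
move=> a; rewrite -eqSE; apply/mapP/idP => [[f _ ->]|aS]; first exact: ssvalP.
by exists (SeqSub aS); rewrite ?mem_enum.
Qed.

Lemma big_seq_sub (R : Type) (idx : R) (op : Monoid.com_law idx) (G : A -> R)
    (P : {set seq_sub S}) (q : pred A) :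
  (forall f : seq_sub S, (f \in P) = q (ssval f)) ->
  \big[op/idx]_(f in P) G (ssval f) = \big[op/idx]_(a <- E | q a) G a.
Proof.
move=> PE; rewrite -(perm_big _ perm_ssval) big_map big_enum_cond.
by apply: eq_bigl => f; rewrite PE.
Qed.

Lemma card_ssval (P : {set seq_sub S}) (q : pred A) :
  (forall f : seq_sub S, (f \in P) = q (ssval f)) -> #|P| = count q E.
Proof.
by move=> PE; rewrite -sum1_card (@big_seq_sub _ _ addn (fun=> 1%N) P q PE) sum1_count.
Qed.

End SeqSub.

Fixpoint bits n : seq (seq bool) :=
  if n is n'.+1 then map (cons false) (bits n') ++ map (cons true) (bits n')
  else [:: [::]].

Lemma mem_bits n zs : (zs \in bits n) = (size zs == n).
Proof.
elim: n zs => [|n IH] [|z zs] //=.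
- by rewrite mem_cat; apply/negbTE/norP; split; apply/mapP=> -[].
- rewrite mem_cat eqSS -IH; case: z.
  + rewrite (mem_map (fun _ _ => _)) => [|a b []//].
    by case: mapP => [[x _ //]|].
  + rewrite (mem_map (fun _ _ => _)) => [|a b []//].
    by case: mapP => [[x _ //]|]; rewrite orbF.
Qed.

Lemma uniq_bits n : uniq (bits n).
Proof.
elim: n => [//|n IH]; rewrite cat_uniq !map_inj_uniq ?IH => [|a b []//|a b []//].
by rewrite andbT; apply/hasPn => _ /mapP[zs _ ->]; apply/mapP=> -[].
Qed.

(** * The minimal matching and the tiles enclosed by a symmetric difference *)

Section MinimalMatching.
Variable T : tsurface.
Local Notation side := (side T).
Local Notation edge := (edge T).
Implicit Types (c d e : side) (u v w : seq side) (z : bool) (zs : seq bool).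

Lemma tedges_pos i j s w f : dualpath w -> f \in tedges i j s w ->
  (i <= f.1.1.1)%N && (j <= f.1.1.2)%N.
Proof. by move=> dp; rewrite mem_tedges //; apply: snake_pos. Qed.

Lemma count_low i j s d w f : dualpath (d :: w) ->
  f \in [:: westE i j s d; southE i j s d] -> count_mem f (tedges i j s (d :: w)) = 1%N.
Proof.
move=> dp fin.
have H : (westE i j s d == f) + ((southE i j s d == f) + ((eastE i j s d == f) + (northE i j s d == f))) = 1.
  by move: fin; rewrite !inE /westE /southE /northE /eastE => /orP[] /eqP->;
   rewrite !xpair_eqE !eqxx ?succ_eqF ?andbF.
case: w dp => [|e w]; first by rewrite tedges1 /= !addn0.
rewrite dualpath_cons tedges_cons2 => /and3P[_ _ dp] /=.
have -> : count_mem f (if north s d e then tedges i j.+1 (~~ s) (e :: w) else tedges i.+1 j (~~ s) (e :: w)) = 0.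
  apply/count_memPn; apply/negP; move: fin; rewrite !inE => fin.
  by case: (north s d e) => /(tedges_pos dp); case/orP: fin => /eqP->; rewrite /= ltnn ?andbF.
by rewrite addn0.
Qed.

Lemma uniq_tile i j s d w : dualpath (d :: w) ->
  uniq [:: westE i j s d; southE i j s d; eastE i j s d; northE i j s d].
Proof.
move=> dp; rewrite -snake1; apply: snake_uniq.
exact: (@dualpath_catl _ [:: d] w dp).
Qed.

Lemma count_north i j s d e w f : dualpath [:: d, e & w] -> north s d e ->
  count_mem f (tedges i j s [:: d, e & w]) =
  ((f \in [:: westE i j s d; southE i j s d; eastE i j s d; northE i j s d])
   + count_mem f (tedges i j.+1 (~~ s) (e :: w)))%N.
Proof.
by move=> dp nde; rewrite tedges_cons2 nde -(count_uniq_mem _ (uniq_tile i j s dp)) -count_cat.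
Qed.

Lemma count_east i j s d e w f : dualpath [:: d, e & w] -> ~~ north s d e ->
  count_mem f (tedges i j s [:: d, e & w]) =
  ((f \in [:: westE i j s d; southE i j s d; eastE i j s d; northE i j s d])
   + count_mem f (tedges i.+1 j (~~ s) (e :: w)))%N.
Proof.
by move=> dp nde; rewrite tedges_cons2 (negbTE nde) -(count_uniq_mem _ (uniq_tile i j s dp)) -count_cat.
Qed.

(** A shared edge is matched exactly when the bits of its two tiles differ. A matching of boundary
    edges only therefore has constant bits. *)
Lemma boundary_matching i j s w zs : dualpath w -> size zs = size w ->
  reflect (zs = nseq (size zs) (head false zs))
    (all (fun f => matching i j s w zs f ==> (count_mem f (tedges i j s w) == 1)%N)
       (snake i j s w)).
Proof.
elim: w i j s zs => [|d [|e w] IH] i j s [|z zs] //; first by move=> *; apply: ReflectT.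
  case: zs => // dp _; apply: (iffP idP) => // _.
  by apply/allP=> f; rewrite -mem_tedges // => fin; apply/implyP=> _;
  rewrite count_uniq_mem ?fin //; rewrite tedges1 -snake1 snake_uniq.
case: zs => [//|z' zs] dp0 [sz]; have := dp0; rewrite dualpath_cons => /and3P[di de dp].
have sz2 : size (z' :: zs) = size (e :: w) by rewrite /= sz.
have step : reflect (z = z' /\ (z' :: zs) = nseq (size (z' :: zs)) z')
    (all (fun f => matching i j s [:: d, e & w] [:: z, z' & zs] f ==>
           (count_mem f (tedges i j s [:: d, e & w]) == 1)%N) (snake i j s [:: d, e & w])).
  case nde : (north s d e).
    have gS := north_shared i j de nde.
    have gin : northE i j s d \in snake i j.+1 (~~ s) (e :: w).
      by rewrite gS; case: (head_snake i j.+1 (~~ s) e w).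
    have inc f : f \in snake i j.+1 (~~ s) (e :: w) -> f \in snake i j s [:: d, e & w].
      by rewrite snake_cons2 nde 3!in_cons => ->; rewrite !orbT.
    have [_ _ _ mg mg'] := matching_north i j w z z' zs de nde.
    have cg : count_mem (northE i j s d) (tedges i j.+1 (~~ s) (e :: w)) = 1.
      by rewrite gS count_low // !inE eqxx ?orbT.
    have notin f : f \in snake i j.+1 (~~ s) (e :: w) -> f != northE i j s d ->
       f \notin [:: westE i j s d; southE i j s d; eastE i j s d; northE i j s d].
      move=> /snake_pos/andP[_ pos] nf; rewrite !inE (negbTE nf) orbF.
      by apply/negP=> /or3P[] /eqP E; rewrite E /= ltnn in pos.
    apply: (iffP allP) => [H|[<- cst] f].
      have zz : z = z'.
        have := H _ (inc _ gin); rewrite mg count_north // cg !inE eqxx !orbT /=.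
        by case: (z) (z') => [] [].
      split=> //; apply/(IH i j.+1 (~~ s) _ dp sz2).
      apply/allP=> f fin; have [->|nf] := eqVneq f (northE i j s d); first by rewrite cg implybT.
      have := H _ (inc _ fin); rewrite matching_tail_north // count_north //.
      by rewrite (negbTE (notin _ fin nf)) add0n.
    rewrite snake_cons2 nde 3!in_cons => fin.
    have [->|nf] := eqVneq f (northE i j s d).
      by have [_ _ _ -> _] := matching_north i j w z z zs de nde; rewrite addbb.
    case fin' : (f \in snake i j.+1 (~~ s) (e :: w)).
      rewrite matching_tail_north // count_north // (negbTE (notin _ fin' nf)) add0n.
      have sz' : size (z :: zs) = size (e :: w) by rewrite /= sz.
      have := IH i j.+1 (~~ s) (z :: zs) dp sz'.
      by move=> /introT/(_ cst)/allP/(_ _ fin').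
    rewrite count_north // (_ : count_mem _ (tedges _ _ _ _) = 0); last first.
      by apply/count_memPn; rewrite mem_tedges // fin'.
    move: fin; rewrite fin' orbF !inE => /or3P[] ->; by rewrite ?orbT implybT.
  have gS := east_shared i j de (negbT nde).
  have gin : eastE i j s d \in snake i.+1 j (~~ s) (e :: w).
    by rewrite gS; case: (head_snake i.+1 j (~~ s) e w).
  have inc f : f \in snake i.+1 j (~~ s) (e :: w) -> f \in snake i j s [:: d, e & w].
    by rewrite snake_cons2 nde 3!in_cons => ->; rewrite !orbT.
  have [_ _ _ mg mg'] := matching_east i j w z z' zs de (negbT nde).
  have cg : count_mem (eastE i j s d) (tedges i.+1 j (~~ s) (e :: w)) = 1.
    by rewrite gS count_low // !inE eqxx ?orbT.
  have notin f : f \in snake i.+1 j (~~ s) (e :: w) -> f != eastE i j s d ->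
     f \notin [:: westE i j s d; southE i j s d; eastE i j s d; northE i j s d].
    move=> /snake_pos/andP[pos _] nf; rewrite !inE (negbTE nf) /=.
    by apply/negP=> /or3P[] /eqP E; rewrite E /= ltnn in pos.
  apply: (iffP allP) => [H|[<- cst] f].
    have zz : z = z'.
      have := H _ (inc _ gin); rewrite mg count_east ?nde // cg !inE eqxx !orbT /=.
      by case: (z) (z') => [] [].
    split=> //; apply/(IH i.+1 j (~~ s) _ dp sz2).
    apply/allP=> f fin; have [->|nf] := eqVneq f (eastE i j s d); first by rewrite cg implybT.
    have := H _ (inc _ fin); rewrite matching_tail_east ?nde // count_east ?nde //.
    by rewrite (negbTE (notin _ fin nf)) add0n.
  rewrite snake_cons2 nde 3!in_cons => fin.
  have [->|nf] := eqVneq f (eastE i j s d).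
    by have [_ _ _ -> _] := matching_east i j w z z zs de (negbT nde); rewrite addbb.
  case fin' : (f \in snake i.+1 j (~~ s) (e :: w)).
    rewrite matching_tail_east ?nde // count_east ?nde // (negbTE (notin _ fin' nf)) add0n.
    have sz' : size (z :: zs) = size (e :: w) by rewrite /= sz.
    have := IH i.+1 j (~~ s) (z :: zs) dp sz'.
    by move=> /introT/(_ cst)/allP/(_ _ fin').
  rewrite count_east ?nde // (_ : count_mem _ (tedges _ _ _ _) = 0); last first.
    by apply/count_memPn; rewrite mem_tedges // fin'.
  by move: fin; rewrite fin' orbF !inE => /or3P[] ->; rewrite ?orbT implybT.
apply: (iffP step) => [[-> /= [E]]|/= [-> E]]; first by rewrite -E.
by split=> //; congr (_ :: _).
Qed.

Lemma linked_nseq w z : linked w (nseq (size w) z).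
Proof.
elim: w => [//|d [|e w] IH] //.
rewrite [nseq _ _]/= linked_cons2 (IH) andbT /link.
by case: ifP; case: (z).
Qed.

Definition mset w zs : {set sedge w} := [set f | matching 0 0 true w zs (ssval f)].

Lemma perfect_matchingE w (P : {set sedge w}) (p : pred edge) :
  dualpath w -> (forall f : sedge w, (f \in P) = p (ssval f)) ->
  perfect_matching P = perfect (@ends T) p (snake 0 0 true w).
Proof.
move=> dp PE; rewrite /perfect_matching /perfect.
rewrite (eq_all_r (s2 := flatten (map (@ends T) (snake 0 0 true w)))); last first.
  by move=> x; apply/flatten_mapP/flatten_mapP=> -[f fin xf]; exists f => //;
     move: fin; rewrite tile_edgesE mem_tedges.
apply: eq_all => x; congr (_ == _).
rewrite /degree; apply: card_ssval; first exact: snake_uniq.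
  by move=> f; rewrite tile_edgesE mem_tedges.
by move=> f; rewrite inE PE.
Qed.

Lemma mset_perfect w zs : dualpath w -> size zs = size w -> linked w zs ->
  perfect_matching (mset w zs).
Proof.
move=> dp sz lk; rewrite (perfect_matchingE (p := matching 0 0 true w zs)) //.
  exact: matching_perfect.
by move=> f; rewrite inE.
Qed.

Lemma ssval_snake w (f : sedge w) : dualpath w -> ssval f \in snake 0 0 true w.
Proof. by move=> dp; rewrite -mem_tedges // -tile_edgesE ssvalP. Qed.

Lemma perfect_msetP w (P : {set sedge w}) : dualpath w -> perfect_matching P ->
  exists zs, [/\ size zs = size w, linked w zs & P = mset w zs].
Proof.
move=> dp; pose p (f : edge) := [exists e in P, ssval e == f].
have PE (f : sedge w) : (f \in P) = p (ssval f).
  apply/idP/existsP=> [fP|[e /andP[eP /eqP/val_inj<-//]]].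
  by exists f; rewrite fP eqxx.
rewrite (perfect_matchingE dp PE) => /(perfect_matching_bits dp)[zs [sz lk E]].
exists zs; split=> //; apply/setP=> f; rewrite inE PE E //; exact: ssval_snake.
Qed.

Lemma mset_inj w zs zs' : dualpath w -> size zs = size w -> size zs' = size w ->
  mset w zs = mset w zs' -> zs = zs'.
Proof.
move=> dp sz sz' /setP eqm; apply: (matching_inj (i := 0) (j := 0) (s := true) dp) => // f fin.
have fS : f \in tile_edges w by rewrite tile_edgesE mem_tedges.
by have := eqm (SeqSub fS); rewrite !inE.
Qed.

(** Of the two constant bit sequences the West edge of the first tile, where [s] is true, selects
    [false]. *)
Lemma minimal_matchingE w : dualpath w -> minimal_matching w = mset w (nseq (size w) false).
Proof.
move=> dp; case: w dp => [|d w] dp.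
  rewrite /minimal_matching; have H (A B : {set sedge [::]}) : A = B :> {set sedge ([::] : seq side)}.
    by apply/setP=> -[].
  exact: H.
set w' := d :: w in dp *; rewrite /minimal_matching.
set C := fun P : {set sedge w'} => _.
have [wL _] := head_snake 0 0 true d w.
have WS : westE 0 0 true d \in tile_edges w' by rewrite tile_edgesE mem_tedges.
have headE x : head x (tile_edges w') = westE 0 0 true d by [].
have mW zs : matching 0 0 true w' zs (westE 0 0 true d) = ~~ head false zs.
  by rewrite matching_low ?inE ?eqxx.
have bdE zs : [forall e in mset w' zs, count_mem (ssval e) (tile_edges w') == 1%N] =
   all (fun f => matching 0 0 true w' zs f ==> (count_mem f (tedges 0 0 true w') == 1)%N)
     (snake 0 0 true w').
  apply/forall_inP/allP=> [H f fin|H f].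
    apply/implyP=> mf; have fS : f \in tile_edges w' by rewrite tile_edgesE mem_tedges.
    by apply: (H (SeqSub fS)); rewrite inE.
  by rewrite inE => mf; apply: (implyP (H _ (ssval_snake f dp))).
have C0 : C (mset w' (nseq (size w') false)).
  apply/and3P; split.
  - by apply: mset_perfect; rewrite ?size_nseq ?linked_nseq.
  - by rewrite bdE; apply/boundary_matching; rewrite ?size_nseq.
  - by apply/existsP; exists (SeqSub WS); rewrite inE headE mW eqxx.
case: pickP => [P /and3P[pm bd /existsP[f /andP[fP]]]|/(_ (mset w' (nseq (size w') false)))]; last by rewrite C0.
have [zs [sz lk E]] := perfect_msetP dp pm; rewrite headE => /eqP fE.
move: fP; rewrite E inE fE mW => hz.
rewrite E bdE in bd; move/(boundary_matching _ _ _ dp sz): bd => ->.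
by rewrite sz (negbTE hz).
Qed.

Definition on_ray (t : tile T) (f : edge) :=
  [&& ~~ f.1.2, f.1.1.2 == t.1.1.2 & (f.1.1.1 <= t.1.1.1)%N].

Lemma tiles_pos i j s w t : t \in tiles_from i j s w ->
  (i <= t.1.1.1)%N && (j <= t.1.1.2)%N.
Proof.
elim: w i j s => [//|d w IH] i j s /=; rewrite inE => /orP[/eqP->|]; first by rewrite !leqnn.
by case: w IH => [//|e w] IH; case: ifP => _ /IH /andP[h1 h2]; apply/andP; split=> //; apply: ltnW.
Qed.

Lemma tiles_cons2 i j s d e w : tiles_from i j s [:: d, e & w] =
  (i, j, s, d) :: (if north s d e then tiles_from i j.+1 (~~ s) (e :: w)
                   else tiles_from i.+1 j (~~ s) (e :: w)).
Proof. by []. Qed.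

(* The horizontal ray meets the boundary of the enclosed region in [westE] of  *)
(* the first tile of the row and in the edges between tiles of this row that   *)
(* are in different states, so the parities telescope.                         *)
Lemma ray_parity i j s w zs : dualpath w -> size zs = size w ->
  [seq odd (count (fun f => (matching i j s w zs f (+)
       matching i j s w (nseq (size w) false) f) && on_ray t f) (snake i j s w))
     | t <- tiles_from i j s w] = zs.
Proof.
elim: w i j s zs => [|d [|e w] IH] i j s [|z zs] //.
  case: zs => // dp _; rewrite snake1 /= !matching1 /tile_has /on_ray /=.
  by rewrite !eqxx !leqnn ltnn !andbT !andbF /= !addn0; case: (s) (z) => [] [].
case: zs => [//|z' zs] dp0 [sz]; have := dp0; rewrite dualpath_cons => /and3P[di de dp].
have sz2 : size (z' :: zs) = size (e :: w) by rewrite /= sz.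
have -> : nseq (size [:: d, e & w]) false = [:: false, false & nseq (size w) false] by [].
rewrite tiles_cons2 map_cons; congr (_ :: _).
  case nde : (north s d e); rewrite snake_cons2 nde.
    have [mW mS mE mg mg'] := matching_north i j w z z' zs de nde.
    have [mW0 mS0 mE0 mg0 mg'0] := matching_north i j w false false (nseq (size w) false) de nde.
    rewrite /= mW mS mE mW0 mS0 mE0 {1 2 3}/on_ray /= eqxx leqnn ltnn !andbF !andbT /=.
    rewrite (_ : count _ (snake _ _ _ _) = 0); first by case: (s) (z) => [] [].
    apply/eqP; rewrite -leqn0 leqNgt -has_count; apply/hasPn => f /snake_pos/andP[_ pos].
    by rewrite /on_ray /= (gtn_eqF pos) andbF andbF.
  have [mS mW mN mg mg'] := matching_east i j w z z' zs de (negbT nde).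
  have [mS0 mW0 mN0 mg0 mg'0] := matching_east i j w false false (nseq (size w) false) de (negbT nde).
  rewrite /= mW mS mN mW0 mS0 mN0 {1 2 3}/on_ray /= eqxx leqnn !andbF !andbT /=.
  rewrite (_ : count _ (snake _ _ _ _) = 0); first by case: (s) (z) => [] [].
  apply/eqP; rewrite -leqn0 leqNgt -has_count; apply/hasPn => f /snake_pos/andP[pos _].
  by rewrite /on_ray /= leqNgt pos !andbF.
case nde : (north s d e); rewrite snake_cons2 nde.
  have [mW mS mE mg mg'] := matching_north i j w z z' zs de nde.
  have [mW0 mS0 mE0 mg0 mg'0] := matching_north i j w false false (nseq (size w) false) de nde.
  rewrite -[RHS](IH i j.+1 (~~ s) _ dp sz2); apply/eq_in_map => t /tiles_pos/andP[_ tpos].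
  rewrite -[[:: _, _, _ & _]]/([:: southE i j s d; westE i j s d; eastE i j s d] ++ snake i j.+1 (~~ s) (e :: w)) count_cat.
  rewrite (_ : count _ [:: _; _; _] = 0); last first.
    apply/eqP; rewrite -leqn0 leqNgt -has_count; apply/hasPn => f.
    by rewrite !inE => /or3P[] /eqP->; rewrite /on_ray /= ?(ltn_eqF tpos) !andbF.
  rewrite add0n; congr (odd _); apply: eq_in_count => f fin.
  have [->|nf] := eqVneq f (northE i j s d); first by rewrite /on_ray /= !andbF.
  by rewrite !matching_tail_north.
have [mS mW mN mg mg'] := matching_east i j w z z' zs de (negbT nde).
have [mS0 mW0 mN0 mg0 mg'0] := matching_east i j w false false (nseq (size w) false) de (negbT nde).
rewrite -[RHS](IH i.+1 j (~~ s) _ dp sz2); apply/eq_in_map => t /tiles_pos/andP[tpos _].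
have gin : eastE i j s d \in snake i.+1 j (~~ s) (e :: w).
  by rewrite (east_shared _ _ de (negbT nde)); case: (head_snake i.+1 j (~~ s) e w).
set L := snake _ _ _ _ in gin *.
have uL : uniq L by apply: snake_uniq.
have splitL (a : pred edge) : count a L = (a (eastE i j s d) + count (fun f => (f != eastE i j s d) && a f) L)%N.
  rewrite -!sum1_count !big_mkcond (bigD1_seq (eastE i j s d)) //= big_mkcond.
  by congr (_ + _)%N; rewrite [RHS]big_mkcond /=; apply: eq_bigr => f _; case: eqP; case: (a f).
(* For a later tile of the same row, the West edge of the first tile contributes [z] and the shared
   edge [z (+) z']. Together this is [z'], the contribution of the shared edge in the tail alone. *)
rewrite /= mW mS mN mW0 mS0 mN0 {1 2 3}/on_ray /= !andbF !add0n.
rewrite splitL (splitL (fun f => _ && _)) mg mg0 mg' mg'0 /on_ray /= !oddD.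
rewrite (eq_in_count (a2 := fun f => (f != eastE i j s d) &&
   ((matching i.+1 j (~~ s) (e :: w) (z' :: zs) f (+)
     matching i.+1 j (~~ s) (e :: w) (false :: nseq (size w) false) f) && on_ray t f))).
  rewrite tpos (ltnW tpos) !addbA; congr (_ (+) _).
  by case: (j == _); case: (s) (z) (z') => [] [] [].
by move=> f fin; case: eqVneq => //= nf; rewrite !matching_tail_east ?nde.
Qed.

Lemma tiles_sides i j s w : map snd (tiles_from i j s w) = w.
Proof.
elim: w i j s => [//|d [//|e w] IH] i j s.
by rewrite tiles_cons2 map_cons; congr (_ :: _); case: ifP => _; rewrite IH.
Qed.

(** With the minimal matching as the zero sequence, the bit of a tile says whether the tile is
    enclosed, so the y-weight factors over the tiles. *)
Lemma tiles_enclosed_mset w zs : dualpath w -> size zs = size w ->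
  map snd (tiles_enclosed (mset w zs)) = mask zs w.
Proof.
move=> dp sz; rewrite /tiles_enclosed filter_mask map_mask tiles_sides; congr (mask _ _).
rewrite -[RHS](ray_parity 0 0 true dp sz); apply/eq_map => -[[[i j] s] d].
rewrite /enclosed minimal_matchingE //; congr (odd _).
apply: card_ssval; first exact: snake_uniq.
  by move=> f; rewrite tile_edgesE mem_tedges.
move=> f; rewrite !inE; case: (ssval f) => [[[i' j'] h] c] /=.
by rewrite /on_ray /=; case: matching; case: matching; rewrite ?andbF.
Qed.

End MinimalMatching.

(** * Cyclic order of places in a triangle, and signs of strands *)

Section Places.
Variable T : tsurface.
Local Notation side := (side T).
Local Notation place := (place T).
Implicit Types (c d e : side) (u v w l : seq side) (p q r : place).

Definition same_tri p q := p.1.1 == q.1.1.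

(* The sign, true meaning -1, of a strand that traverses a triangle from the   *)
(* place p to the place q.                                                     *)
Definition tau p q : bool :=
  if q.2 then q.1 == nx p.1
  else if p.2 then q.1 != pv p.1 else q.1 == nx p.1.

Lemma place_eqE (d e : side) (h h' : bool) : ((d, h) == (e, h') :> place) = (d == e) && (h == h').
Proof. by []. Qed.

Lemma order_next_place p : order (@next_place T) p = 6%N.
Proof.
have E : fcycle (@next_place T) (traject (@next_place T) p 6) && uniq (traject (@next_place T) p 6).
  case: p => d [] /=; rewrite /next_place /= ?nx_nx ?nx_pv ?pv_nx !inE !place_eqE !eqxx /=;
  by rewrite ?neq_nx ?nx_neq ?neq_pv ?pv_neq ?nx_pv_neq ?pv_nx_neq ?andbF.
case/andP: E => cy un.
by rewrite (order_cycle cy un) // inE eqxx.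
Qed.

Lemma findex_next_place p k : (k < 6)%N -> findex (@next_place T) p (iter k (@next_place T) p) = k.
Proof. by move=> k6; rewrite findex_iter // order_next_place. Qed.

Lemma same_triP p q : same_tri p q -> exists2 k, (k < 6)%N & q = iter k (@next_place T) p.
Proof.
case: p q => d h [e h'] /eqP /= /esym/triangle_cases.
by case: h; case: h' => -[] ->;
  [exists 0%N | exists 2%N | exists 4%N | exists 5%N | exists 1%N | exists 3%N
  |exists 1%N | exists 3%N | exists 5%N | exists 0%N | exists 2%N | exists 4%N] => //=;
  by rewrite /next_place /= ?nx_nx ?nx_pv ?pv_nx ?nx_pv.
Qed.

Lemma next_place_tri p k : same_tri p (iter k (@next_place T) p).
Proof.
rewrite /same_tri eq_sym; elim: k => [|k /eqP IH] //=; rewrite -IH.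
by rewrite /next_place; case: ifP.
Qed.

Lemma ccw_iter p i j : (i < 6)%N -> (j < 6)%N ->
  ccw p (iter i (@next_place T) p) (iter j (@next_place T) p) = (0 < i < j)%N.
Proof.
by move=> i6 j6; rewrite /ccw !findex_next_place // fconnect_iter andbT.
Qed.

Lemma ccw_tri p q r : ccw p q r -> same_tri p q && same_tri p r.
Proof.
case/and3P=> _ qr pr; have lr : (findex (@next_place T) p r < 6)%N.
  by rewrite -(order_next_place p) findex_max.
have pq : fconnect (@next_place T) p q.
  rewrite fconnect_orbit -index_mem size_orbit order_next_place.
  by apply: leq_ltn_trans lr; apply: ltnW.
by rewrite -(iter_findex pq) -(iter_findex pr) !next_place_tri.
Qed.

(** The cyclic orientation of three distinct places is the coboundary of [tau]. This links the signs
    of the matrix calculus to the geometry of crossings; with six places per triangle it is a finite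
    check. *)
Lemma ccw_orient p q r : same_tri p q -> same_tri p r -> p != q -> p != r -> q != r ->
  ccw p q r = tau p q (+) tau q r (+) tau r p.
Proof.
move=> /same_triP[i i6 ->] /same_triP[j j6 ->]; rewrite ccw_iter //.
case: p => d [];
  move: i i6 => [|[|[|[|[|[|//]]]]]] _; rewrite ?eqxx //;
  move: j j6 => [|[|[|[|[|[|//]]]]]] _; rewrite ?eqxx //;
  rewrite /tau /= /next_place /= ?nx_nx ?nx_pv ?pv_nx ?pv_pv ?nx_nx ?eqxx;
  by rewrite ?neq_nx ?nx_neq ?neq_pv ?pv_neq ?nx_pv_neq ?pv_nx_neq.
Qed.

Lemma ccw_neq p q r : ccw p q r -> [/\ p != q, p != r & q != r].
Proof.
move=> C; have /andP[/same_triP[i i6 qE] /same_triP[j j6 rE]] := ccw_tri C.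
move: C; rewrite qE rE ccw_iter // => /andP[i0 ij].
by split; apply/eqP=> /(congr1 (findex (@next_place T) p));
  rewrite ?findex0 ?findex_next_place // => E; move: i0 ij; rewrite -?E ?ltnn ?ltn0 // E ltnn.
Qed.

Lemma tau_anti p q : same_tri p q -> p != q -> tau q p = ~~ tau p q.
Proof.
move=> /same_triP[i i6 ->]; case: p => d [];
  move: i i6 => [|[|[|[|[|[|//]]]]]] _; rewrite ?eqxx // => _;
  rewrite /tau /= /next_place /= ?nx_nx ?nx_pv ?pv_nx ?pv_pv ?nx_nx ?eqxx;
  by rewrite ?neq_nx ?nx_neq ?neq_pv ?pv_neq ?nx_pv_neq ?pv_nx_neq.
Qed.

Lemma ccw_sign p q r : ccw p q r -> tau p q (+) tau q r (+) tau r p.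
Proof.
move=> C; have [n1 n2 n3] := ccw_neq C; have /andP[s1 s2] := ccw_tri C.
by rewrite -ccw_orient.
Qed.

(** Replacing entry through a side by a start at its second corner changes the sign, while by
    [tau_corner] its first corner keeps it. These match the signs in the two directions of unwinding
    an end. *)
Lemma tau_rho e q : same_tri (e, true) q -> q != (e, true) -> q != (nx e, false) ->
  tau (e, true) q = ~~ tau (nx e, false) q.
Proof.
move=> /same_triP[i i6 ->];
  move: i i6 => [|[|[|[|[|[|//]]]]]] _; rewrite ?eqxx //;
  rewrite /tau /= /next_place /= ?nx_nx ?nx_pv ?pv_nx ?pv_pv ?nx_nx ?eqxx //;
  by rewrite ?neq_nx ?nx_neq ?neq_pv ?pv_neq ?nx_pv_neq ?pv_nx_neq.
Qed.

Lemma tau_corner e q : same_tri (e, true) q -> q != (e, true) -> q != (e, false) ->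
  tau (e, true) q = tau (e, false) q.
Proof.
move=> /same_triP[i i6 ->];
  move: i i6 => [|[|[|[|[|[|//]]]]]] _; rewrite ?eqxx //;
  rewrite /tau /= /next_place /= ?nx_nx ?nx_pv ?pv_nx ?pv_pv ?nx_nx ?eqxx //;
  by rewrite ?neq_nx ?nx_neq ?neq_pv ?pv_neq ?nx_pv_neq ?pv_nx_neq.
Qed.

Fixpoint psign p w q : bool :=
  if w is d :: w' then tau p (d, true) (+) psign (opp d, true) w' q else tau p q.

Definition traverse p q := same_tri p q && (p != q).
Fixpoint traverses p w q : bool :=
  if w is d :: w' then traverse p (d, true) && traverses (opp d, true) w' q
  else traverse p q.

Lemma psign_cat p u d v q :
  psign p (u ++ d :: v) q = psign p u (d, true) (+) psign (opp d, true) v q.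
Proof. by elim: u p => [//|e u IH] p /=; rewrite IH addbA. Qed.

Lemma traverses_cat p u d v q :
  traverses p (u ++ d :: v) q = traverses p u (d, true) && traverses (opp d, true) v q.
Proof. by elim: u p => [//|e u IH] p /=; rewrite IH andbA. Qed.

(** A path crossing [size w] sides traverses one more triangle than that, and reversal changes the
    sign in each of them. *)
Lemma psign_inv p w q : traverses p w q ->
  psign q (inv w) p = psign p w q (+) odd (size w).+1.
Proof.
elim: w p => [|d w IH] p /=.
  by case/andP=> s n; rewrite addbT tau_anti.
case/andP=> /andP[s n] /IH E; rewrite inv_cons -cats1 psign_cat E /= oppK.
rewrite (tau_anti s n); by case: tau; case: psign; case: odd.
Qed.

(** Paths without backtracking whose ends may still run along an incident side: the form in which a
    smoothing appears before it is tightened. *)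
Definition pathok c w c' :=
  dualpath w && (if w is d :: w' then (c.1 == d.1) && (c'.1 == (opp (last d w')).1)
                 else c.1 == c'.1).

Lemma pathok_cons d w c c' : pathok c (d :: w) c' ->
  [/\ interior d, c.1 = d.1, dualpath w &
      (if w is e :: w' then turn d e /\ c'.1 = (opp (last e w')).1 else c'.1 = (opp d).1)].
Proof.
case/andP=> dp /andP[/eqP cd /eqP cl]; have := dp; case: w cl dp => [|e w] cl dp.
  by rewrite /dualpath /= !andbT => ->.
by rewrite dualpath_cons => /and3P[-> de ->].
Qed.

Lemma pathok_step d w c c' c'' : pathok c (d :: w) c' -> c''.1 = (opp d).1 -> pathok c'' w c'.
Proof.
case/pathok_cons=> di cd dw; rewrite /pathok dw /=; case: w dw => [|e w] dw H E.
  by rewrite E H.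
by case: H; rewrite turnE => /andP[/eqP-> _] ->; rewrite E !eqxx.
Qed.

Lemma pathok_inv c w c' : pathok c w c' -> pathok c' (inv w) c.
Proof.
rewrite /pathok dualpath_inv => /andP[-> ]; case: w => [|d w] /=; first by rewrite eq_sym.
move=> /andP[/eqP cd /eqP cl].
have E : inv (d :: w) = opp (last d w) :: inv (belast d w) by rewrite lastI inv_rcons.
have := rev_last_inv d w d; rewrite E /= => ->.
by rewrite oppK cd cl !eqxx.
Qed.

Lemma pathok_traverses c w c' : pathok c w c' -> (w == [::] -> c != c') ->
  traverses (c, false) w (c', false).
Proof.
case: w => [|d w].
  by case/andP=> _ cc /(_ isT) n /=; rewrite /traverse /same_tri cc place_eqE (negbTE n).
move=> ok _; have [_ cd _ _] := pathok_cons ok.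
rewrite /= /traverse /same_tri cd eqxx place_eqE andbF /=.
elim: w d c ok {cd} => [|e w IH] d c ok.
  by have [_ _ _ /= E] := pathok_cons ok; rewrite /= /traverse /same_tri /= E eqxx place_eqE andbF.
have [_ cd _ [de _]] := pathok_cons ok.
have ok' : pathok (opp d) (e :: w) c' by apply: (pathok_step ok).
rewrite /= (IH _ _ ok') andbT /traverse /same_tri place_eqE andbT eq_sym.
by move: de; rewrite turnE => /andP[-> ne]; rewrite eq_sym.
Qed.

End Places.

Local Open Scope ring_scope.

(** * Locating the edges of a given tile inside the snake graph *)

Section TileEdges.
Variable T : tsurface.
Local Notation side := (side T).
Local Notation edge := (edge T).
Implicit Types (c d e : side) (u v w : seq side) (z : bool) (zs : seq bool).

Definition shared d e := if e == nx (opp d) then pv (opp d) else nx (opp d).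

Lemma northE_shared i j s d e : turn d e -> north s d e -> (northE i j s d).2 = shared d e.
Proof.
rewrite /north /shared /= => /turnP[]->; case: s; rewrite ?eqxx ?pv_nx_neq ?nx_pv_neq //.
Qed.

Lemma eastE_shared i j s d e : turn d e -> ~~ north s d e -> (eastE i j s d).2 = shared d e.
Proof.
rewrite /north /shared /= => /turnP[]->; case: s; rewrite ?eqxx ?pv_nx_neq ?nx_pv_neq //.
Qed.

Lemma eastE_northE i j s d : (eastE i j s d == northE i j s d) = false.
Proof. by rewrite /eastE /northE !xpair_eqE (gtn_eqF (ltnSn _)). Qed.
Lemma northE_eastE i j s d : (northE i j s d == eastE i j s d) = false.
Proof. by rewrite eq_sym eastE_northE. Qed.

(** Successive tiles lie on successive antidiagonals. Comparing coordinate sums shows that an edge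
    of a later tile can equal the edge shared by the first two tiles only if it is a lower edge of
    the second tile, and the label then excludes it. *)
Lemma matching_nth (t0 : tile T) i j s u d v zu z zv :
  dualpath (u ++ d :: v) -> size zu = size u ->
  let t := nth t0 (tiles_from i j s (u ++ d :: v)) (size u) in
  [/\ t.2 = d, (t.1.1.1 + t.1.1.2 = i + j + size u)%N,
    forall f, f \in lower_half t -> (if u is u0 :: u' then f.2 != shared (last u0 u') d else true) ->
      f \in snake i j s (u ++ d :: v) /\
      matching i j s (u ++ d :: v) (zu ++ z :: zv) f = (f.2 == nx d) (+) z &
    forall f, f \in upper_half t -> (if v is e :: _ then f.2 != shared d e else true) ->
      f \in snake i j s (u ++ d :: v) /\
      matching i j s (u ++ d :: v) (zu ++ z :: zv) f = (f.2 == nx (opp d)) (+) z].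
Proof.
elim: u i j s zu => [|d0 u IH] i j s [|z0 zu] //.
  rewrite !cat0s /= addn0 => dp _; split=> // f.
    rewrite /lower_half => fin _; have [wL sL] := head_snake i j s d v.
    split; first by move: fin; rewrite !inE => /orP[] /eqP->.
    rewrite matching_low //; move: fin; rewrite !inE => /orP[] /eqP->; rewrite /tile_has /=;
    by case: (s); rewrite ?eqxx ?pv_nx_neq /=; case: (z).
  rewrite /upper_half => fin; case: v dp => [|e v] dp.
    rewrite snake1 matching1 /tile_has /= => _; split.
      by move: fin; rewrite !inE -!/(eastE _ _ _ _) -!/(northE _ _ _ _) => /orP[] ->; rewrite ?orbT.
    by move: fin; rewrite !inE => /orP[] /eqP-> /=;
     case: (s); rewrite ?eqxx ?pv_nx_neq /=; case: (z).
  have := dp; rewrite dualpath_cons => /and3P[_ de _] fs.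
  rewrite snake_cons2 matching_cons2; case nde: (north s d e).
    have fE : f = eastE i j s d.
      move: fin; rewrite !inE => /orP[] /eqP E; first by rewrite E.
      by case/eqP: fs; rewrite E -(northE_shared i j de nde).
    rewrite fE /= eastE_northE !inE !eqxx !orbT /tile_has; split=> //=.
    by case: (s); rewrite ?eqxx ?pv_nx_neq /=; case: (z).
  have fE : f = northE i j s d.
    move: fin; rewrite !inE => /orP[] /eqP E; last by rewrite E.
    by case/eqP: fs; rewrite E -(eastE_shared i j de (negbT nde)).
  rewrite fE /= northE_eastE !inE !eqxx !orbT /tile_has; split=> //=.
  by case: (s); rewrite ?eqxx ?pv_nx_neq /=; case: (z).
move=> dp0 [sz].
have [e [w E]] : exists e w, u ++ d :: v = e :: w by case: u {dp0 IH sz} => [|e u]; [exists d, v | exists e, (u ++ d :: v)].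
have dp : dualpath (u ++ d :: v) := dualpath_cons1 dp0.
have de : turn d0 e by move: dp0; rewrite /= E dualpath_cons => /and3P[].
pose c := north s d0 e; pose i' := if c then i else i.+1; pose j' := if c then j.+1 else j.
have [t2 tp lo up] := IH i' j' (~~ s) zu dp sz.
have tE : nth t0 (tiles_from i j s ((d0 :: u) ++ d :: v)) (size (d0 :: u)) =
          nth t0 (tiles_from i' j' (~~ s) (u ++ d :: v)) (size u).
  by rewrite /= /i' /j' E /c -/(north s d0 e); case: (north s d0 e).
set g := if c then northE i j s d0 else eastE i j s d0.
have gpos : (g.1.1.1 + g.1.1.2 = i + j + 1)%N.
  by rewrite /g /c; case: (north s d0 e) => /=; rewrite ?addSn ?addnS ?addn0.
have g2 : g.2 = shared d0 e.
  by rewrite /g /c; case nde: (north s d0 e); rewrite ?(northE_shared _ _ de) ?(eastE_shared _ _ de) ?nde.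
have ij : (i' + j' = i + j + 1)%N.
  by rewrite /i' /j' /c; case: (north s d0 e); rewrite ?addSn ?addnS ?addn0.
have tail f : f \in snake i' j' (~~ s) (u ++ d :: v) -> f != g ->
    f \in snake i j s ((d0 :: u) ++ d :: v) /\
    matching i j s ((d0 :: u) ++ d :: v) ((z0 :: zu) ++ z :: zv) f =
    matching i' j' (~~ s) (u ++ d :: v) (zu ++ z :: zv) f.
  rewrite /= E /i' /j' /g /c; case nde: (north s d0 e) => fin fg; rewrite snake_cons2 nde 3!in_cons fin !orbT; split=> //.
    by rewrite matching_tail_north.
  by rewrite matching_tail_east ?nde.
move=> t; rewrite {}/t tE; move: (nth _ _ _) t2 tp lo up => t t2 tp lo up; split=> //.
- by rewrite tp ij addn1 -addSnnS.
- move=> f fin fs; have nfg : f != g.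
    apply/eqP=> fg; have fp : (f.1.1.1 + f.1.1.2 = t.1.1.1 + t.1.1.2)%N.
      by move: fin; case: (t) => [[[a b] s'] d']; rewrite /lower_half !inE => /orP[] /eqP->.
    move: fp; rewrite fg gpos tp ij => /eqP; rewrite -[X in X == _]addn0 eqn_add2l eq_sym.
    move/eqP/size0nil => u0; case/eqP: fs; rewrite fg g2 u0 /=; move: E; rewrite u0 /= => -[-> _] //.
  have [] := lo f fin; last by move=> fin' <-; apply: tail.
  move: fs fin; case: (u) E => [//|u0 u'] _ fs fin.
  by [].
- move=> f fin fs; have nfg : f != g.
    apply/eqP=> fg; have fp : (f.1.1.1 + f.1.1.2 = t.1.1.1 + t.1.1.2 + 1)%N.
      by move: fin; case: (t) => [[[a b] s'] d']; rewrite /upper_half !inE => /orP[] /eqP->;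
         rewrite /= ?addSn ?addnS ?addn0.
    move: fp; rewrite fg gpos tp ij => /eqP.
    by rewrite -[X in X == _]addn0 -(addnA _ (size u)) eqn_add2l addn1.
  by have [fin' <-] := up f fin fs; apply: tail.
Qed.

Lemma has_edge_mset w zs (h : seq edge) f : dualpath w -> f \in h ->
  {in h, forall g, g.2 = f.2 -> g = f} -> f \in snake 0 0 true w ->
  has_edge (mset w zs) h f.2 = matching 0 0 true w zs f.
Proof.
move=> dp fh uf fin; have fS : f \in tile_edges w by rewrite tile_edgesE mem_tedges.
apply/existsP/idP => [[g /andP[]]|mf].
  by rewrite inE => mg /andP[gh /eqP g2]; rewrite -(uf _ gh g2).
by exists (SeqSub fS); rewrite inE mf fh eqxx.
Qed.

Lemma has_edge_lower u d v zu z zv c : dualpath (u ++ d :: v) -> size zu = size u ->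
  (if u is u0 :: u' then c != shared (last u0 u') d else true) ->
  c \in [:: nx d; pv d] ->
  has_edge (mset (u ++ d :: v) (zu ++ z :: zv))
    (nth [::] (map (@lower_half T) (tiles (u ++ d :: v))) (size u)) c = (c == nx d) (+) z.
Proof.
move=> dp sz us cin.
pose t0 : tile T := (0%N, 0%N, true, d).
have tsz : (size u < size (tiles (u ++ d :: v)))%N.
  by rewrite -(size_map snd (tiles _)) /tiles tiles_sides size_cat /= -addSnnS leq_addr.
have [t2 _ lo _] := @matching_nth t0 0 0 true u d v zu z zv dp sz.
rewrite (nth_map t0) //; rewrite -/(tiles _) in t2 lo; move: (nth _ _ _) t2 lo => t t2 lo.
have [f flo f2] : exists2 f, f \in lower_half t & f.2 = c.
  case: t t2 {lo} => [[[i j] s] d'] /= ->.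
  by move: cin; rewrite !inE => /orP[] /eqP->; case: s;
   do [by exists (i, j, false, nx d); rewrite // !inE eqxx ?orbT
      |by exists (i, j, true, nx d); rewrite // !inE eqxx ?orbT
      |by exists (i, j, false, pv d); rewrite // !inE eqxx ?orbT
      |by exists (i, j, true, pv d); rewrite // !inE eqxx ?orbT].
have [] := lo f flo; first by rewrite f2.
rewrite -f2 => fin <-; apply: has_edge_mset => // g glo.
move: flo glo; case: (t) t2 => [[[i j] s] d'] /= ->; rewrite !inE.
by move=> /orP[] /eqP-> /orP[] /eqP-> //=; case: (s) => /eqP; rewrite ?nx_pv_neq ?pv_nx_neq.
Qed.

Lemma has_edge_upper u d v zu z zv c : dualpath (u ++ d :: v) -> size zu = size u ->
  (if v is e :: _ then c != shared d e else true) ->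
  c \in [:: nx (opp d); pv (opp d)] ->
  has_edge (mset (u ++ d :: v) (zu ++ z :: zv))
    (nth [::] (map (@upper_half T) (tiles (u ++ d :: v))) (size u)) c = (c == nx (opp d)) (+) z.
Proof.
move=> dp sz us cin.
pose t0 : tile T := (0%N, 0%N, true, d).
have tsz : (size u < size (tiles (u ++ d :: v)))%N.
  by rewrite -(size_map snd (tiles _)) /tiles tiles_sides size_cat /= -addSnnS leq_addr.
have [t2 _ _ lo] := @matching_nth t0 0 0 true u d v zu z zv dp sz.
rewrite (nth_map t0) //; rewrite -/(tiles _) in t2 lo; move: (nth _ _ _) t2 lo => t t2 lo.
have [f flo f2] : exists2 f, f \in upper_half t & f.2 = c.
  case: t t2 {lo} => [[[i j] s] d'] /= ->.
  by move: cin; rewrite !inE => /orP[] /eqP->; case: s;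
   do [by exists (i.+1, j, false, nx (opp d)); rewrite // !inE eqxx ?orbT
      |by exists (i, j.+1, true, nx (opp d)); rewrite // !inE eqxx ?orbT
      |by exists (i.+1, j, false, pv (opp d)); rewrite // !inE eqxx ?orbT
      |by exists (i, j.+1, true, pv (opp d)); rewrite // !inE eqxx ?orbT].
have [] := lo f flo; first by rewrite f2.
rewrite -f2 => fin <-; apply: has_edge_mset => // g glo.
move: flo glo; case: (t) t2 => [[[i j] s] d'] /= ->; rewrite !inE.
by move=> /orP[] /eqP-> /orP[] /eqP-> //=; case: (s) => /eqP; rewrite ?nx_pv_neq ?pv_nx_neq.
Qed.

End TileEdges.

(** * Transfer matrices for the states of consecutive tiles *)

Section Transfer.
Variable T : tsurface.
Local Notation side := (side T).
Local Notation edge := (edge T).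
Implicit Types (c d e : side) (u v w : seq side) (z : bool) (zs : seq bool).
Variables (F : fieldType) (X Y : side -> F).

Definition lower d z := if z then X (pv d) else X (nx d).
Definition upper d z := if z then X (pv (opp d)) else X (nx (opp d)).
Definition tilew d z := (if z then Y d else 1) / X d.
(** For linked states the common edge occurs in one of them, and is then unmatched, or in both, and
    is then matched once. Either way the product of edge weights counts it once too often, which
    explains the division by [X (shared d e)]. *)
Definition transfer d e z z' :=
  if link d e z z' then upper d z * lower e z' / X (shared d e) * tilew e z' else 0.

(* Sum over the states of the tiles after the tile of [d], which is in state [z]. *)
Fixpoint walk d w z (G : seq bool -> F) : F :=
  if w is e :: w' then
    transfer d e z false * walk e w' false (fun zs => G (false :: zs)) +
    transfer d e z true * walk e w' true (fun zs => G (true :: zs))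
  else G [::].

Lemma eq_walk d w z G G' : (forall zs, size zs = size w -> G zs = G' zs) ->
  walk d w z G = walk d w z G'.
Proof.
elim: w d z G G' => [|e w IH] d z G G' E /=; first exact: E.
by congr (_ * _ + _ * _); apply: IH => zs sz; apply: E; rewrite /= sz.
Qed.

Lemma walk_cat d u v z G : walk d (u ++ v) z G =
  walk d u z (fun zu => walk (last d u) v (last z zu) (fun zv => G (zu ++ zv))).
Proof. by elim: u d z G => [//|e u IH] d z G /=; rewrite !IH. Qed.

Lemma walk_scale d w z k G : walk d w z (fun zs => k * G zs) = k * walk d w z G.
Proof.
by elim: w d z G => [//|e w IH] d z G /=; rewrite !IH mulrDr; congr (_ + _); rewrite mulrCA.
Qed.

Lemma walk_add d w z G G' :
  walk d w z (fun zs => G zs + G' zs) = walk d w z G + walk d w z G'.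
Proof.
by elim: w d z G G' => [//|e w IH] d z G G' /=; rewrite !IH; ring.
Qed.

Definition walkl d w z (g : bool -> F) := walk d w z (fun zs => g (last z zs)).

Lemma walkl_cons d e w z g : walkl d (e :: w) z g =
  transfer d e z false * walkl e w false g + transfer d e z true * walkl e w true g.
Proof. by []. Qed.

Fixpoint xrec d z w zs : F :=
  match w, zs with
  | e :: w', z' :: zs' => upper d z * lower e z' / X (shared d e) * xrec e z' w' zs'
  | _, _ => upper d z
  end.

Hypothesis X0 : forall d, X d != 0.

Lemma big_split_edge (L : seq edge) (p : pred edge) g : uniq L -> g \in L ->
  \prod_(f <- L | p f) X f.2 =
  (if p g then X g.2 else 1) * \prod_(f <- L | (f != g) && p f) X f.2.
Proof.
move=> uL gL; rewrite big_mkcond (bigD1_seq g) //=; congr (_ * _).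
by rewrite [RHS]big_mkcondr.
Qed.

Lemma xprod_rec i j s d w z zs : dualpath (d :: w) -> size zs = size w ->
  linked (d :: w) (z :: zs) ->
  \prod_(f <- snake i j s (d :: w) | matching i j s (d :: w) (z :: zs) f) X f.2 =
  lower d z * xrec d z w zs.
Proof.
elim: w i j s d z zs => [|e w IH] i j s d z [|z' zs] //.
  move=> _ _ _; rewrite snake1 !big_cons big_nil !matching1 /tile_has /= /lower /upper.
  by case: s; case: z => /=; ring.
move=> dp0 [sz]; have := dp0; rewrite dualpath_cons => /and3P[di de dp].
rewrite linked_cons2 => /andP[lk lks].
have Xg := X0 (shared d e).
rewrite [xrec _ _ _ _]/=; transitivity (lower d z * upper d z / X (shared d e) *
   (lower e z' * xrec e z' w zs)); last by ring.
rewrite snake_cons2; case nde: (north s d e).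
  rewrite -(IH i j.+1 (~~ s)) //.
  have [mW mS mE mg mg'] := matching_north i j w z z' zs de nde.
  have gin : northE i j s d \in snake i j.+1 (~~ s) (e :: w).
    by rewrite (north_shared _ _ de nde); case: (head_snake i j.+1 (~~ s) e w).
  have uL : uniq (snake i j.+1 (~~ s) (e :: w)) by apply: snake_uniq.
  have g2 := northE_shared i j de nde.
  rewrite !big_cons mW mS mE
    (@big_split_edge _ (matching i j s [:: d, e & w] [:: z, z' & zs]) _ uL gin)
    (@big_split_edge _ (matching i j.+1 (~~ s) (e :: w) (z' :: zs)) _ uL gin) mg mg' g2.
  have -> : \prod_(f <- snake i j.+1 (~~ s) (e :: w) | (f != northE i j s d) &&
      matching i j s [:: d, e & w] [:: z, z' & zs] f) X f.2 =
     \prod_(f <- snake i j.+1 (~~ s) (e :: w) | (f != northE i j s d) &&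
      matching i j.+1 (~~ s) (e :: w) (z' :: zs) f) X f.2.
    rewrite big_seq_cond [RHS]big_seq_cond; apply: eq_bigl => f.
    case fin: (f \in _) => //=; case: eqVneq => //= nf.
    by rewrite matching_tail_north.
  set B := \big[_/_]_(_ <- _ | _) _.
  rewrite (north_link s) // nde in lk.
  move: lk g2; rewrite /lower /upper /southE /westE /eastE /northE /tile_has /=.
  case: (s); case: (z); case: (z') => //= _ g2; rewrite ?g2; field; exact: Xg.
rewrite -(IH i.+1 j (~~ s)) //.
have [mS mW mN mg mg'] := matching_east i j w z z' zs de (negbT nde).
have gin : eastE i j s d \in snake i.+1 j (~~ s) (e :: w).
  by rewrite (east_shared _ _ de (negbT nde)); case: (head_snake i.+1 j (~~ s) e w).
have uL : uniq (snake i.+1 j (~~ s) (e :: w)) by apply: snake_uniq.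
have g2 := eastE_shared i j de (negbT nde).
rewrite !big_cons mW mS mN
    (@big_split_edge _ (matching i j s [:: d, e & w] [:: z, z' & zs]) _ uL gin)
    (@big_split_edge _ (matching i.+1 j (~~ s) (e :: w) (z' :: zs)) _ uL gin) mg mg' g2.
have -> : \prod_(f <- snake i.+1 j (~~ s) (e :: w) | (f != eastE i j s d) &&
    matching i j s [:: d, e & w] [:: z, z' & zs] f) X f.2 =
   \prod_(f <- snake i.+1 j (~~ s) (e :: w) | (f != eastE i j s d) &&
    matching i.+1 j (~~ s) (e :: w) (z' :: zs) f) X f.2.
  rewrite big_seq_cond [RHS]big_seq_cond; apply: eq_bigl => f.
  case fin: (f \in _) => //=; case: eqVneq => //= nf.
  by rewrite matching_tail_east ?nde.
set B := \big[_/_]_(_ <- _ | _) _.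
rewrite (north_link s) // nde in lk.
move: lk g2; rewrite /lower /upper /southE /westE /eastE /northE /tile_has /=.
case: (s); case: (z); case: (z') => //= _ g2; rewrite ?g2; field; exact: Xg.
Qed.

(** [G] sees the whole sequence of states, because the condition for good matchings compares states
    of tiles that are far apart. *)
Lemma walk_bits d w z (G : seq bool -> F) :
  \sum_(zs <- bits (size w) | linked (d :: w) (z :: zs))
     xrec d z w zs * (\prod_(e <- mask zs w) Y e) / (\prod_(e <- w) X e) * G zs =
  walk d w z (fun zs => upper (last d w) (last z zs) * G zs).
Proof.
elim: w d z G => [|e w IH] d z G.
  by rewrite big_mkcond big_seq1 /= !big_nil divr1 mulr1.
have P0 : \prod_(e <- w) X e != 0.
  by elim: (w) => [|a u IHu]; rewrite ?big_nil ?oner_eq0 // big_cons mulf_neq0.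
rewrite /= big_cat /=; congr (_ + _); rewrite big_map.
  rewrite (eq_bigl (fun zs => link d e z false && linked (e :: w) (false :: zs))) //.
  rewrite /transfer; case: (link d e z false) => /=; last by rewrite big_pred0 // mul0r.
  rewrite -IH mulr_sumr; apply: eq_bigr => zs _ /=; rewrite big_cons /tilew.
  by field; rewrite ?P0 ?X0.
rewrite (eq_bigl (fun zs => link d e z true && linked (e :: w) (true :: zs))) //.
rewrite /transfer; case: (link d e z true) => /=; last by rewrite big_pred0 // mul0r.
rewrite -IH mulr_sumr; apply: eq_bigr => zs _ /=; rewrite !big_cons /tilew.
by field; rewrite ?P0 ?X0.
Qed.

End Transfer.

(** * Matching sums as sums over bits *)

Section MatchingSum.
Variable T : tsurface.
Local Notation side := (side T).
Implicit Types (c d e : side) (u v w : seq side) (z : bool) (zs : seq bool).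
Variables (F : fieldType) (x y : 'I_(narc T) -> F).
Hypothesis X0 : forall d, xside x d != 0.
Local Notation X := (xside x).
Local Notation Y := (yside y).

Lemma matching_sum_bits w (good : pred {set sedge w}) : dualpath w ->
  matching_sum x y good =
  (\sum_(zs <- bits (size w) | linked w zs && good (mset w zs))
     (\prod_(f <- snake 0 0 true w | matching 0 0 true w zs f) X f.2) *
     \prod_(d <- mask zs w) Y d) / \prod_(d <- w) X d.
Proof.
move=> dp; rewrite /matching_sum /crossing_monomial; congr (_ / _).
transitivity (\sum_(P <- map (mset w) (filter (linked w) (bits (size w))) | good P)
   xmatching x P * ymatching y P).
  rewrite -big_filter_cond -big_filter -[RHS]big_filter; apply: perm_big; apply: uniq_perm.
  - by rewrite !filter_uniq // index_enum_uniq.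
  - rewrite filter_uniq // map_inj_in_uniq ?filter_uniq ?uniq_bits // => a b.
    rewrite !mem_filter !mem_bits => /andP[_ /eqP sa] /andP[_ /eqP sb]; exact: mset_inj.
  move=> P; rewrite !mem_filter mem_index_enum andbT; congr (_ && _).
  apply/idP/mapP => [/(perfect_msetP dp)[zs [sz lk ->]]|[zs]].
    by exists zs => //; rewrite mem_filter lk mem_bits sz eqxx.
  by rewrite mem_filter mem_bits => /andP[lk /eqP sz] ->; apply: mset_perfect.
rewrite big_map big_filter_cond /= big_seq_cond [RHS]big_seq_cond.
apply: eq_bigr => zs; rewrite mem_bits => /and3P[/eqP sz lk _].
rewrite /xmatching /ymatching; congr (_ * _).
  apply: (@big_seq_sub _ (tile_edges w) (snake 0 0 true w) _ _ _ _ _ (fun f => X f.2)).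
  - exact: snake_uniq.
  - by move=> f; rewrite tile_edgesE mem_tedges.
  - by move=> f; rewrite inE.
by rewrite -(tiles_enclosed_mset dp sz) big_map.
Qed.

Lemma matching_sum_walk d w (good : pred {set sedge (d :: w)}) : dualpath (d :: w) ->
  let G z zs := upper X (last d w) (last z zs) * (good (mset (d :: w) (z :: zs)))%:R in
  matching_sum x y good =
  lower X d false * tilew X Y d false * walk X Y d w false (G false) +
  lower X d true * tilew X Y d true * walk X Y d w true (G true).
Proof.
move=> dp G; rewrite matching_sum_bits // {}/G -!walk_bits //.
have P0 : \prod_(e <- w) X e != 0.
  by elim: (w) => [|a u IHu]; rewrite ?big_nil ?oner_eq0 // big_cons mulf_neq0.
rewrite [bits _]/= big_cat /= mulrDl !big_map /= !mulr_sumr !mulr_suml.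
congr (_ + _); rewrite big_mkcondr big_seq_cond [RHS]big_seq_cond; apply: eq_bigr => zs;
  rewrite mem_bits => /andP[/eqP sz lk]; rewrite (xprod_rec X0) //;
  case: (good _); rewrite ?mulr0 ?mul0r // ?mulr1 /tilew ?big_cons /lower; by field; rewrite ?P0 ?X0.
Qed.

End MatchingSum.

(** * Vectors and 2x2 matrices in explicit coordinates *)

Section Plane.
Variable F : fieldType.

Definition vec := (F * F)%type.
(* A matrix is the pair of its columns. *)
Definition mat := (vec * vec)%type.
Implicit Types (a b u : vec) (A B C : mat).

Definition det2 a b : F := a.1 * b.2 - a.2 * b.1.
Definition lincomb (k : F) a (l : F) b : vec := (k * a.1 + l * b.1, k * a.2 + l * b.2).
Definition scalev (k : F) a : vec := (k * a.1, k * a.2).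
Definition app A u : vec := lincomb u.1 A.1 u.2 A.2.
Definition mulm A B : mat := (app A B.1, app A B.2).
Definition scalem (k : F) A : mat := ((k * A.1.1, k * A.1.2), (k * A.2.1, k * A.2.2)).
Definition idm : mat := ((1, 0), (0, 1)).
Definition adjm A : mat := ((A.2.2, - A.1.2), (- A.2.1, A.1.1)).
Definition trm A : F := A.1.1 + A.2.2.

End Plane.

Ltac plane := rewrite /det2 /mulm /app /scalev /lincomb /scalem /idm /adjm /trm /=.
Ltac pring := plane; repeat congr (_, _); ring.

Section PlaneTheory.
Variable F : fieldType.
Implicit Types (k l : F) (a b u : vec F) (A B C : mat F).

Lemma mulmA A B C : mulm A (mulm B C) = mulm (mulm A B) C.
Proof. by pring. Qed.
Lemma mul1m A : mulm (idm F) A = A.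
Proof. by case: A => [[? ?] [? ?]]; pring. Qed.
Lemma mulm1 A : mulm A (idm F) = A.
Proof. by case: A => [[? ?] [? ?]]; pring. Qed.
Lemma app1m u : app (idm F) u = u.
Proof. by case: u => ? ?; pring. Qed.
Lemma app_mulm A B u : app (mulm A B) u = app A (app B u).
Proof. by pring. Qed.
Lemma trmC A B : trm (mulm A B) = trm (mulm B A).
Proof. by pring. Qed.
Lemma adjm_mul A B : adjm (mulm A B) = mulm (adjm B) (adjm A).
Proof. by pring. Qed.
Lemma adjmK A : adjm (adjm A) = A.
Proof. by case: A => [[? ?] [? ?]]; pring. Qed.
Lemma adjm_id : adjm (idm F) = idm F.
Proof. by pring. Qed.
Lemma det2_adj a A b : det2 a (app A b) = det2 (app (adjm A) a) b.
Proof. by pring. Qed.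
Lemma det2C a b : det2 a b = - det2 b a.
Proof. by pring. Qed.
Lemma det2xx a : det2 a a = 0.
Proof. by pring. Qed.
Lemma scalemA k l A : scalem k (scalem l A) = scalem (k * l) A.
Proof. by pring. Qed.
Lemma scalem1 A : scalem 1 A = A.
Proof. by case: A => [[? ?] [? ?]]; pring. Qed.
Lemma mulm_scalel k A B : mulm (scalem k A) B = scalem k (mulm A B).
Proof. by pring. Qed.
Lemma mulm_scaler k A B : mulm A (scalem k B) = scalem k (mulm A B).
Proof. by pring. Qed.
Lemma det2_scale k a A b : det2 a (app (scalem k A) b) = k * det2 a (app A b).
Proof. by pring. Qed.
Lemma trm_scale k A : trm (scalem k A) = k * trm A.
Proof. by pring. Qed.

Lemma cayley_hamilton a A B C b :
  det2 a (app (mulm A (mulm B C)) b) =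
  trm B * det2 a (app (mulm A C) b) - det2 a (app (mulm A (mulm (adjm B) C)) b).
Proof. by pring. Qed.

End PlaneTheory.

(** * Vectors at corners, gluing matrices, and the notched vector *)

Section Crossing.
Variable T : tsurface.
Local Notation side := (side T).
Implicit Types (c d e : side) (u v w l : seq side) (z : bool) (zs : seq bool).
Variables (F : fieldType) (X Y : side -> F).
Hypothesis X0 : forall d, X d != 0.
Hypothesis Xopp : forall d, X (opp d) = X d.
Hypothesis Yopp : forall d, Y (opp d) = Y d.

(* Vectors of determinant [X c] at the two ends of each side [c] of a triangle. *)
Definition vert c : vec F :=
  match val c.2 with
  | 0%N => (1, 0)
  | 1%N => (0, X (pv c))
  | _ => (- X (pv c) / X (nx c), - X c)
  end.

(** The sign is the same for all three sides: for positive [X] the vectors surround the origin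
    rather than lie in a half-plane. The corners are thus interchangeable, at the price of the signs
    [tau]. *)
Lemma det_vert c : det2 (vert c) (vert (nx c)) = X c.
Proof.
have [h1 h2] : (nx (nx (nx c)) = c) /\ pv (nx c) = c by rewrite nxE pv_nx.
rewrite /vert /det2; move: h1 h2.
case: c => t [[|[|[|k]]] lk] //= h1 h2.
- by rewrite h2; ring.
- by rewrite /pv in h2 *; rewrite nxE; field.
- have -> : pv (t, Ordinal lk) = nx (nx (t, Ordinal lk)) by [].
  by ring.
Qed.

Lemma det_vert_pv c : det2 (vert c) (vert (pv c)) = - X (pv c).
Proof. by rewrite det2C -{2}(nx_pv c) det_vert. Qed.

Lemma vert_rel c (u : vec F) : X (nx c) * det2 u (vert c) + X (pv c) * det2 u (vert (nx c))
   + X c * det2 u (vert (pv c)) = 0.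
Proof.
have := det_vert c; have := det_vert (nx c); have := det_vert (pv c).
rewrite nx_pv nx_nx => <- <- <-; by pring.
Qed.

(** The gluing map from the plane of the triangle of [opp d] to that of [d]. At the two common
    corners it sends [vert (opp d)] to [vert (nx d)], and [vert (nx (opp d))] to [- Y d] times
    [vert d]. *)
Definition cross_app d (u : vec F) : vec F :=
  lincomb (det2 u (vert (nx (opp d))) / X d) (vert (nx d))
          (Y d * det2 u (vert (opp d)) / X d) (vert d).
Definition crossm d : mat F := (cross_app d (1, 0), cross_app d (0, 1)).
Definition wordm w : mat F := foldr (fun d A => mulm (crossm d) A) (idm F) w.

Lemma crossmE d (u : vec F) : app (crossm d) u = cross_app d u.
Proof. by case: u => a b; rewrite /crossm /cross_app; pring. Qed.

Lemma det_left (a : vec F) d (u : vec F) : det2 a (app (crossm d) u) =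
  det2 a (vert (nx d)) * det2 u (vert (nx (opp d))) / X d +
  Y d * det2 a (vert d) * det2 u (vert (opp d)) / X d.
Proof. by rewrite crossmE /cross_app; pring. Qed.

Lemma crossm_opp d : crossm (opp d) = scalem (-1) (adjm (crossm d)).
Proof. by rewrite /crossm /cross_app oppK Xopp Yopp; pring. Qed.

Lemma crossm_cancel d : mulm (crossm d) (crossm (opp d)) = scalem (- Y d) (idm F).
Proof.
have e1 := det_vert d; have := det_vert (opp d); rewrite Xopp => e2.
have H : Y d = Y d * det2 (vert d) (vert (nx d)) * det2 (vert (opp d)) (vert (nx (opp d))) / X d / X d.
  by rewrite e1 e2; field.
rewrite crossm_opp H /crossm /cross_app; by pring.
Qed.

Lemma wordm_cat u v : wordm (u ++ v) = mulm (wordm u) (wordm v).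
Proof. by elim: u => [|d u IH] /=; rewrite ?mul1m // IH mulmA. Qed.

Lemma wordm1 d : wordm [:: d] = crossm d.
Proof. exact: mulm1. Qed.

Lemma wordm_inv w : wordm (inv w) = scalem ((-1) ^+ size w) (adjm (wordm w)).
Proof.
elim: w => [|d w IH]; first by rewrite /= adjm_id scalem1.
rewrite inv_cons -cats1 wordm_cat wordm1 IH crossm_opp /= adjm_mul.
by rewrite mulm_scalel mulm_scaler scalemA exprSr.
Qed.

Definition pairing (a : vec F) w (b : vec F) := det2 a (app (wordm w) b).

Lemma pairing_cons a d w b : pairing a (d :: w) b = pairing (app (adjm (crossm d)) a) w b.
Proof. by rewrite /pairing /= app_mulm det2_adj. Qed.

Lemma pairing_inv a w b : pairing b (inv w) a = - (-1) ^+ size w * pairing a w b.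
Proof.
by rewrite /pairing wordm_inv det2_scale det2_adj adjmK det2C mulrN mulNr.
Qed.

Lemma pairing_skein a b w1 w2 w3 :
  pairing a (w1 ++ w2 ++ w3) b =
  trm (wordm w2) * pairing a (w1 ++ w3) b
  - (-1) ^+ size w2 * pairing a (w1 ++ inv w2 ++ w3) b.
Proof.
rewrite /pairing !wordm_cat cayley_hamilton; congr (_ - _).
rewrite wordm_inv mulm_scalel mulm_scaler det2_scale mulrA.
by rewrite -expr2 sqrr_sign mul1r.
Qed.

Definition yword w : F := \prod_(d <- w) Y d.

Lemma yword_cons d w : yword (d :: w) = Y d * yword w.
Proof. by rewrite /yword big_cons. Qed.
Lemma yword_cat u v : yword (u ++ v) = yword u * yword v.
Proof. by rewrite /yword big_cat. Qed.

(** The matrices are not those of a representation of the fundamental groupoid: going there and back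
    along [u] is a scalar, and this scalar is the source of the monomials in y. *)
Lemma wordm_backtrack u : wordm (inv u ++ u) = scalem ((-1) ^+ size u * yword u) (idm F).
Proof.
elim: u => [|d u IH]; first by rewrite /= /yword big_nil mulr1 scalem1.
rewrite inv_cons -cats1 -catA /= -cat1s.
have -> : inv u ++ opp d :: d :: u = inv u ++ [:: opp d; d] ++ u by [].
rewrite !wordm_cat [wordm [:: _; _]]/= mulm1 -{2}(oppK d) crossm_cancel Yopp.
rewrite mulm_scalel mul1m mulm_scaler -wordm_cat IH scalemA yword_cons exprS.
by congr scalem; ring.
Qed.

Lemma pairing_backtrack a p u q b :
  pairing a (p ++ inv u ++ u ++ q) b = (-1) ^+ size u * yword u * pairing a (p ++ q) b.
Proof.
rewrite /pairing catA (catA (p ++ _)) -(catA p) !wordm_cat -(wordm_cat (inv u)).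
by rewrite wordm_backtrack mulm_scaler mulm1 mulm_scalel det2_scale -wordm_cat.
Qed.

Lemma trace_conj u v :
  trm (wordm (u ++ v ++ inv u)) = (-1) ^+ size u * yword u * trm (wordm v).
Proof.
rewrite !wordm_cat mulmA trmC mulmA -wordm_cat wordm_backtrack mulm_scalel mul1m.
by rewrite trm_scale.
Qed.

(** Unwinding a plain end clockwise costs only a sign; [pairing_vert_nx] shows the price [Y d] of
    the other direction. For notched ends, [pairing_hat_rho] and [pairing_hat_nx] exchange the two
    prices. *)
Lemma pairing_vert_rho d w b :
  pairing (vert d) (d :: w) b = - pairing (vert (rho d)) w b.
Proof.
rewrite /pairing /= app_mulm det_left det_vert det2xx /rho.
by rewrite [X in _ = - X]det2C; have := X0 d => h; field.
Qed.

Lemma pairing_vert_nx d w b :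
  pairing (vert (nx d)) (d :: w) b = Y d * pairing (vert (opp d)) w b.
Proof.
rewrite /pairing /= app_mulm det_left det2xx [det2 _ (vert d)]det2C det_vert.
by rewrite [X in _ = _ * X]det2C; have := X0 d => h; field.
Qed.

(* The notched vector at c: horocyclic lengths [hlen] of the corners around    *)
(* the puncture, weighted by the y-variables of the arcs passed.               *)
Definition hlen c := X (nx c) / (X (pv c) * X c).
Fixpoint fanlen l : F := if l is c :: l' then hlen c + Y c * fanlen l' else 0.
Definition hat c : vec F :=
  lincomb (fanlen (orbit (@rho T) c)) (vert c)
          ((1 - yword (orbit (@rho T) c)) / X (pv c)) (vert (pv c)).

Lemma orbit_rho c : exists2 l, orbit (@rho T) c = c :: l & orbit (@rho T) (rho c) = rcons l c.
Proof.
exists (behead (orbit (@rho T) c)); first by rewrite /orbit -orderSpred.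
have E : order (@rho T) (rho c) = order (@rho T) c.
  by apply: (@eq_card _ (fconnect (@rho T) (rho c))) => d;
     rewrite !unfold_in; apply/esym/(@same_fconnect1 _ _ (@rho_inj T)).
rewrite /orbit E -orderSpred trajectSr /= -iterSr orderSpred.
by rewrite iter_order //; exact: rho_inj.
Qed.

Lemma fanlen_rcons l c : fanlen (rcons l c) = fanlen l + yword l * hlen c.
Proof.
elim: l => [|d l IH] /=; first by rewrite /yword big_nil; ring.
by rewrite IH yword_cons; ring.
Qed.

Lemma yword_orbit c : yword (orbit (@rho T) (rho c)) = yword (orbit (@rho T) c).
Proof.
by have [l -> ->] := orbit_rho c; rewrite yword_cons -cats1 yword_cat yword_cons /yword big_nil; ring.
Qed.

Lemma fanlen_orbit c : fanlen (orbit (@rho T) c) =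
  Y c * fanlen (orbit (@rho T) (rho c)) + (1 - yword (orbit (@rho T) c)) * hlen c.
Proof.
by have [l -> ->] := orbit_rho c; rewrite fanlen_rcons yword_cons /=; ring.
Qed.

(** Starting the fan one side later expresses the notched vector through the corners [c] and [nx c],
    where its definition uses [c] and [pv c]. *)
Lemma det_hat (u : vec F) c : det2 u (hat c) =
  Y c * fanlen (orbit (@rho T) (rho c)) * det2 u (vert c)
  - (1 - yword (orbit (@rho T) c)) / X c * det2 u (vert (nx c)).
Proof.
have -> : det2 u (hat c) = fanlen (orbit (@rho T) c) * det2 u (vert c)
   + (1 - yword (orbit (@rho T) c)) / X (pv c) * det2 u (vert (pv c)).
  by rewrite /hat; pring.
rewrite fanlen_orbit /hlen; have := vert_rel c u => rel.
have -> : det2 u (vert (pv c)) = - (X (nx c) * det2 u (vert c) + X (pv c) * det2 u (vert (nx c))) / X c.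
  by apply: (mulfI (X0 c)); rewrite [in RHS]mulrC divfK //; apply/eqP; rewrite -addr_eq0 addrC; apply/eqP.
by field; rewrite !X0.
Qed.

Lemma det2_ext (a b : vec F) : (forall u : vec F, det2 u a = det2 u b) -> a = b.
Proof.
case: a b => a1 a2 [b1 b2] H; have := H (1, 0); have := H (0, 1).
by rewrite /det2 /= !mul1r !mul0r !sub0r !subr0 => /oppr_inj-> ->.
Qed.

(** Under the same matrix [vert (rho d)] becomes [- Y d] times [vert d]. So [vert] and [hat] are
    eigenvectors of the turn around a puncture, with eigenvalues the products of the [- Y d] and of
    the [- 1]. *)
Lemma cross_hat d : app (crossm d) (hat (rho d)) = scalev (-1) (hat d).
Proof.
apply: det2_ext => u.
have -> : det2 u (scalev (-1) (hat d)) = - det2 u (hat d) by pring.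
rewrite det_left [det2 (hat _) (vert (nx _))]det2C [det2 (hat _) (vert (opp _))]det2C.
have -> : det2 (vert (nx (opp d))) (hat (rho d)) = - (1 - yword (orbit (@rho T) d)).
  have -> : det2 (vert (nx (opp d))) (hat (rho d)) = (1 - yword (orbit (@rho T) (rho d))) / X (pv (rho d)) * det2 (vert (nx (opp d))) (vert (pv (rho d))).
    by rewrite /hat /rho; pring.
  rewrite yword_orbit /rho pv_nx det2C det_vert; field; exact: X0.
have -> : det2 (vert (opp d)) (hat (rho d)) = fanlen (orbit (@rho T) (rho d)) * X d.
  have -> : det2 (vert (opp d)) (hat (rho d)) = fanlen (orbit (@rho T) (rho d)) * det2 (vert (opp d)) (vert (rho d)).
    by rewrite /hat /rho pv_nx; pring.
  by rewrite /rho det_vert Xopp.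
by rewrite det_hat; field; exact: X0.
Qed.

Lemma pairing_hat_rho d w b :
  pairing (hat d) (d :: w) b = - Y d * pairing (hat (rho d)) w b.
Proof.
have e := det_vert d; have := det_vert (opp d); rewrite Xopp => e2.
have -> : pairing (hat d) (d :: w) b = - det2 (app (crossm d) (hat (rho d))) (app (wordm (d :: w)) b).
  by rewrite cross_hat /pairing; pring.
rewrite /pairing [wordm (d :: w)]/= app_mulm !crossmE /cross_app.
set p := app (wordm w) b; set h := hat _; move: p h => p h.
have -> : - Y d * det2 h p = - Y d * (det2 (vert d) (vert (nx d)) * det2 (vert (opp d)) (vert (nx (opp d)))) * det2 h p / X d / X d.
  by rewrite e e2; field.
by pring.
Qed.

Lemma pairing_hat_nx d w b :
  pairing (hat (nx d)) (d :: w) b = pairing (hat (opp d)) w b.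
Proof.
rewrite pairing_cons; congr (pairing _ _ _).
have -> : app (adjm (crossm d)) (hat (nx d)) = scalev (-1) (app (crossm (opp d)) (hat (nx d))).
  by rewrite crossm_opp; pring.
rewrite -rho_opp cross_hat; case: (hat _) => ? ?; by pring.
Qed.

End Crossing.

(** * Edges of tiles by index, and the sides around a puncture *)

Section EdgeIndex.
Variable T : tsurface.
Local Notation side := (side T).
Implicit Types (c d e : side) (u v w l : seq side) (z : bool) (zs : seq bool).

Lemma has_edge_lower_nth d0 w zs k c : dualpath w -> size zs = size w -> (k < size w)%N ->
  ((0 < k)%N -> c != shared (nth d0 w k.-1) (nth d0 w k)) ->
  c \in [:: nx (nth d0 w k); pv (nth d0 w k)] ->
  has_edge (mset w zs) (nth [::] (map (@lower_half T) (tiles w)) k) c =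
  (c == nx (nth d0 w k)) (+) nth false zs k.
Proof.
move=> dp sz kw cs cin.
have [wE zE] : w = take k w ++ nth d0 w k :: drop k.+1 w /\
   zs = take k zs ++ nth false zs k :: drop k.+1 zs.
  by rewrite -!drop_nth ?sz // !cat_take_drop.
have szk : size (take k w) = k by rewrite size_takel // ltnW.
have := @has_edge_lower T (take k w) (nth d0 w k) (drop k.+1 w) (take k zs) (nth false zs k)
  (drop k.+1 zs) c.
rewrite -wE -zE szk => -> //.
- by rewrite size_takel // sz ltnW.
- case E: (take k w) => [//|u0 u']; have k0 : (0 < k)%N by rewrite -szk E.
  rewrite (_ : last u0 u' = nth d0 w k.-1) ?cs //.
  by transitivity (last d0 (take k w)); [rewrite E | rewrite -nth_last szk nth_take ?ltn_predL].
Qed.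

Lemma has_edge_upper_nth d0 w zs k c : dualpath w -> size zs = size w -> (k < size w)%N ->
  ((k.+1 < size w)%N -> c != shared (nth d0 w k) (nth d0 w k.+1)) ->
  c \in [:: nx (opp (nth d0 w k)); pv (opp (nth d0 w k))] ->
  has_edge (mset w zs) (nth [::] (map (@upper_half T) (tiles w)) k) c =
  (c == nx (opp (nth d0 w k))) (+) nth false zs k.
Proof.
move=> dp sz kw cs cin.
have [wE zE] : w = take k w ++ nth d0 w k :: drop k.+1 w /\
   zs = take k zs ++ nth false zs k :: drop k.+1 zs.
  by rewrite -!drop_nth ?sz // !cat_take_drop.
have szk : size (take k w) = k by rewrite size_takel // ltnW.
have := @has_edge_upper T (take k w) (nth d0 w k) (drop k.+1 w) (take k zs) (nth false zs k)
  (drop k.+1 zs) c.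
rewrite -wE -zE szk => -> //.
- by rewrite size_takel // sz ltnW.
- case: ltnP cs => [kw2 /(_ isT)|kw2 _]; last by rewrite drop_oversize.
  by rewrite (drop_nth d0).
Qed.

Lemma puncture_orbit c : puncture c -> exists l,
  [/\ orbit (@rho T) c = c :: l, path (frel (@rho T)) c l, rho (last c l) = c &
      dualpath (c :: l)].
Proof.
move=> pc; have [l E _] := orbit_rho c; exists l.
have lE : l = traject (@rho T) (rho c) (order (@rho T) c).-1.
  by have := E; rewrite /orbit -orderSpred => -[].
split=> //.
- by rewrite lE; apply: fpath_traject.
- by rewrite lE last_traject -iterS orderSpred iter_order //; exact: rho_inj.
move: pc; rewrite /puncture E /dualpath => -> /=.
have : path (frel (@rho T)) c l by rewrite lE; apply: fpath_traject.
by apply: sub_path => a b /eqP<-; rewrite /turn eqxx.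
Qed.

End EdgeIndex.

(** * Pairings along taut words as transfer sums *)

Section TautEvaluation.
Variable T : tsurface.
Local Notation side := (side T).
Implicit Types (c d e : side) (u v w l : seq side) (z : bool) (zs : seq bool).
Variables (F : fieldType) (X Y : side -> F).
Hypothesis X0 : forall d, X d != 0.
Hypothesis Xopp : forall d, X (opp d) = X d.
Hypothesis Yopp : forall d, Y (opp d) = Y d.
Local Notation vert := (vert X).
Local Notation hat := (hat X Y).
Local Notation transfer := (transfer X Y).
Local Notation walkl := (walkl X Y).
Local Notation pairing := (pairing X Y).
Local Notation fanlen := (fanlen X Y).
Implicit Types (a b : vec F).

(** [link] forbids one of the four transitions, so the transfer matrix is triangular; the two kinds
    of turn give the two kinds of triangular matrices. *)
Lemma transfer_nx d e (t := transfer d e) : e = nx (opp d) ->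
  [/\ t false false = 1, t false true = 0, t true false = X (nx e) / X e &
      t true true = X d * Y e / X e].
Proof.
move=> E; have E1 : pv (opp d) = nx e by rewrite E.
have E2 : pv e = opp d by rewrite E pv_nx.
rewrite /t /transfer /link /shared /lower /upper /tilew -E eqxx /= E1 E2 Xopp.
by split=> //; field; rewrite !X0.
Qed.

Lemma transfer_pv d e (t := transfer d e) : e = pv (opp d) ->
  [/\ t false false = X d / X e, t false true = X (nx (opp d)) * Y e / X e,
      t true false = 0 & t true true = Y e].
Proof.
move=> E; have E1 : nx (opp d) = pv e by rewrite E pv_pv.
have E2 : nx e = opp d by rewrite E nx_pv.
rewrite /t /transfer /link /shared /lower /upper /tilew E1 -E neq_pv /= E2 Xopp.
by split=> //; field; rewrite !X0.
Qed.

Fixpoint tsign d w : F :=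
  if w is e :: w' then (-1) ^+ (e == nx (opp d)) * tsign e w' else 1.

(** [phi] and [beta] are the coordinates of [a] and [b] with respect to the ends of the side just
    crossed. In these coordinates a gluing matrix becomes the transfer matrix, up to the sign of the
    turn. *)
Lemma walkl_pairing a b d w (phi beta : bool -> F) : dualpath (d :: w) ->
  det2 a (vert (opp d)) = - X d * phi false ->
  det2 a (vert (nx (opp d))) = - X d * phi true ->
  (forall u : vec F, X (last d w) * det2 u b =
     - (beta false * det2 u (vert (opp (last d w))) +
        beta true * det2 u (vert (nx (opp (last d w)))))) ->
  pairing a w b = tsign d w * (phi false * walkl d w false beta + phi true * walkl d w true beta).
Proof.
elim: w a d phi => [|e w IH] a d phi dp H0 H1 Hb.
  apply: (mulfI (X0 d)); rewrite /pairing /= app1m Hb H0 H1 /walkl /=; ring.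
move: dp; rewrite dualpath_cons => /and3P[di de dp].
rewrite pairing_cons.
pose s : F := (-1) ^+ (e == nx (opp d)).
have s2 : s * s = 1 by rewrite /s -expr2 sqrr_sign.
(* The new coordinates are the row vector [phi] times the transfer matrix, with the sign of this
   turn. *)
rewrite (IH _ e (fun z => s * (phi false * transfer d e false z + phi true * transfer d e true z)) dp) //.
- rewrite !walkl_cons [tsign d _]/= -/s; ring.
- rewrite -det2_adj det_left // det2xx det_vert // Xopp.
  have -> : det2 a (vert (nx e)) * X e / X e + Y e * det2 a (vert e) * 0 / X e = det2 a (vert (nx e)).
    by field; exact: X0.
  case/turnP: de => E.
    have [-> _ -> _] := transfer_nx E; rewrite /s E eqxx expr1.
    have := vert_rel X0 (opp d) a; rewrite H0 H1 Xopp -nx_nx -!E => rel.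
    have : X d * det2 a (vert (nx e)) = X d * (X e * phi false + X (nx e) * phi true).
      by apply/eqP; rewrite -subr_eq0; apply/eqP; rewrite -[RHS]rel; ring.
    by move/(mulfI (X0 d)) ->; field; exact: X0.
  have [-> _ -> _] := transfer_pv E; rewrite /s E pv_nx_neq expr0 nx_pv H0 mulr0 addr0.
  by field; exact: X0.
rewrite -det2_adj det_left // det2xx [det2 (vert (nx (opp e))) _]det2C det_vert // Xopp.
have -> : det2 a (vert (nx e)) * 0 / X e + Y e * det2 a (vert e) * - X e / X e = - Y e * det2 a (vert e).
  by field; exact: X0.
case/turnP: de => E.
  have [_ -> _ ->] := transfer_nx E; rewrite /s E eqxx expr1 H1.
  by field; exact: X0.
have [_ -> _ ->] := transfer_pv E; rewrite /s E pv_nx_neq expr0.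
have := vert_rel X0 (opp d) a; rewrite H0 H1 Xopp -!E => rel.
have : X d * det2 a (vert e) = X d * (X (nx (opp d)) * phi false + X e * phi true).
  by apply/eqP; rewrite -subr_eq0; apply/eqP; rewrite -[RHS]rel; ring.
by move/(mulfI (X0 d)) ->; field; exact: X0.
Qed.

(** Along a fan the state can drop from true to false but never return. Summing over the place of
    the drop produces [fanlen], and not dropping produces the product of the [Y]. *)
Lemma fan_walk c l (k := last c l) g : path (frel (@rho T)) c l ->
  walkl c l false g = g false /\
  walkl c l true g = X c * (fanlen l * g false + yword Y l / X k * g true).
Proof.
rewrite /k; elim: l c {k} => [|e l IH] c.
  by move=> _; rewrite /walkl /= /yword big_nil; split=> //; field; exact: X0.
case/andP=> /eqP E pl; have {pl}[IH0 IH1] := IH _ pl.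
have e_nx : e = nx (opp c) by rewrite -E.
have pve : pv e = opp c by rewrite e_nx pv_nx.
have [t00 t01 t10 t11] := transfer_nx e_nx.
rewrite !walkl_cons IH0 IH1 t00 t01 t10 t11; split; first ring.
have -> : fanlen (e :: l) = hlen X e + Y e * fanlen l by [].
rewrite yword_cons [last c _]/= /hlen pve Xopp.
by field; rewrite !X0.
Qed.

(** Once its tiles are summed out, a hook acts as a modified edge weight of the adjacent tile. Plain
    and notched ends can then be evaluated by one formula. *)
Definition hookw c z : F :=
  if z then X c * Y c * fanlen (orbit (@rho T) (rho c))
  else X (pv c) * fanlen (orbit (@rho T) c).

Definition startw (n : bool) c d := if n then hookw c else lower X d.
Definition endw (n : bool) c d := if n then hookw c else upper X d.
Definition pvec (n : bool) c := if n then hat c else vert c.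

Lemma startwE n d : let c := pv d in
  det2 (pvec n c) (vert (nx d)) = - startw n c d false /\
  det2 (pvec n c) (vert d) = startw n c d true.
Proof.
move=> c; have dE : d = nx c by rewrite /c nx_pv.
clearbody c; subst d; case: n; rewrite /pvec /startw /hookw.
  split; last first.
    rewrite det2C det_hat // det2xx [det2 (vert (nx c)) _]det2C det_vert //; ring.
  have -> : det2 (hat c) (vert (nx (nx c))) = fanlen (orbit (@rho T) c) * det2 (vert c) (vert (pv c)).
    by rewrite /hat; pring.
  by rewrite det_vert_pv //; ring.
rewrite /lower; split; last by rewrite pv_nx det_vert.
by rewrite nx_nx det_vert_pv.
Qed.

Lemma endwE n (l : side) (u : vec F) : let c := pv (opp l) in
  X l * det2 u (pvec n c) =
   - (endw n c l false * det2 u (vert (opp l)) + endw n c l true * det2 u (vert (nx (opp l)))).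
Proof.
move=> c; have oE : opp l = nx c by rewrite /c nx_pv.
have Xl : X l = X (nx c) by rewrite -oE Xopp.
rewrite /upper oE Xl; clearbody c; have := vert_rel X0 c u => rel.
case: n; rewrite /pvec /endw /hookw; last first.
  apply/eqP; rewrite -subr_eq0; apply/eqP; rewrite /upper oE nx_nx pv_nx -[RHS]rel; ring.
rewrite det_hat // [fanlen (orbit _ c)]fanlen_orbit /hlen.
have -> : det2 u (vert c) = - (X c * det2 u (vert (pv c)) + X (pv c) * det2 u (vert (nx c))) / X (nx c).
  apply: (mulfI (X0 (nx c))); rewrite [in RHS]mulrC divfK //; apply/eqP; rewrite -subr_eq0.
  by apply/eqP; rewrite -[RHS]rel; ring.
by rewrite nx_nx; field; rewrite !X0.
Qed.

Lemma taut_pairing n0 n1 d w (l := last d w) : dualpath (d :: w) ->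
  let c0 := pv d in let c1 := pv (opp l) in
  let ph z := startw n0 c0 d z * tilew X Y d z in
  pairing (pvec n0 c0) (d :: w) (pvec n1 c1) =
  tsign d w * (ph false * walkl d w false (endw n1 c1 l) + ph true * walkl d w true (endw n1 c1 l)).
Proof.
move=> dp c0 c1 ph; rewrite pairing_cons.
have [s0 s1] := startwE n0 d.
rewrite (@walkl_pairing _ _ d w ph (endw n1 c1 l)) //.
- rewrite -det2_adj det_left // s0 s1 det2xx det_vert // Xopp /ph /tilew.
  by field; exact: X0.
- rewrite -det2_adj det_left // s0 s1 det2xx [det2 (vert (nx (opp d))) _]det2C det_vert // Xopp /ph /tilew.
  by field; exact: X0.
by move=> u; apply: endwE.
Qed.

End TautEvaluation.

(** * Loop graphs: summing out the hooks *)

Section HookedValue.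
Variable T : tsurface.
Local Notation side := (side T).
Implicit Types (c d e : side) (u v w l : seq side) (z : bool) (zs : seq bool).
Variables (F : fieldType) (x y : 'I_(narc T) -> F).
Local Notation X := (xside x).
Local Notation Y := (yside y).
Hypothesis X0 : forall d, X d != 0.
Hypothesis Xopp : forall d, X (opp d) = X d.
Hypothesis Yopp : forall d, Y (opp d) = Y d.
Local Notation walk := (walk X Y).
Local Notation walkl := (walkl X Y).
Local Notation transfer := (transfer X Y).
Local Notation tilew := (tilew X Y).
Local Notation fanlen := (fanlen X Y).

Definition tautval (n0 n1 : bool) d w : F :=
  let ph z := startw X Y n0 (pv d) d z * tilew d z in
  let be := endw X Y n1 (pv (opp (last d w))) (last d w) in
  ph false * walkl d w false be + ph true * walkl d w true be.

Lemma xplain_tautval d w : dualpath (d :: w) -> xplain x y (d :: w) = tautval false false d w.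
Proof.
move=> dp; rewrite /xplain matching_sum_walk // /tautval /startw /endw /walkl.
by congr (_ * _ + _ * _); apply: eq_walk => zs _; rewrite mulr1.
Qed.

Lemma end_hook d w l zd (c := pv (opp (last d w))) : dualpath (d :: w) ->
  orbit (@rho T) c = c :: l -> path (frel (@rho T)) c l -> rho (last c l) = c ->
  walk d (w ++ c :: l) zd (fun zs => upper X (last d (w ++ c :: l)) (last zd zs) *
     (nth false (zd :: zs) (size w) || ~~ last zd zs)%:R) =
  X c * walkl d w zd (endw X Y true c (last d w)).
Proof.
move=> dp orb pl rl; rewrite walk_cat -walk_scale; apply: eq_walk => zu szu.
set k := last c l in rl.
have ok : opp k = pv c by rewrite -rl /rho pv_nx.
set zz := last zd zu; pose G z := upper X k z * (zz || ~~ z)%:R.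
transitivity (walkl (last d w) (c :: l) zz G).
  apply: eq_walk => zv _; rewrite last_cat /= last_cat -/k /G; congr (_ * (_ || _)%:R).
  by rewrite -cat_cons nth_cat /= szu ltnS leqnn -szu; apply: (nth_last false (zd :: zu)).
rewrite walkl_cons; have [-> ->] := fan_walk Y X0 Xopp G pl; rewrite /G.
have cE : c = pv (opp (last d w)) by [].
have Xl : X (nx c) = X (last d w) by rewrite /c nx_pv Xopp.
have Xp : X (pv c) = X (nx (opp (last d w))) by rewrite /c pv_pv.
have [t00 t01 t10 t11] := transfer_pv Y X0 Xopp cE.
have [_ _ orb' _] : [/\ True, True, orbit (@rho T) (rho c) = rcons l c & True].
  by have [l'] := orbit_rho c; rewrite orb => -[<-].
rewrite /endw /hookw /upper ok orb orb' fanlen_rcons.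
have Xk : X k = X (pv c) by rewrite -Xopp ok.
have -> : fanlen (c :: l) = hlen X c + Y c * fanlen l by [].
rewrite -/k Xk nx_pv pv_pv /hlen.
clear G; case: zz; rewrite ?t00 ?t01 ?t10 ?t11 /= -?Xl -?Xp; by field; rewrite !X0.
Qed.

Lemma start_hook c l zd (d := nx c) (k := last c l) :
  orbit (@rho T) c = c :: l -> path (frel (@rho T)) c l -> rho k = c ->
  let g zd z0 := fun zk => transfer k d zk zd * (z0 || ~~ zd)%:R in
  lower X c false * tilew c false * walkl c l false (g zd false) +
  lower X c true * tilew c true * walkl c l true (g zd true) =
  X (pv c) * (startw X Y true c d zd * tilew d zd).
Proof.
move=> orb pl rl g.
have ok : opp k = pv c by rewrite -rl /rho pv_nx.
have [-> _] := fan_walk Y X0 Xopp (g zd false) pl.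
have [_ ->] := fan_walk Y X0 Xopp (g zd true) pl.
have dE : d = pv (opp k) by rewrite ok pv_pv.
have [t00 t01 t10 t11] := transfer_pv Y X0 Xopp dE.
have orb' : orbit (@rho T) (rho c) = rcons l c.
  by have [l'] := orbit_rho c; rewrite orb => -[<-].
have Xk : X k = X (pv c) by rewrite -Xopp ok.
rewrite /startw /hookw orb orb' fanlen_rcons /g /tilew /lower -/k Xk -/d.
have -> : fanlen (c :: l) = hlen X c + Y c * fanlen l by [].
case: zd; rewrite ?t00 ?t01 ?t10 ?t11 ?ok ?nx_pv ?Xk /hlen -/d /=; by field; rewrite !X0.
Qed.

(** The glued side is the [pv] edge of the tile next to the hook and the [nx] edge of the end tile.
    It therefore belongs to the state true of the former and to the state false of the latter. *)
Lemma glue_end W u d w l zs (c1 := pv (opp (last d w))) :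
  W = u ++ (d :: w) ++ c1 :: l -> dualpath W -> rho (last c1 l) = c1 -> size zs = size W ->
  good_glue (mset W zs) (nth [::] (map (@upper_half T) (tiles W)) (size u + (size w).+1).-1)
            (nth [::] (map (@upper_half T) (tiles W)) (size W).-1) c1 =
  nth false zs (size u + size w) || ~~ last false zs.
Proof.
move=> WE dpW rl szs.
have sW : size W = (size u + (size w).+1 + (size l).+1)%N by rewrite WE !size_cat /= addnA.
have n1W : nth d W (size u + size w) = last d w.
  by rewrite WE nth_cat ltnNge leq_addr /= addKn -cat_cons nth_cat /= ltnS leqnn; apply: (nth_last d (d :: w)).
have n2W : nth d W (size u + size w).+1 = c1.
  by rewrite WE -addnS nth_cat ltnNge leq_addr /= addKn -cat_cons nth_cat /= ltnn subnn.
have n3W : nth d W (size W).-1 = last c1 l.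
  by rewrite nth_last WE !last_cat.
have W0 : (0 < size W)%N by rewrite sW addnS.
rewrite /good_glue addnS /=.
rewrite (@has_edge_upper_nth _ d) //; first last.
- by rewrite n1W !inE eqxx orbT.
- by rewrite n1W n2W /shared /c1 pv_nx_neq /= pv_nx_neq.
- by rewrite sW -addnA ltn_add2l addSn ltnS leq_addr.
rewrite (@has_edge_upper_nth _ d) //; first last.
- by rewrite n3W -/(rho (last c1 l)) rl !inE eqxx.
- by rewrite prednK // ltnn.
- by rewrite prednK.
by rewrite n1W n3W -/(rho (last c1 l)) rl eqxx /c1 pv_nx_neq /= -szs nth_last.
Qed.

Lemma glue_start W l d v zs (c0 := pv d) : rho (last c0 l) = c0 ->
  W = (c0 :: l) ++ d :: v -> dualpath W -> size zs = size W ->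
  good_glue (mset W zs) (nth [::] (map (@lower_half T) (tiles W)) 0)
            (nth [::] (map (@lower_half T) (tiles W)) (size (c0 :: l))) (pv c0) =
  head false zs || ~~ nth false zs (size (c0 :: l)).
Proof.
move=> rl WE dpW szs.
have sW : size W = ((size l).+1 + (size v).+1)%N by rewrite WE !size_cat.
have n1W : nth d W 0 = c0 by rewrite WE.
have n2W : nth d W (size (c0 :: l)) = d by rewrite WE nth_cat ltnn subnn.
have n3W : nth d W (size l) = last c0 l.
  by rewrite WE nth_cat /= ltnS leqnn; apply: (nth_last d (c0 :: l)).
have dE : d = nx c0 by rewrite /c0 nx_pv.
rewrite /good_glue (@has_edge_lower_nth _ d) //; first last.
- by rewrite n1W !inE eqxx orbT.
- by rewrite sW.
rewrite (@has_edge_lower_nth _ d) //; first last.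
- by rewrite n2W dE nx_nx !inE eqxx.
- move=> _; rewrite [_.-1]/= n2W n3W /shared -/(rho (last c0 l)) rl.
  by rewrite {1}dE nx_neq pv_neq.
- by rewrite sW addnS ltnS leq_addr.
by rewrite n1W n2W dE nx_nx eqxx pv_nx_neq -nth0.
Qed.

(** The type of matchings depends on the word, so a hooked word cannot be rewritten in place; the
    equation for [W] is substituted here once and for all. *)
Lemma matching_sum_walkE W d v (good : pred {set sedge W}) (gd : pred (seq bool)) :
  W = d :: v -> dualpath W -> (forall zs, size zs = size W -> good (mset W zs) = gd zs) ->
  let G z zs := upper X (last d v) (last z zs) * (gd (z :: zs))%:R in
  matching_sum x y good =
  lower X d false * tilew d false * walk d v false (G false) +
  lower X d true * tilew d true * walk d v true (G true).
Proof.
move=> WE; subst W => dp goodE G; rewrite matching_sum_walk //.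
by congr (_ * _ + _ * _); apply: eq_walk => zs szs; rewrite goodE //= szs.
Qed.

(** Each hook, summed out, leaves besides [hookw] the weight of the side along which it is glued,
    and this is the weight by which [xhooked] divides. *)
Lemma xhooked_tautval (n0 n1 : bool) d w (c0 := pv d) (c1 := pv (opp (last d w))) :
  dualpath (d :: w) -> (n0 -> puncture c0) -> (n1 -> puncture c1) ->
  xhooked x y (IPath c0 (d :: w) c1) n0 n1 = tautval n0 n1 d w.
Proof.
move=> dp p0 p1; rewrite /xhooked [org _]/= [word _]/= [dst _]/=.
set h0 := hook n0 c0; set h1 := hook n1 c1.
set W := h0 ++ (d :: w) ++ h1.
(* The second gluing condition involves only states from the tile of [d] on, so the second hook is
   summed out before the first one is considered. *)
pose rg zd zs := n1 ==> (nth false (zd :: zs) (size w) || ~~ last zd zs).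
have right zd : walk d (w ++ h1) zd (fun zs => upper X (last d (w ++ h1)) (last zd zs) *
     (rg zd zs)%:R) = (if n1 then X c1 else 1) * walkl d w zd (endw X Y n1 c1 (last d w)).
  rewrite /rg /h1; case: (n1) p1 => p1.
    have [l [orb pl rl _]] := puncture_orbit (p1 isT).
    by rewrite [hook _ _]/= orb end_hook.
  by rewrite cats0 mul1r; apply: eq_walk => zs _; rewrite mulr1.
have dp1 : dualpath ((d :: w) ++ h1).
  rewrite /h1; case: (n1) p1 => p1; last by rewrite cats0.
  have [l [orb pl rl dpl]] := puncture_orbit (p1 isT).
  by rewrite [hook _ _]/= orb dualpath_catE dp dpl /turn eqxx orbT.
have sW : size W = (size h0 + (size w).+1 + size h1)%N by rewrite /W !size_cat /= addnA.
have dpW : dualpath W.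
  rewrite /W /h0; case: (n0) p0 => p0 //.
  have [l [orb pl rl dpl]] := puncture_orbit (p0 isT).
  rewrite [hook _ _]/= orb -[d :: w]cat1s -!catA [[:: d] ++ _]/= dualpath_catE dpl dp1 andbT /=.
  by have := rl; rewrite /rho /turn /c0 => /(congr1 (@nx T)); rewrite nx_nx nx_pv => ->; rewrite eqxx orbT.
have glue1 zs : size zs = size W ->
    (n1 ==> good_glue (mset W zs) (nth [::] (map (@upper_half T) (tiles W)) (size h0 + (size w).+1).-1)
              (nth [::] (map (@upper_half T) (tiles W)) (size W).-1) c1) =
    (n1 ==> (nth false zs (size h0 + size w) || ~~ last false zs)).
  move=> szs; apply: implyb_id2l => N1; have [l [orb pl rl dpl]] := puncture_orbit (p1 N1).
  by apply: (glue_end (l := l)) => //; rewrite /W /h1 N1 [hook _ _]/= orb.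
have glue0 zs : size zs = size W ->
    (n0 ==> good_glue (mset W zs) (nth [::] (map (@lower_half T) (tiles W)) 0)
              (nth [::] (map (@lower_half T) (tiles W)) (size h0)) (pv c0)) =
    (n0 ==> (head false zs || ~~ nth false zs (size h0))).
  move=> szs; apply: implyb_id2l => N0; have [l [orb pl rl dpl]] := puncture_orbit (p0 N0).
  have h0E : h0 = c0 :: l by rewrite /h0 N0 [hook _ _]/= orb.
  rewrite h0E; apply: (glue_start (v := w ++ h1) rl) => //; by rewrite /W h0E.
set good := (X in matching_sum x y X).
have goodE zs : size zs = size W -> good (mset W zs) =
   (n0 ==> (head false zs || ~~ nth false zs (size h0))) &&
   (n1 ==> (nth false zs (size h0 + size w) || ~~ last false zs)).
  by move=> szs; rewrite -glue0 // -glue1.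
clear glue0 glue1; rewrite /tautval -/c0 -/c1.
set be := endw X Y n1 c1 _ in right *.
have szh : size (w ++ h1) = (size w + size h1)%N by rewrite size_cat.
have K0 : (if n1 then X c1 else 1) != 0 by case: (n1); rewrite ?oner_eq0 ?X0.
have [N0|N0] := boolP n0; last first.
  have h0E : h0 = [::] by rewrite /h0 (negbTE N0).
  have WE : W = d :: (w ++ h1) by rewrite /W h0E.
  rewrite (matching_sum_walkE WE dpW goodE) (negbTE N0) !h0E /=.
  have E zd : walk d (w ++ h1) zd (fun zs => upper X (last d (w ++ h1)) (last zd zs) *
     (n1 ==> nth false (zd :: zs) (0 + size w) || ~~ last zd zs)%:R) = (if n1 then X c1 else 1) * walkl d w zd be.
    by rewrite -right.
  by rewrite !E /startw; field.
have [l [orb pl rl dpl]] := puncture_orbit (p0 N0).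
have h0E : h0 = c0 :: l by rewrite /h0 N0 [hook _ _]/= orb.
have WE : W = c0 :: (l ++ d :: w ++ h1) by rewrite /W h0E.
rewrite (matching_sum_walkE WE dpW goodE) N0 h0E.
set k := last c0 l in rl.
(* The first gluing condition couples only the first bit [z0] with the bit of the tile of [d]. For
   each value of the latter, the sums over the first hook and over the rest factor. *)
have E z0 : walk c0 (l ++ d :: w ++ h1) z0 (fun zs => upper X (last c0 (l ++ d :: w ++ h1)) (last z0 zs) *
     ((true ==> head false (z0 :: zs) || ~~ nth false (z0 :: zs) (size (c0 :: l))) &&
       (n1 ==> nth false (z0 :: zs) (size (c0 :: l) + size w) || ~~ last false (z0 :: zs)))%:R) =
   (if n1 then X c1 else 1) * (
   walkl c0 l z0 (fun zk => transfer k d zk false * (z0 || ~~ false)%:R) * walkl d w false be +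
   walkl c0 l z0 (fun zk => transfer k d zk true * (z0 || ~~ true)%:R) * walkl d w true be).
  rewrite walk_cat /walkl mulrDr !mulrA ![_ * walk c0 l z0 _]mulrC -!mulrA.
  rewrite ![walk c0 l z0 _ * _]mulrC -!walk_scale -walk_add; apply: eq_walk => zl szl /=.
  have G zd : walk d (w ++ h1) zd (fun zs => upper X (last c0 (l ++ d :: w ++ h1)) (last z0 (zl ++ zd :: zs)) *
     ((z0 || ~~ nth false (zl ++ zd :: zs) (size l)) &&
      (n1 ==> nth false (z0 :: zl ++ zd :: zs) (size (c0 :: l) + size w) || ~~ last z0 (zl ++ zd :: zs)))%:R) =
     (z0 || ~~ zd)%:R * ((if n1 then X c1 else 1) * walkl d w zd be).
    rewrite -right -walk_scale; apply: eq_walk => zs szs.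
    rewrite !last_cat /= -szl nth_cat ltnn subnn /=.
    have -> : nth false (zl ++ zd :: zs) (size zl + size w) = nth false (zd :: zs) (size w).
      by rewrite nth_cat ltnNge leq_addr /= addKn.
    rewrite -/(rg zd zs).
    rewrite ?last_cat; by case: (z0 || ~~ zd); case: (rg zd zs); rewrite ?mulr1 ?mul1r ?mulr0 ?mul0r.
  by rewrite !G -/k !walk_scale /walkl /=; ring.
rewrite !E /=.
have s0 := @start_hook c0 l false orb pl rl.
have s1 := @start_hook c0 l true orb pl rl.
have dE : nx c0 = d by rewrite /c0 nx_pv.
rewrite dE -/k in s0 s1.
have K A B : A = X (pv c0) * B -> B = A / X (pv c0) by move=> ->; field; rewrite X0.
have -> : startw X Y true c0 d false * tilew d false = (lower X c0 false * tilew c0 false *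
    walkl c0 l false (fun zk => transfer k d zk false * true%:R) +
    lower X c0 true * tilew c0 true * walkl c0 l true (fun zk => transfer k d zk false * true%:R)) / X (pv c0).
  exact: K s0.
have -> : startw X Y true c0 d true * tilew d true = (lower X c0 false * tilew c0 false *
    walkl c0 l false (fun zk => transfer k d zk true * false%:R) +
    lower X c0 true * tilew c0 true * walkl c0 l true (fun zk => transfer k d zk true * true%:R)) / X (pv c0).
  exact: K s1.
rewrite /lower /=; by field; rewrite X0 K0.
Qed.

End HookedValue.

(** * Free and cyclic reduction of words *)

Section Reduction.
Variable T : tsurface.
Local Notation side := (side T).
Implicit Types (c d e : side) (u v w l s : seq side).

Definition push d s := if s is e :: s' then if e == opp d then s' else d :: s else [:: d].
Definition irr s := sorted (fun d e => e != opp d) s.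

Lemma push_irr d s : irr s -> irr (push d s).
Proof.
case: s => [//|e s] /= irs; case: ifP => [_|ne]; first exact: path_sorted irs.
by rewrite /irr /= ne.
Qed.

Lemma reduce_irr w : irr (reduce w).
Proof. by elim: w => [//|d w IH]; apply: push_irr. Qed.

(** Adding a letter is invertible on irreducible words. Hence [reduce] depends only on the class
    modulo backtracking, without any confluence argument. *)
Lemma push_push d s : irr s -> push (opp d) (push d s) = s.
Proof.
case: s => [|e s] irs; first by rewrite /= oppK eqxx.
rewrite [push d _]/=; case: eqP => [E|_]; last by rewrite /= oppK eqxx.
subst e; case: s irs => [|f s] //= /andP[/negbTE].
by rewrite oppK => ->.
Qed.

Lemma reduce_cat u v : reduce (u ++ v) = foldr push (reduce v) u.
Proof. by rewrite /reduce foldr_cat. Qed.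

Lemma reduce_backtrack u p v : reduce (u ++ inv p ++ p ++ v) = reduce (u ++ v).
Proof.
rewrite reduce_cat [RHS]reduce_cat; congr foldr.
elim: p v => [//|d p IH] v; rewrite inv_cons -cats1 -catA.
rewrite reduce_cat; have -> : reduce ([:: opp d] ++ (d :: p) ++ v) = push (opp d) (push d (reduce (p ++ v))) by [].
rewrite push_push ?reduce_irr // -reduce_cat.
exact: IH.
Qed.

Lemma dualpath_irr w : dualpath w -> irr w.
Proof.
rewrite /irr /dualpath => /andP[_]; case: w => [//|d w] /=.
by apply: sub_path => a b; rewrite turnE => /andP[].
Qed.

Lemma reduce_id w : irr w -> reduce w = w.
Proof.
elim: w => [//|d [//|e w] IH] irw; move: (irw) => /andP[/negbTE ne irw'].
have -> : reduce [:: d, e & w] = push d (reduce (e :: w)) by [].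
by rewrite IH // /push ne.
Qed.

Definition strip w := if w is d :: w' then
  if opp (last d w') == d then behead (belast d w') else w else w.

Lemma cyc_reduceE w : cyc_reduce w = iter (size (reduce w)) strip (reduce w).
Proof. by []. Qed.

Lemma strip_conj d v : v != [::] -> strip (d :: rcons v (opp d)) = v.
Proof.
by rewrite /strip last_rcons oppK eqxx belast_rcons.
Qed.

Lemma strip_id d w : turn (last d w) d -> strip (d :: w) = d :: w.
Proof.
by rewrite turnE /strip eq_sym => /andP[_ /negbTE]; rewrite eq_sym => ->.
Qed.

Lemma cyc_reduce_conj p d w : dualpath (p ++ (d :: w) ++ inv p) -> turn (last d w) d ->
  cyc_reduce (p ++ (d :: w) ++ inv p) = d :: w.
Proof.
move=> dp td; rewrite cyc_reduceE reduce_id; last exact: dualpath_irr.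
(* Any number of strips that is at least the length of [p] will do, since a cyclically reduced word
   is fixed by [strip]. *)
have: (size p <= size (p ++ (d :: w) ++ inv p))%N by rewrite size_cat leq_addr.
move: (size (p ++ _)) => n {dp}.
elim: p n => [|e p IH] n.
  by rewrite cats0 /= => _; elim: n => [//|n IHn]; rewrite iterS IHn strip_id.
case: n => [//|n] len; rewrite iterSr inv_cons.
have -> : (e :: p) ++ (d :: w) ++ rcons (inv p) (opp e) = e :: rcons (p ++ (d :: w) ++ inv p) (opp e).
  by rewrite -!cats1 /= -!catA /= -!catA.
by rewrite strip_conj ?IH //; case: (p).
Qed.

End Reduction.

(** * Band graphs and traces *)

Section Loops.
Variable T : tsurface.
Local Notation side := (side T).
Implicit Types (c d e : side) (u v w l : seq side) (z : bool) (zs : seq bool).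
Variables (F : fieldType) (x y : 'I_(narc T) -> F).
Local Notation X := (xside x).
Local Notation Y := (yside y).
Hypothesis X0 : forall d, X d != 0.
Hypothesis Xopp : forall d, X (opp d) = X d.
Hypothesis Yopp : forall d, Y (opp d) = Y d.
Local Notation walk := (walk X Y).
Local Notation walkl := (walkl X Y).
Local Notation transfer := (transfer X Y).
Local Notation vert := (vert X).

(** The trace of the product of the transfer matrices around the closed curve. *)
Definition bandval d w : F :=
  walkl d w false (fun z => transfer (last d w) d z false) +
  walkl d w true (fun z => transfer (last d w) d z true).

Lemma walkl_lin d w z (g : bool -> F) :
  walkl d w z g = g false * walkl d w z (fun z => (~~ z)%:R) + g true * walkl d w z (fun z => z%:R).
Proof.
rewrite /walkl -!walk_scale -walk_add; apply: eq_walk => zs _.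
by case: (last z zs); rewrite /=; ring.
Qed.

Lemma trace_basis (A : mat F) (a b : vec F) :
  trm A * det2 a b = det2 (app A a) b + det2 a (app A b).
Proof. by rewrite /det2 /trm /app /lincomb /=; ring. Qed.

Lemma trace_bandval d w (l := last d w) : dualpath (d :: w) -> turn l d ->
  trm (wordm X Y (d :: w)) = tsign F l (d :: w) * bandval d w.
Proof.
move=> dp ld.
have li : interior l.
  by case/andP: dp => /allP/(_ l); rewrite mem_last => /(_ isT).
have dpl : dualpath [:: l, d & w] by rewrite dualpath_cons li ld.
have lw : last l (d :: w) = l by [].
(* [W0] and [W1] compute the two diagonal entries in the basis formed by the ends of [opp l]; the
   indicator functions are the coordinates of the basis vectors and of their duals. *)
have W0 := @walkl_pairing T F X Y X0 Xopp (vert (nx (opp l))) (scalev (- (X l)^-1) (vert (opp l)))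
   l (d :: w) (fun z => (~~ z)%:R) (fun z => (~~ z)%:R) dpl.
have W1 := @walkl_pairing T F X Y X0 Xopp (scalev (-1) (vert (opp l))) (scalev (- (X l)^-1) (vert (nx (opp l))))
   l (d :: w) (fun z => z%:R) (fun z => z%:R) dpl.
have dv := det_vert X0 (opp l); rewrite Xopp in dv.
have {W0} := W0 _ _ _; have {W1} := W1 _ _ _.
rewrite lw => W1 W0.
have {}W1 : pairing X Y (scalev (-1) (vert (opp l))) (d :: w) (scalev (- (X l)^-1) (vert (nx (opp l)))) = tsign F l (d :: w) * walkl l (d :: w) true (fun z => z%:R).
  rewrite W1 /=; first by ring.
  - have -> : det2 (scalev (-1) (vert (opp l))) (vert (opp l)) = 0 by pring.
    by ring.
  - have -> : det2 (scalev (-1) (vert (opp l))) (vert (nx (opp l))) = - det2 (vert (opp l)) (vert (nx (opp l))) by pring.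
    by rewrite dv; ring.
  move=> u; have -> : det2 u (scalev (- (X l)^-1) (vert (nx (opp l)))) = - (X l)^-1 * det2 u (vert (nx (opp l))) by pring.
  by field; exact: X0.
have {}W0 : pairing X Y (vert (nx (opp l))) (d :: w) (scalev (- (X l)^-1) (vert (opp l))) = tsign F l (d :: w) * walkl l (d :: w) false (fun z => (~~ z)%:R).
  rewrite W0 /=; first by ring.
  - by rewrite det2C dv; ring.
  - by rewrite det2xx; ring.
  move=> u; have -> : det2 u (scalev (- (X l)^-1) (vert (opp l))) = - (X l)^-1 * det2 u (vert (opp l)) by pring.
  by field; exact: X0.
have tb := trace_basis (wordm X Y (d :: w)) (vert (opp l)) (vert (nx (opp l))).
rewrite dv in tb; apply: (mulIf (X0 l)); rewrite tb.
have -> : det2 (app (wordm X Y (d :: w)) (vert (opp l))) (vert (nx (opp l))) =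
   X l * (tsign F l (d :: w) * walkl l (d :: w) false (fun z => (~~ z)%:R)).
  rewrite -W0 /pairing; set A := wordm _ _ _.
  have -> : det2 (vert (nx (opp l))) (app A (scalev (- (X l)^-1) (vert (opp l)))) =
     (X l)^-1 * det2 (app A (vert (opp l))) (vert (nx (opp l))) by pring.
  by field; exact: X0.
have -> : det2 (vert (opp l)) (app (wordm X Y (d :: w)) (vert (nx (opp l)))) =
   X l * (tsign F l (d :: w) * walkl l (d :: w) true (fun z => z%:R)).
  rewrite -W1 /pairing; set A := wordm _ _ _.
  have -> : det2 (scalev (-1) (vert (opp l))) (app A (scalev (- (X l)^-1) (vert (nx (opp l))))) =
     (X l)^-1 * det2 (vert (opp l)) (app A (vert (nx (opp l)))) by pring.
  by field; exact: X0.
rewrite !walkl_cons /bandval -/l (walkl_lin d w false (fun z => transfer l d z false))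
  (walkl_lin d w true (fun z => transfer l d z true)).
ring.
Qed.

Lemma transfer_link e d z z0 : transfer e d z z0 =
  lower X d z0 * tilew X Y d z0 * (upper X e z * (link e d z z0)%:R) / X (shared e d).
Proof. by rewrite /transfer; case: ifP => _; rewrite ?mulr1 ?mulr0 ?mul0r //; field; exact: X0. Qed.

Lemma xband_bandval d w : dualpath (d :: w) -> turn (last d w) d ->
  xband x y (d :: w) = bandval d w.
Proof.
move=> dp ld; rewrite /xband.
set a := opp (last d w); set c := (if d == pv a then nx a else pv a).
have cE : c = shared (last d w) d.
  by case/turnP: ld => E; rewrite /c /shared -/a E ?nx_pv_neq ?pv_nx_neq ?eqxx.
rewrite (@matching_sum_walkE _ _ _ _ X0 (d :: w) d w _
  (fun zs => link (last d w) d (last false zs) (head false zs)) erefl dp); last first.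
  move=> zs szs; rewrite /good_glue.
  have -> : head [::] (map (@lower_half T) (tiles (d :: w))) = nth [::] (map (@lower_half T) (tiles (d :: w))) 0 by rewrite nth0.
  have -> : last [::] (map (@upper_half T) (tiles (d :: w))) =
     nth [::] (map (@upper_half T) (tiles (d :: w))) (size w).
    by rewrite -nth_last size_map -(size_map snd (tiles _)) /tiles tiles_sides.
  have nl : nth d (d :: w) (size w) = last d w by apply: (nth_last d (d :: w)).
  rewrite (@has_edge_lower_nth _ d) // ?(@has_edge_upper_nth _ d) // ?nl -/a ?ltnn //.
  - have -> : nth false zs (size w) = last false zs by rewrite -nth_last szs.
    rewrite nth0 cE /shared /link -/a /=.
    case/turnP: (ld) => E; rewrite -/a in E; rewrite E.
      by rewrite eqxx nx_nx eqxx pv_nx_neq /= orbC; case: (last false zs).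
    by rewrite pv_nx_neq nx_pv nx_neq eqxx /= orbC; case: (last false zs).
  - by rewrite /c; case: ifP; rewrite !inE eqxx ?orbT.
  - rewrite /= /c; case/turnP: ld => E; rewrite -/a in E; rewrite E ?nx_pv_neq ?eqxx !inE ?nx_nx ?pv_nx ?pv_pv eqxx ?orbT //.
have key z0 : walk d w z0 (fun zs => transfer (last d w) d (last z0 zs) z0) =
   lower X d z0 * tilew X Y d z0 / X c * walk d w z0 (fun zs => upper X (last d w) (last z0 zs) *
       (link (last d w) d (last z0 zs) z0)%:R).
  by rewrite -walk_scale cE; apply: eq_walk => zs _; rewrite transfer_link; ring.
by rewrite /bandval /walkl !key /=; field; exact: X0.
Qed.

(** All turns are of one kind, so the matrix is triangular with diagonal entries 1 and the product
    of the [Y]. The value that [xloop] assigns to a curve around a puncture is thus again a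
    trace. *)
Lemma bandval_puncture d w : puncture d -> orbit (@rho T) d = d :: w ->
  bandval d w = 1 + yword Y (d :: w).
Proof.
move=> pd orb; have [l [orb' pl rl dpl]] := puncture_orbit pd.
move: orb'; rewrite orb => -[E]; rewrite -{l}E in pl rl dpl *.
rewrite /bandval; have [-> _] := fan_walk Y X0 Xopp (fun z => transfer (last d w) d z false) pl.
have [_ ->] := fan_walk Y X0 Xopp (fun z => transfer (last d w) d z true) pl.
have [-> -> _ ->] := transfer_nx Y X0 Xopp (esym rl).
by rewrite yword_cons; field; rewrite !X0.
Qed.

End Loops.

(** * Unwinding the ends of a path and its price *)

Section Unfan.
Variable T : tsurface.
Local Notation side := (side T).
Implicit Types (c d e : side) (u v w l : seq side) (n : bool).

Lemma psign_rho d w c' : pathok d (d :: w) c' -> ~~ ((w == [::]) && (c' == rho d)) ->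
  psign (d, false) (d :: w) (c', false) = ~~ psign (rho d, false) w (c', false).
Proof.
move=> ok ne; rewrite /= /tau /= neq_nx /=; have [_ _ _] := pathok_cons ok.
case: w ok ne => [|e w] ok ne /=.
  move=> E; rewrite -/(tau (opp d, true) (c', false)) tau_rho ?place_eqE ?andbF //.
    by rewrite /same_tri /= E.
  by rewrite andbT.
case; rewrite turnE => /andP[/eqP e1 ne1] _.
rewrite -/(tau (opp d, true) (e, true)) -/(tau (rho d, false) (e, true)) -addNb; congr (_ (+) _).
by apply: tau_rho; rewrite ?place_eqE ?andbF ?andbT // /same_tri /= e1.
Qed.

Lemma psign_corner d w c' : pathok (nx d) (d :: w) c' -> ~~ ((w == [::]) && (c' == opp d)) ->
  psign (nx d, false) (d :: w) (c', false) = psign (opp d, false) w (c', false).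
Proof.
move=> ok ne; rewrite /= /tau /= nx_nx neq_pv /=; have [_ _ _] := pathok_cons ok.
case: w ok ne => [|e w] ok ne /=.
  move=> E; rewrite -/(tau (opp d, true) (c', false)) tau_corner ?place_eqE ?andbF ?andbT //.
  by rewrite /same_tri /= E.
case; rewrite turnE => /andP[/eqP e1 ne1] _.
rewrite -/(tau (opp d, true) (e, true)) -/(tau (opp d, false) (e, true)); congr (_ (+) _).
Qed.

Lemma puncture_rho c : puncture (rho c) = puncture c.
Proof. by have [l E1 E2] := orbit_rho c; rewrite /puncture E1 E2 all_rcons. Qed.

Lemma notchable_rho c : notchable (rho c) = notchable c.
Proof. by rewrite /notchable puncture_rho (inj_eq (@rho_inj T)). Qed.

Definition tagok n0 n1 c c' :=
  [/\ n0 -> notchable c, n1 -> notchable c' & c' \in orbit (@rho T) c -> n0 = n1].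

Lemma tagok_rho n0 n1 c c' : tagok n0 n1 (rho c) c' <-> tagok n0 n1 c c'.
Proof.
rewrite /tagok notchable_rho -!fconnect_orbit.
by rewrite -(same_fconnect1 (@rho_inj T)).
Qed.

Lemma tagok_sym n0 n1 c c' : tagok n0 n1 c c' -> tagok n1 n0 c' c.
Proof.
case=> h0 h1 h2; split=> //; rewrite -fconnect_orbit fconnect_sym; last exact: rho_inj.
by rewrite fconnect_orbit => /h2.
Qed.

(* An end at the corner c is free when unwinding it costs no y-variable.       *)
Definition free_end n c d := (d == nx c) || (d == if n then pv c else c).
Definition free_path n0 n1 c w c' :=
  if w is d :: w' then free_end n0 c d && free_end n1 c' (opp (last d w'))
  else ~~ [|| [&& n0, ~~ n1 & c' == nx c] | [&& ~~ n0, n1 & c == nx c']].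

Lemma free_inv n0 n1 c w c' : free_path n0 n1 c w c' -> free_path n1 n0 c' (inv w) c.
Proof.
case: w => [|d w]; first by rewrite /= orbC; case: n0; case: n1.
have E : inv (d :: w) = opp (last d w) :: inv (belast d w) by rewrite lastI inv_rcons.
have := rev_last_inv d w d; rewrite E /= => ->.
by rewrite oppK andbC.
Qed.

(** Without backtracking the unwinding never changes direction: the next side either continues the
    fan or is opposite to the new corner. Freeness of the first crossing thus decides about all of
    them. *)
Lemma free_rho n0 n1 d w c' : pathok d (d :: w) c' ->
  free_path n0 n1 d (d :: w) c' -> ~~ n0 /\ free_path n0 n1 (rho d) w c'.
Proof.
move=> ok /= /andP[f0 f1].
have N0 : n0 = false.
  by move: f0; rewrite /free_end neq_nx /=; case: (n0); rewrite ?neq_pv.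
rewrite N0 /rho; split=> //; have [_ _ _] := pathok_cons ok; case: w ok f1 => [|e w] ok f1 /=.
  move=> _; apply/negP => /andP[N1 /eqP/nx_inj E].
  by move: f1; rewrite /free_end N1 E neq_nx neq_pv.
by case=> /turnP[] E _; rewrite f1 andbT /free_end E; [rewrite eqxx orbT | rewrite -/(pv (opp d)) eqxx].
Qed.

Lemma free_corner n0 n1 d w c' : pathok (nx d) (d :: w) c' ->
  free_path n0 n1 (nx d) (d :: w) c' -> n0 /\ free_path n0 n1 (opp d) w c'.
Proof.
move=> ok /= /andP[f0 f1].
have N0 : n0 = true.
  by move: f0; rewrite /free_end nx_nx neq_pv /=; case: (n0); rewrite ?neq_nx.
rewrite N0; split=> //; have [_ _ _] := pathok_cons ok; case: w ok f1 => [|e w] ok f1 /=.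
  move=> _; rewrite orbF; apply/negP => /andP[/negbTE N1 /eqP E].
  by move: f1; rewrite /free_end N1 E nx_nx neq_pv neq_nx.
by case=> /turnP[] E _; rewrite f1 andbT /free_end E eqxx ?orbT.
Qed.

Variables (F : fieldType) (x y : 'I_(narc T) -> F).
Local Notation X := (xside x).
Local Notation Y := (yside y).
Hypothesis X0 : forall d, X d != 0.
Hypothesis Xopp : forall d, X (opp d) = X d.
Hypothesis Yopp : forall d, Y (opp d) = Y d.

(** The sign is chosen so that taut paths get their Laurent expansion with coefficient 1, and so
    that unwinding changes the value only by a monomial in y. *)
Definition spair n0 n1 c w c' : F :=
  - (-1) ^+ (psign (c, false) w (c', false)) * pairing X Y (pvec X Y n0 c) w (pvec X Y n1 c').

Definition mono (k : F) := exists2 l, all (@interior T) l & k = yword Y l.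

Lemma mono1 : mono 1.
Proof. by exists [::] => //; rewrite /yword big_nil. Qed.
Lemma monoM k k' : mono k -> mono k' -> mono (k * k').
Proof.
by move=> [l i ->] [l' i' ->]; exists (l ++ l'); rewrite ?all_cat ?i // yword_cat.
Qed.
Lemma mono_side d : interior d -> mono (Y d).
Proof. by move=> di; exists [:: d]; rewrite /= ?di // yword_cons /yword big_nil mulr1. Qed.

Lemma pairing_same n0 n1 c c' : tagok n0 n1 c c' -> c' = c ->
  pairing X Y (pvec X Y n0 c) [::] (pvec X Y n1 c') = 0.
Proof.
case=> _ _ H E; move: H; rewrite E -fconnect_orbit connect0 => /(_ isT)->.
by rewrite /pairing app1m det2xx.
Qed.

Lemma spair_rho n0 n1 d w c' : pathok d (d :: w) c' -> tagok n0 n1 d c' ->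
  spair n0 n1 d (d :: w) c' = (if n0 then Y d else 1) * spair n0 n1 (rho d) w c'.
Proof.
move=> ok tg; rewrite /spair.
have -> : pairing X Y (pvec X Y n0 d) (d :: w) (pvec X Y n1 c') =
  - (if n0 then Y d else 1) * pairing X Y (pvec X Y n0 (rho d)) w (pvec X Y n1 c').
  by case: (n0); rewrite /pvec ?pairing_hat_rho ?pairing_vert_rho // mulN1r.
(* In the exceptional case of [psign_rho] the path shrinks to a point. Both values vanish there,
   because coinciding ends carry equal tags, and the sign is immaterial. *)
case C: ((w == [::]) && (c' == rho d)).
  move/andP: C => [/eqP-> /eqP E].
  by rewrite (@pairing_same n0 n1 (rho d)) ?mulr0 //; apply/tagok_rho.
rewrite psign_rho ?C // signrN; ring.
Qed.

Lemma spair_corner n0 n1 d w c' : pathok (nx d) (d :: w) c' -> tagok n0 n1 (nx d) c' ->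
  spair n0 n1 (nx d) (d :: w) c' = (if n0 then 1 else Y d) * spair n0 n1 (opp d) w c'.
Proof.
move=> ok tg; rewrite /spair.
have -> : pairing X Y (pvec X Y n0 (nx d)) (d :: w) (pvec X Y n1 c') =
  (if n0 then 1 else Y d) * pairing X Y (pvec X Y n0 (opp d)) w (pvec X Y n1 c').
  by case: (n0); rewrite /pvec ?pairing_hat_nx ?pairing_vert_nx // mul1r.
case C: ((w == [::]) && (c' == opp d)).
  move/andP: C => [/eqP-> /eqP E].
  rewrite (@pairing_same n0 n1 (opp d)) ?mulr0 //.
  by apply/tagok_rho; rewrite rho_opp.
rewrite psign_corner ?C //; ring.
Qed.

(** The clause that [r.2] is a suffix of [w] is for later use: it shows that unwinding the second
    end does not spoil the first. *)
Lemma unfanP n0 n1 w c c' (r := unfan c w) : pathok c w c' -> tagok n0 n1 c c' ->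
  exists2 k, mono k &
  [/\ free_path n0 n1 c w c' -> k = 1 /\ free_path n0 n1 r.1 r.2 c',
      pathok r.1 r.2 c' /\ tagok n0 n1 r.1 c',
      if r.2 is d :: _ then r.1 = pv d else True,
      exists p, w = p ++ r.2 &
      spair n0 n1 c w c' = k * spair n0 n1 r.1 r.2 c'].
Proof.
rewrite {}/r; elim: w c => [|d w IH] c ok tg.
  by exists 1; [exact: mono1 | split=> //; [exists [::] | rewrite mul1r]].
have [di cd _ _] := pathok_cons ok; rewrite [unfan _ _]/=.
case: (eqVneq d c) => [E|nc].
  subst c; have ok' : pathok (rho d) w c' by apply: (pathok_step ok).
  have tg' : tagok n0 n1 (rho d) c' by apply/tagok_rho.
  have [k mk [fr oks ed [p wE] sE]] := IH _ ok' tg'.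
  exists ((if n0 then Y d else 1) * k).
    by apply: monoM => //; case: (n0); [exact: mono_side | exact: mono1].
  split=> //.
  - by move=> /(free_rho ok)[/negbTE N0 /fr[-> fr']]; split=> //; rewrite N0 mul1r.
  - by exists (d :: p); rewrite {1}wE.
  - by rewrite spair_rho // sE mulrA.
case: (eqVneq d (pv c)) => [E|npc].
  have cE : c = nx d by rewrite E nx_pv.
  subst c; have ok' : pathok (opp d) w c' by apply: (pathok_step ok).
  have tg' : tagok n0 n1 (opp d) c' by apply/tagok_rho; rewrite rho_opp.
  have [k mk [fr oks ed [p wE] sE]] := IH _ ok' tg'.
  exists ((if n0 then 1 else Y d) * k).
    by apply: monoM => //; case: (n0); [exact: mono1 | exact: mono_side].
  split=> //.
  - by move=> /(free_corner ok)[N0 /fr[-> fr']]; split=> //; rewrite N0 mul1r.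
  - by exists (d :: p); rewrite {1}wE.
  - by rewrite spair_corner // sE mulrA.
exists 1; first exact: mono1.
split=> //; [|by exists [::]|by rewrite mul1r].
case/triangle_cases: cd nc npc => -> /=; rewrite ?eqxx //.
by rewrite pv_nx eqxx.
Qed.

(** The sign from adjugates in [pairing_inv] and the sign from reversed strands in [psign_inv] are
    equal, so they cancel. *)
Lemma spair_inv n0 n1 c w c' : pathok c w c' -> tagok n0 n1 c c' ->
  spair n1 n0 c' (inv w) c = spair n0 n1 c w c'.
Proof.
move=> ok tg; rewrite /spair pairing_inv //.
case C: ((w == [::]) && (c' == c)).
  by move/andP: C => [/eqP-> /eqP E]; rewrite (pairing_same tg E) !mulr0.
rewrite psign_inv; last first.
  by apply: pathok_traverses => // w0; move: C; rewrite w0 /= eq_sym => ->.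
rewrite signr_addb signr_odd exprS.
have : (-1) ^+ size w * (-1) ^+ size w = 1 :> F by rewrite -expr2 sqrr_sign.
set a := (-1) ^+ size w; set b := (-1) ^+ _; set p := pairing _ _ _ _ _ => H.
by transitivity (a * a * (- b * p)); [ring | rewrite H mul1r].
Qed.

End Unfan.

(** * Signed pairings are cluster expansions up to a monomial in y *)

Section ArcValues.
Variable T : tsurface.
Local Notation side := (side T).
Implicit Types (c d e : side) (u v w l : seq side) (n : bool).
Variables (F : fieldType) (x y : 'I_(narc T) -> F).
Local Notation X := (xside x).
Local Notation Y := (yside y).
Hypothesis X0 : forall d, X d != 0.
Hypothesis Xopp : forall d, X (opp d) = X d.
Hypothesis Yopp : forall d, Y (opp d) = Y d.
Local Notation fanlen := (fanlen X Y).
Local Notation spair := (spair x y).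
Local Notation pvec := (pvec X Y).
Local Notation pairing := (pairing X Y).

Lemma notchable_puncture c : notchable c -> puncture c.
Proof. by case/andP. Qed.

(** The loop crosses the sides of one fan only, so [fan_walk] sums its matchings. *)
Lemma xaround_fanlen (a : side) : notchable a ->
  xaround x y a / X a = X a * fanlen (orbit (@rho T) (rho a)).
Proof.
case/andP=> pa ra; have [l [orb pl rl dpl]] := puncture_orbit pa.
have orb' : orbit (@rho T) (rho a) = rcons l a.
  by have [l'] := orbit_rho a; rewrite orb => -[<-].
rewrite /xaround orb [behead _]/=.
(* An empty [l] would mean a puncture with a single incident side, which [notchable] excludes. *)
case: l orb pl rl dpl orb' => [|e l] orb pl rl dpl orb'.
  by rewrite /= in rl; rewrite rl eqxx in ra.
have dpl' : dualpath (e :: l) := dualpath_cons1 dpl.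
rewrite xplain_tautval // /tautval /startw /endw orb'.
have /andP[/eqP ea pl'] := pl.
have [-> _] := fan_walk Y X0 Xopp (upper X (last e l)) pl'.
have [_ ->] := fan_walk Y X0 Xopp (upper X (last e l)) pl'.
have ok : opp (last e l) = pv a by rewrite -rl /rho pv_nx.
have pe : pv e = opp a by rewrite -ea /rho pv_nx.
have Xk : X (last e l) = X (pv a) by rewrite -Xopp ok.
rewrite fanlen_rcons yword_cons.
have -> : fanlen (e :: l) = hlen X e + Y e * fanlen l by [].
rewrite /upper /lower /tilew ok pe nx_pv pv_pv Xk /hlen pe Xopp.
by field; rewrite !X0.
Qed.

Lemma det_hat_pv (u : vec F) c : det2 u (hat X Y c) =
  fanlen (orbit (@rho T) c) * det2 u (vert X c)
  + (1 - yword Y (orbit (@rho T) c)) / X (pv c) * det2 u (vert X (pv c)).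
Proof. by rewrite /hat; pring. Qed.

Lemma yaroundE c : yaround y c = yword Y (orbit (@rho T) c).
Proof. by []. Qed.

(** Up to the factor [Y a] in one case, the four formulas for an arc of the triangulation are the
    determinants of [vert] or [hat] at one end with [vert] or [hat] at the other. The doubly notched
    formula is the expansion of the determinant of two [hat] vectors. *)
Lemma nil_pairing n0 n1 (a : side) : (n0 -> notchable a) -> (n1 -> notchable (opp a)) ->
  pairing (pvec n0 a) [::] (pvec n1 (nx a)) =
  (if n0 && ~~ n1 then Y a else 1) * xarc_of_T x y a n0 n1.
Proof.
move=> h0 h1; rewrite /pairing /= app1m /xarc_of_T.
have e1 : det2 (vert X (nx a)) (vert X a) = - X a by rewrite det2C det_vert.
have q := @xaround_fanlen (opp a); rewrite rho_opp Xopp in q.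
case: n0 h0; case: n1 h1 => h1 h0; rewrite /pvec /=.
- rewrite (xaround_fanlen (h0 isT)) (q (h1 isT)) !yaroundE.
  rewrite -(yword_orbit Y (opp a)) rho_opp mul1r.
  rewrite det2C det_hat // [det2 _ (vert X a)]det2C [det2 (hat X Y (nx a)) (vert X (nx a))]det2C.
  rewrite !det_hat_pv pv_nx !det2xx e1 det_vert //.
  by field; exact: X0.
- rewrite (xaround_fanlen (h0 isT)) det2C det_hat // det2xx [det2 (vert X (nx a)) _]det2C det_vert //.
  ring.
- rewrite (q (h1 isT)) det_hat_pv pv_nx det2xx det_vert //; ring.
by rewrite det_vert // mul1r.
Qed.

Lemma xarc_of_T_opp n0 n1 (a : side) : xarc_of_T x y (opp a) n0 n1 = xarc_of_T x y a n1 n0.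
Proof.
rewrite /xarc_of_T oppK !Xopp; case: n0; case: n1 => //.
by rewrite Yopp; ring.
Qed.

Lemma spair_nil n0 n1 c c'  : pathok c [::] c' -> tagok n0 n1 c c' ->
  exists2 k, mono y k & (free_path n0 n1 c [::] c' -> k = 1) /\
    spair n0 n1 c [::] c' = k * (if c == c' then 0 else
       if c' == nx c then xarc_of_T x y c n0 n1 else xarc_of_T x y (opp c') n0 n1).
Proof.
move=> /andP[_ /eqP cc] tg;
case: eqVneq => [E|ne].
  exists 1; [exact: mono1 | split=> //].
  by rewrite /spair (pairing_same x y tg) ?mulr0.
have [h0 h1 h2] := tg.
have sw a n : (n -> notchable (nx a)) -> n -> notchable (opp a).
  by move=> h /h; rewrite -rho_opp notchable_rho.
case: (eqVneq c' (nx c)) => [E|nE].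
  subst c'; exists (if n0 && ~~ n1 then Y c else 1).
    case N: (n0 && ~~ n1); last exact: mono1.
    apply: mono_side; move: N => /andP[/h0/notchable_puncture/puncture_interior //].
  split; first by rewrite /= eqxx andbT; case: (n0); case: (n1).
  rewrite /spair /= /tau /= eqxx nil_pairing //; last exact: sw.
  by rewrite expr1 opprK mul1r.
have cE : c = nx c'.
  case/triangle_cases: cc => E //; first by rewrite E eqxx in ne.
  by rewrite E nx_pv eqxx in nE.
subst c; exists (if n1 && ~~ n0 then Y c' else 1).
  case N: (n1 && ~~ n0); last exact: mono1.
  apply: mono_side; move: N => /andP[/h1/notchable_puncture/puncture_interior //].
split; first by rewrite /= eqxx !andbT; case: (n0); case: (n1); rewrite ?orbT.
rewrite xarc_of_T_opp -nil_pairing //; last exact: sw.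
rewrite /spair /= /tau /= nx_nx neq_pv expr0 /pairing /= !app1m det2C; ring.
Qed.

Lemma psign_taut d w : dualpath (d :: w) ->
  (-1) ^+ psign (pv d, false) (d :: w) (pv (opp (last d w)), false) = - tsign F d w.
Proof.
rewrite /= {1}/tau /= nx_pv eqxx /= => dp; rewrite signrN; congr (- _).
elim: w d dp => [|e w IH] d dp /=; first by rewrite /tau /= eqxx.
have := dp; rewrite dualpath_cons => /and3P[di de dp'].
by rewrite signr_addb IH.
Qed.

Lemma spair_taut n0 n1 d w : dualpath (d :: w) ->
  (n0 -> puncture (pv d)) -> (n1 -> puncture (pv (opp (last d w)))) ->
  spair n0 n1 (pv d) (d :: w) (pv (opp (last d w))) =
  xhooked x y (IPath (pv d) (d :: w) (pv (opp (last d w)))) n0 n1.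
Proof.
move=> dp p0 p1; rewrite xhooked_tautval // /spair psign_taut // taut_pairing //.
rewrite opprK mulrA; set s := tsign _ _ _.
have -> : s * s = 1.
  rewrite /s; elim: (w) (d) => [|e u IH] d' /=; first by rewrite mulr1.
  have := IH e; set t := tsign _ _ _ => tt.
  by transitivity (((-1) ^+ (e == nx (opp d')) * (-1) ^+ (e == nx (opp d'))) * (t * t)); [ring | rewrite tt -expr2 sqrr_sign mulr1].
by rewrite mul1r.
Qed.

(** The second end is treated as the first end of the inverse path, as [tighten] does. *)
Lemma spair_xarc n0 n1 c w c' : pathok c w c' -> tagok n0 n1 c c' ->
  exists2 k, mono y k & (free_path n0 n1 c w c' -> k = 1) /\
    spair n0 n1 c w c' = k * xarc x y (IPath c w c') (n0, n1).
Proof.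
move=> ok tg; have [dw _] := andP ok.
rewrite /xarc /tighten [word _]/= [org _]/= [dst _]/= reduce_id ?dualpath_irr //.
have [k1 m1 [f1 [ok1 tg1] ed1 _ ->]] := unfanP X0 Xopp Yopp ok tg.
move: (unfan c w) f1 ok1 tg1 ed1 => -[c1 w1] /= f1 ok1 tg1 ed1.
rewrite -(spair_inv Xopp Yopp ok1 tg1).
have ok1' := pathok_inv ok1; have tg1' := tagok_sym tg1.
have [k2 m2 [f2 [ok2 tg2] ed2 [p wE] ->]] := unfanP X0 Xopp Yopp ok1' tg1'.
move: (unfan c' (inv w1)) f2 ok2 tg2 ed2 wE => -[c2 w2] /= f2 ok2 tg2 ed2 wE.
rewrite -(spair_inv Xopp Yopp ok2 tg2).
have ok3 := pathok_inv ok2; have tg3 := tagok_sym tg2.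
have F12 : free_path n0 n1 c w c' -> [/\ k1 = 1, k2 = 1 & free_path n0 n1 c1 (inv w2) c2].
  by move=> /f1[-> /free_inv/f2[-> /free_inv]].
case E : (inv w2) ok3 F12 => [|d w3] ok3 F12.
  have [k3 m3 [f3 ->]] := spair_nil ok3 tg3.
  exists (k1 * k2 * k3); first by do 2?apply: monoM.
  split; last by rewrite !mulrA.
  by case/F12 => -> -> /f3->; rewrite !mulr1.
(* Unwinding the second end removed only a tail of [w1]. The first side is still [d], so the first
   end has stayed taut. *)
have w1E : w1 = d :: w3 ++ inv p by rewrite -[w1]invK wE inv_cat E.
rewrite w1E in ed1.
have w2E : w2 = opp (last d w3) :: inv (belast d w3) by rewrite -[w2]invK E lastI inv_rcons.
rewrite w2E in ed2.
have [dp3 _] := andP ok3.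
case: tg3 => t0 t1 _; subst c1 c2.
rewrite spair_taut //; last 2 first.
- by move/t0/notchable_puncture.
- by move/t1/notchable_puncture.
exists (k1 * k2); first exact: monoM.
by split; [case/F12=> -> -> _; rewrite mulr1 | rewrite mulrA].
Qed.

End ArcValues.

(** * Signs of path segments cut inside a triangle *)

Section Segments.
Variable T : tsurface.
Local Notation side := (side T).
Local Notation place := (place T).
Implicit Types (c d e : side) (u v w l : seq side) (p q r s t b : place).

(** A crossing cuts paths inside a triangle. [asgn] counts the triangles completed before the cut,
    [endplace] is where the cut triangle was entered, and [exitp], [bsgn] and [btr] describe the
    part behind it. *)
Fixpoint asgn p w : bool :=
  if w is d :: w' then tau p (d, true) (+) asgn (opp d, true) w' else false.
Fixpoint endplace p w : place := if w is d :: w' then endplace (opp d, true) w' else p.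
Fixpoint atr p w : bool :=
  if w is d :: w' then traverse p (d, true) && atr (opp d, true) w' else true.
Definition exitp w q : place := if w is d :: _ then (d, true) else q.
Definition bsgn w q : bool := if w is d :: w' then psign (opp d, true) w' q else false.
Definition btr w q : bool := if w is d :: w' then traverses (opp d, true) w' q else true.

Lemma psign_cat2 p u v q : psign p (u ++ v) q = asgn p u (+) psign (endplace p u) v q.
Proof. by elim: u p => [//|d u IH] p /=; rewrite IH addbA. Qed.
Lemma traverses_cat2 p u v q : traverses p (u ++ v) q = atr p u && traverses (endplace p u) v q.
Proof. by elim: u p => [//|d u IH] p /=; rewrite IH andbA. Qed.
Lemma psignE p v q : psign p v q = tau p (exitp v q) (+) bsgn v q.
Proof. by case: v => [|d v] //=; rewrite addbF. Qed.
Lemma traversesE p v q : traverses p v q = traverse p (exitp v q) && btr v q.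
Proof. by case: v => [|d v] //=; rewrite andbT. Qed.
Lemma asgn_cat p u v : asgn p (u ++ v) = asgn p u (+) asgn (endplace p u) v.
Proof. by elim: u p => [//|d u IH] p /=; rewrite IH addbA. Qed.
Lemma atr_cat p u v : atr p (u ++ v) = atr p u && atr (endplace p u) v.
Proof. by elim: u p => [//|d u IH] p /=; rewrite IH andbA. Qed.
Lemma endplace_cat p u v : endplace p (u ++ v) = endplace (endplace p u) v.
Proof. by elim: u p => [//|d u IH] p /=. Qed.
Lemma endplace_cons p d u : endplace p (d :: u) = (opp (last d u), true).
Proof. by elim: u d p => [//|e u IH] d p; exact: IH. Qed.
Lemma asgn_rcons p u d : asgn p (rcons u d) = psign p u (d, true).
Proof. by elim: u p => [|e u IH] p /=; rewrite ?addbF // IH. Qed.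
Lemma atr_rcons p u d : atr p (rcons u d) = traverses p u (d, true).
Proof. by elim: u p => [|e u IH] p /=; rewrite ?andbT // IH. Qed.

Lemma traverse_sym p q : traverse p q = traverse q p.
Proof. by rewrite /traverse /same_tri eq_sym [q == p]eq_sym. Qed.

Lemma traverses_inv p w q : traverses q (inv w) p = traverses p w q.
Proof.
elim: w p => [|d w IH] p /=; first exact: traverse_sym.
by rewrite inv_cons -cats1 traverses_cat IH /= oppK andbC traverse_sym.
Qed.

Lemma asgn_inv w p : btr w p -> asgn p (inv w) = bsgn w p (+) odd (size w).
Proof.
case: w => [//|d w] /= tr; by rewrite inv_cons asgn_rcons psign_inv.
Qed.

Lemma atr_inv w p : atr p (inv w) = btr w p.
Proof. by case: w => [//|d w] /=; rewrite inv_cons atr_rcons traverses_inv. Qed.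

Lemma endplace_inv w p : endplace p (inv w) = exitp w p.
Proof.
case: w => [//|d w]; rewrite /= inv_cons -cats1 endplace_cat /= oppK //.
Qed.

Lemma inner_inv d w s : atr (opp d, true) w ->
  atr s (inv (d :: w)) = traverse s (opp (last d w), true) /\
  asgn s (inv (d :: w)) = tau s (opp (last d w), true) (+) asgn (opp d, true) w (+) odd (size w).
Proof.
case: (lastP w) => [|u l] /=; first by rewrite !addbF andbT.
rewrite last_rcons atr_rcons asgn_rcons inv_cons inv_rcons rcons_cons /= oppK.
rewrite atr_rcons asgn_rcons traverses_inv => tr; rewrite tr andbT; split=> //.
by rewrite psign_inv // size_rcons addbA.
Qed.

Lemma traverse_turn d e : traverse (opp d, true) (e, true) = turn d e.
Proof. by rewrite /traverse /same_tri turnE place_eqE andbT eq_sym [opp d == e]eq_sym. Qed.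

Lemma atr_path d w : atr (opp d, true) w = path (@turn T) d w.
Proof. by elim: w d => [//|e w IH] d; rewrite /= traverse_turn IH. Qed.

Lemma pathok_traversesE c w c' : w != [::] ->
  pathok c w c' = all (@interior T) w && traverses (c, false) w (c', false).
Proof.
case/lastP: w => [//|w l] _; rewrite /pathok /dualpath -andbA; congr (_ && _).
rewrite -cats1 traverses_cat2 /=.
case: w => [|d w] /=.
  rewrite /traverse /same_tri !place_eqE !andbF !andbT /=.
  by rewrite [c'.1 == _]eq_sym.
rewrite -[endplace _ w]/(endplace (opp d, true) w).
rewrite cats1 last_rcons.
have -> : endplace (opp d, true) w = (opp (last d w), true) by exact: (endplace_cons (d, true) d w).
rewrite rcons_path atr_path traverse_turn.
rewrite {1 2}/traverse /same_tri !place_eqE !andbF !andbT /= [c'.1 == _]eq_sym.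
by case: path; case: turn; case: (c.1 == d.1); case: (_ == _).
Qed.

Lemma ccw_trans p q r t : ccw p q r -> ccw p r t -> ccw p q t.
Proof.
by case/and3P=> a b _ /and3P[_ d e]; rewrite /ccw a e (ltn_trans b d).
Qed.

Lemma ccw_rot p q r : ccw p q r -> ccw q r p.
Proof.
move=> C; have [n1 n2 n3] := ccw_neq C; have /andP[s1 s2] := ccw_tri C.
have s3 : same_tri q r by rewrite /same_tri -(eqP s1).
have s4 : same_tri q p by rewrite /same_tri eq_sym.
rewrite ccw_orient //; try by rewrite eq_sym.
by have := ccw_sign C; rewrite -addbA addbC.
Qed.

Lemma ccw_traverse p q r : ccw p q r -> [/\ traverse p q, traverse q r & traverse p r].
Proof.
move=> C; have [n1 n2 n3] := ccw_neq C; have /andP[s1 s2] := ccw_tri C.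
by rewrite /traverse s1 s2 n1 n2 n3 /same_tri -(eqP s1) (eqP s2) eqxx.
Qed.

Lemma tau_sym p q : traverse p q -> tau q p = ~~ tau p q.
Proof. by case/andP; apply: tau_anti. Qed.

Lemma ccw_tau p q r : traverse p q -> traverse p r -> traverse q r ->
  ccw p q r = tau p q (+) tau q r (+) tau r p.
Proof. by move=> /andP[? ?] /andP[? ?] /andP[? ?]; apply: ccw_orient. Qed.

Definition chords_cross s t s' t' :=
  (ccw s s' t && ccw t t' s) || (ccw s t' t && ccw t s' s).

(** Among four places in crossing position every triple has a known orientation. Adding [ccw_sign]
    over suitable triples shows that either smoothing of the two chords has the same total sign as
    the chords themselves. *)
Lemma chords_cross_sign s t s' t' : chords_cross s t s' t' ->
  [/\ traverse s t', traverse s' t, traverse s s' & traverse t t'] /\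
  (tau s t (+) tau s' t' (+) tau s t' (+) tau s' t = false) /\
  (tau s t (+) tau s' t' (+) tau s s' (+) tau t t' = false).
Proof.
case/orP=> /andP[C1 C2].
  have C3 := ccw_rot (ccw_rot C2).
  have C4 := ccw_trans C1 C3.
  have C5 := ccw_rot (ccw_rot (ccw_trans C2 (ccw_rot (ccw_rot C1)))).
  have [v1 v2 v3] := ccw_traverse C1; have [v4 v5 v6] := ccw_traverse C2.
  have [v7 v8 v9] := ccw_traverse C4; have [v10 v11 v12] := ccw_traverse C5.
  split; first by split.
  have a3 := ccw_sign C3; have a4 := ccw_sign C4; have a5 := ccw_sign C5.
  rewrite (tau_sym v9) in a3 a4; rewrite (tau_sym v12) in a5.
  by move: a3 a4 a5; do 6?case: (tau _ _).
have C3 := ccw_rot (ccw_rot C2).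
have C4 := ccw_trans C1 C3.
have C5 := ccw_trans C2 (ccw_rot (ccw_rot C1)).
have [v1 v2 v3] := ccw_traverse C1; have [v4 v5 v6] := ccw_traverse C2.
have [v7 v8 v9] := ccw_traverse C4; have [v10 v11 v12] := ccw_traverse C5.
split; first by split; rewrite // traverse_sym.
have a1 := ccw_sign C1; have a4 := ccw_sign C4; have a5 := ccw_sign C5.
have u1 : traverse t t' by rewrite traverse_sym.
have u2 : traverse s' t by rewrite traverse_sym.
have u3 : traverse s' t' by [].
rewrite (tau_sym u1) in a1 a5; rewrite (tau_sym v3) in a1.
rewrite (tau_sym u2) in a5; rewrite (tau_sym u3) (tau_sym v9) in a4.
by move: a1 a4 a5; do 6?case: (tau _ _).
Qed.

End Segments.

(** * Values of closed curves, independent of direction and of a tail *)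

Section LoopValues.
Variable T : tsurface.
Local Notation side := (side T).
Implicit Types (c d e : side) (u v w l : seq side) (n : bool).
Variables (F : fieldType) (x y : 'I_(narc T) -> F).
Local Notation X := (xside x).
Local Notation Y := (yside y).
Hypothesis X0 : forall d, X d != 0.
Hypothesis Xopp : forall d, X (opp d) = X d.
Hypothesis Yopp : forall d, Y (opp d) = Y d.
Local Notation bandval := (bandval x y).
Local Notation wordm := (wordm X Y).

Lemma tsign_asgn d w : tsign F d w = (-1) ^+ asgn (opp d, true) w.
Proof. by elim: w d => [//|e w IH] d /=; rewrite signr_addb IH. Qed.

Lemma trace_asgn d w : dualpath (d :: w) -> turn (last d w) d ->
  trm (wordm (d :: w)) = (-1) ^+ asgn (opp (last d w), true) (d :: w) * bandval d w.
Proof. by move=> dp td; rewrite (trace_bandval y X0 Xopp) // tsign_asgn. Qed.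

Lemma yword_inv w : yword Y (inv w) = yword Y w.
Proof.
elim: w => [//|d w IH]; rewrite inv_cons -cats1 yword_cat IH !yword_cons /yword big_nil Yopp.
by rewrite mulr1 mulrC.
Qed.

(** A matrix and its adjugate have the same trace. This serves the curves that run around a puncture
    counterclockwise. *)
Lemma bandval_inv d w e u : inv (d :: w) = e :: u -> dualpath (d :: w) -> turn (last d w) d ->
  bandval e u = bandval d w.
Proof.
move=> E dp td.
have le : last e u = opp d by have := rev_last_inv d w d; rewrite E.
have eE : e = opp (last d w) by have := head_inv d w d; rewrite E.
have td' : turn (last e u) e by rewrite le eE turn_inv.
have dp' : dualpath (e :: u) by rewrite -E dualpath_inv.
have t1 := trace_asgn dp td; have t2 := trace_asgn dp' td'.
have : trm (wordm (e :: u)) = (-1) ^+ size (d :: w) * trm (wordm (d :: w)).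
  by rewrite -E wordm_inv // trm_scale; congr (_ * _); rewrite /trm /adjm /= addrC.
rewrite t1 t2 le oppK -E.
have tr : atr (opp d, true) w by rewrite atr_path; case/andP: dp.
have [_ ->] := inner_inv (d, true) tr.
have tv : traverse (opp (last d w), true) (d, true) by rewrite traverse_turn.
rewrite (tau_sym tv) -[(-1) ^+ size _]signr_odd mulrA -signr_addb [asgn _ (d :: w)]/= => H.
have {}H : (-1) ^+ (~~ tau (opp (last d w), true) (d, true) (+) asgn (opp d, true) w (+) odd (size w)) * bandval e u
 = (-1) ^+ (~~ tau (opp (last d w), true) (d, true) (+) asgn (opp d, true) w (+) odd (size w)) * bandval d w.
  rewrite H; congr ((-1) ^+ _ * _); rewrite /=.
  by case: tau; case: asgn; case: odd.
by apply: (mulfI _ H); rewrite signr_eq0.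
Qed.

Lemma xloop_conj (c : seq side) d w : dualpath (c ++ (d :: w) ++ inv c) -> turn (last d w) d ->
  xloop x y (c ++ (d :: w) ++ inv c) = bandval d w.
Proof.
move=> dp td; rewrite /xloop cyc_reduce_conj //.
have dpw : dualpath (d :: w) by apply: (dualpath_catl (dualpath_catr dp)).
case: ifP => [/orP[]|_]; last by rewrite (xband_bandval y X0).
  by case/andP=> pd /eqP orb; rewrite (bandval_puncture y X0 Xopp pd (esym orb)).
case E: (inv (d :: w)) => [|e u]; first by [].
case/andP=> pd /eqP orb; rewrite -(bandval_inv E) //.
by rewrite (bandval_puncture y X0 Xopp pd (esym orb)) -E yword_inv.
Qed.

Lemma xloop_taut d w : dualpath (d :: w) -> turn (last d w) d ->
  xloop x y (d :: w) = bandval d w.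
Proof.
by move=> dp td; have := @xloop_conj [::] d w; rewrite /= cats0; apply.
Qed.

End LoopValues.

(** * Strands that run in parallel *)

Section CommonPrefix.
Variable T : tsurface.
Local Notation side := (side T).
Implicit Types (d e p q : side) (u v w c : seq side).

Definition parted u v : bool := if (u, v) is (d :: _, e :: _) then d != e else true.

Lemma common_prefix u v : exists c u' v',
  [/\ u = c ++ u', v = c ++ v' & parted u' v'].
Proof.
elim: u v => [|d u IH] [|e v].
- by exists [::], [::], [::].
- by exists [::], [::], (e :: v).
- by exists [::], (d :: u), [::].
have [<-|ne] := eqVneq d e; last by exists [::], (d :: u), (e :: v).
by have [c [u' [v' [-> -> h]]]] := IH v; exists (d :: c), u', v'.
Qed.

Lemma right_of_prefix (b : place T) (c : seq side) u v p q :
  parted u v ->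
  right_of b (c ++ u) p (c ++ v) q =
  ccw (endplace b c) (exitp u (p, false)) (exitp v (q, false)).
Proof.
move=> ne; elim: c b => [|d c IH] b /=; last by rewrite eqxx IH.
by move: ne; case: u => [|d u]; case: v => [|e v] //= /negbTE->.
Qed.

(** As long as first and last side cancel, both are removed; the absence of backtracking prevents
    the word from being used up. The part removed is the stretch along which the two strands of an
    antiparallel crossing run together. *)
Lemma closed_word_conj d w : dualpath (d :: w) -> d.1 = (opp (last d w)).1 ->
  exists (c : seq side) e v, d :: w = c ++ (e :: v) ++ inv c /\ turn (last e v) e.
Proof.
move: {2}(size w) (leqnn (size w)) => m; elim: m d w => [|m IH] d w.
  rewrite leqn0 size_eq0 => /eqP-> dp cl; exists [::], d, [::]; split=> //=.
  by rewrite turnE cl eqxx neq_opp //; case/andP: dp => /andP[].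
move=> sz dp cl; have [E|ne] := eqVneq (opp (last d w)) d; last first.
  by exists [::], d, w; rewrite cats0; split=> //; rewrite turnE cl eqxx eq_sym.
case/lastP: w sz dp cl E => [|w l] sz dp cl E.
  by case/andP: dp => /andP[/opp_neq ne _] _; rewrite /= in E; rewrite E eqxx in ne.
rewrite last_rcons in E; have lE : l = opp d by rewrite -E oppK.
subst l; case: w sz dp {cl E} => [|e w] sz dp.
  by move: dp; rewrite /= dualpath_cons turnE !eqxx /= andbF.
have dp' : dualpath (e :: w).
  by have := dualpath_cons1 dp; rewrite -cats1 => /dualpath_catl.
have te : turn d e by move: dp; rewrite dualpath_cons => /and3P[].
have tl : turn (last e w) (opp d).
  have := dp; rewrite -rcons_cons -cats1 dualpath_catE => /and3P[] //.
have cl : e.1 = (opp (last e w)).1.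
  by move: te tl; rewrite !turnE => /andP[/eqP-> _] /andP[/eqP-> _].
have sz' : (size w <= m)%N by move: sz; rewrite size_rcons ltnS => /ltnW; rewrite /= .
have [c [f [v [E tv]]]] := IH e w sz' dp' cl.
exists (d :: c), f, v; split=> //.
by rewrite -rcons_cons E inv_cons -!cats1 /= -!catA /= -!catA.
Qed.

End CommonPrefix.

(** The sign count of the parallel case in abstract bits, decided by its truth table. The right side
    compares two cyclic orientations expanded by [ccw_tau]. *)
Lemma xor_parallel (asg tau asg0 tau1 asg1 tau4 bsg od R od1 tau3 tau0 od0 tau2 : bool) :
  asg (+) (tau (+) asg0 (+) (~~ tau1 (+) (asg1 (+) (tau4 (+) bsg)))) (+) ~~ od (+) R
  (+) (R (+) ~~ od1 (+) (asg1 (+) tau3 (+) (asg0 (+) asg (+) tau0 (+) ~~ od0)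
                         (+) (od (+) od0 (+) od1) (+) (tau2 (+) bsg))) =
  (~~ tau (+) tau0 (+) ~~ tau1 == tau3 (+) tau2 (+) ~~ tau4).
Proof.
do 14 (match goal with b : bool |- _ => destruct b end); reflexivity.
Qed.

(** * The skein relation, case by case *)

Section Skein.
Variable T : tsurface.
Local Notation side := (side T).
Implicit Types (c d e p q : side) (u v w l : seq side) (n : bool).
Variables (F : fieldType) (x y : 'I_(narc T) -> F).
Local Notation X := (xside x).
Local Notation Y := (yside y).
Hypothesis X0 : forall d, X d != 0.
Hypothesis Xopp : forall d, X (opp d) = X d.
Hypothesis Yopp : forall d, Y (opp d) = Y d.
Local Notation wordm := (wordm X Y).
Local Notation spair := (spair x y).
Local Notation ps p w q := (psign (p, false) w (q, false)).

Lemma skein_spair n0 n1 p q w1 w2 w3 :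
  spair n0 n1 p (w1 ++ w2 ++ w3) q =
  (-1) ^+ (ps p (w1 ++ w2 ++ w3) q (+) ps p (w1 ++ w3) q) * trm (wordm w2)
    * spair n0 n1 p (w1 ++ w3) q
  - (-1) ^+ (ps p (w1 ++ w2 ++ w3) q (+) odd (size w2) (+) ps p (w1 ++ inv w2 ++ w3) q)
    * spair n0 n1 p (w1 ++ inv w2 ++ w3) q.
Proof.
rewrite /spair pairing_skein // !signr_addb signr_odd.
set a := (-1) ^+ psign _ (w1 ++ w2 ++ w3) _; set b := (-1) ^+ psign _ (w1 ++ w3) _.
set c := (-1) ^+ psign _ _ _.
have bb : b * b = 1 by rewrite /b -expr2 sqrr_sign.
have cc : c * c = 1 by rewrite /c -expr2 sqrr_sign.
set t := trm _; set p1 := pairing _ _ _ _ _; set p2 := pairing _ _ _ _ _; set z := (-1) ^+ size _.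
transitivity (- a * (t * p1) * (b * b) + a * z * p2 * (c * c)); last by ring.
by rewrite bb cc; ring.
Qed.

Lemma free_pathE n0 n1 c w c' d0 : w != [::] ->
  free_path n0 n1 c w c' = free_end n0 c (head d0 w) && free_end n1 c' (opp (last d0 w)).
Proof. by case: w. Qed.

Lemma free_nx n c : free_end n c (nx c).
Proof. by rewrite /free_end eqxx. Qed.

(** The sides other than [nx c] are the two incident to [c], one for each direction of unwinding,
    and either tag makes one direction free. This is why one of two smoothings at a corner costs
    nothing. *)
Lemma free_one n c d e : d.1 = c.1 -> e.1 = c.1 -> d != nx c -> e != nx c -> d != e ->
  free_end n c d || free_end n c e.
Proof.
case/triangle_cases=> ->; case/triangle_cases=> ->; rewrite ?eqxx // /free_end ?eqxx;
 by case: n; rewrite ?eqxx ?orbT.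
Qed.

Lemma spair_value n0 n1 p w q : pathok p w q -> tagok n0 n1 p q ->
  exists2 k, mono y k & (free_path n0 n1 p w q -> k = 1) /\
    spair n0 n1 p w q = k * xarc x y (IPath p w q) (n0, n1).
Proof. exact: (spair_xarc X0 Xopp Yopp). Qed.

Definition skein_value n0 n1 p q w1 w2 w3 (kink : bool) : Prop :=
  let xdet := xarc x y (IPath p (w1 ++ w3) q) (n0, n1) * xloop x y w2 in
  let xrev := (-1) ^+ kink * xarc x y (IPath p (w1 ++ inv w2 ++ w3) q) (n0, n1) in
  let xg := xarc x y (IPath p (w1 ++ w2 ++ w3) q) (n0, n1) in
  (exists2 k, mono y k & xg = xdet + k * xrev) \/
  (exists2 k, mono y k & xg = xrev + k * xdet).

Section Pieces.
Variables (n0 n1 : bool) (p q : side) (w1 : seq side) (d : side) (w2 w3 : seq side).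
Let w := w1 ++ (d :: w2) ++ w3.
Hypothesis okw : pathok p w q.
Hypothesis tg : tagok n0 n1 p q.
Hypothesis hd : head d w = nx p.
Hypothesis lt : opp (last d w) = nx q.
Let s := endplace (p, false) w1.
Let t : place T := (d, true).
Let s' : place T := (opp (last d w2), true).
Let t' := exitp w3 (q, false).

Lemma pieces : [/\ all (@interior T) w1, all (@interior T) (d :: w2) & all (@interior T) w3] /\
  [/\ atr (p, false) w1, traverse s t, atr (opp d, true) w2, traverse s' t' & btr w3 (q, false)].
Proof.
move: okw; rewrite pathok_traversesE; last by rewrite /w; case: (w1).
rewrite /w !all_cat => /andP[/and3P[-> -> ->]].
rewrite traverses_cat2 -/s => /andP[-> ]; rewrite cat_cons /= -/t => /andP[->].
rewrite traverses_cat2 => /andP[->].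
have -> : endplace (opp d, true) w2 = s' by exact: (endplace_cons (d, true) d w2).
by rewrite traversesE -/t' => /andP[-> ->].
Qed.

Lemma gamma_value : spair n0 n1 p w q = xarc x y (IPath p w q) (n0, n1).
Proof.
have [k _ [k1 ->]] := spair_value okw tg.
rewrite k1 ?mul1r // (@free_pathE _ _ _ _ _ d); last by rewrite /w; case: (w1).
by rewrite hd lt !free_nx.
Qed.

Lemma det_pathok : traverse s t' -> pathok p (w1 ++ w3) q.
Proof.
have [[i1 _ i3] [a1 _ _ _ b3]] := pieces => st.
case: (eqVneq (w1 ++ w3) [::]) => [E|ne]; last first.
  by rewrite pathok_traversesE // all_cat i1 i3 traverses_cat2 a1 -/s traversesE -/t' st b3.
rewrite E /pathok /=; move: st; rewrite /s /t'.
move: E; case: (w1) => // E; case: (w3) E => //= _.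
by rewrite /traverse /same_tri => /andP[].
Qed.

Lemma rev_pathok : traverse s s' -> traverse t t' -> pathok p (w1 ++ inv (d :: w2) ++ w3) q.
Proof.
have [[i1 i2 i3] [a1 _ a2 _ b3]] := pieces => ss tt.
rewrite pathok_traversesE; last by case: (w1) => //; rewrite inv_cons; case: (inv w2).
rewrite !all_cat i1 all_interior_inv i2 i3 /=.
rewrite traverses_cat2 a1 -/s traverses_cat2.
have [-> _] := inner_inv s a2; rewrite -/s' ss endplace_inv /= -/t.
by rewrite traversesE -/t' tt b3.
Qed.

Lemma psign_gamma : ps p w q =
  asgn (p, false) w1 (+) (tau s t (+) asgn (opp d, true) w2 (+) (tau s' t' (+) bsgn w3 (q, false))).
Proof.
rewrite /w psign_cat2 -/s cat_cons /= -/t psign_cat2.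
have -> : endplace (opp d, true) w2 = s' by exact: (endplace_cons (d, true) d w2).
by rewrite psignE -/t' -addbA.
Qed.

Lemma psign_det : ps p (w1 ++ w3) q =
  asgn (p, false) w1 (+) (tau s t' (+) bsgn w3 (q, false)).
Proof. by rewrite psign_cat2 -/s psignE. Qed.

Lemma psign_rev : ps p (w1 ++ inv (d :: w2) ++ w3) q =
  asgn (p, false) w1 (+) (tau s s' (+) asgn (opp d, true) w2 (+) odd (size w2) (+)
     (tau t t' (+) bsgn w3 (q, false))).
Proof.
have [_ [_ _ a2 _ _]] := pieces.
rewrite psign_cat2 -/s psign_cat2 endplace_inv /= -/t psignE -/t'.
by have [_ ->] := inner_inv s a2.
Qed.

Lemma skein_chords (kink : bool) : kink = false -> chords_cross s t s' t' ->
  skein_value n0 n1 p q w1 (d :: w2) w3 kink.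
Proof.
move=> -> cr; have [[v1 v2 v3 v4] [sg1 sg2]] := chords_cross_sign cr.
have [[i1 i2 i3] [a1 v5 a2 v6 b3]] := pieces.
have td : turn (last d w2) d by rewrite -traverse_turn.
have dp2 : dualpath (d :: w2).
  by have [dw _] := andP okw; apply: (dualpath_catl (dualpath_catr dw)).
have main : spair n0 n1 p w q = xloop x y (d :: w2) * spair n0 n1 p (w1 ++ w3) q
    + spair n0 n1 p (w1 ++ inv (d :: w2) ++ w3) q.
  rewrite [LHS](skein_spair n0 n1 p q w1 (d :: w2) w3) -/w (trace_asgn y X0 Xopp) // (xloop_taut X0 Xopp Yopp) // -/s'.
  rewrite psign_gamma psign_det psign_rev.
  rewrite [asgn s' _]/= -/t mulrA -signr_addb; congr (_ + _).
    rewrite (_ : _ (+) _ = false) ?expr0 ?mul1r //.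
    move: sg1; case: asgn; case: (tau s t); case: asgn; case: (tau s' t'); case: bsgn; case: (tau s t'); case: (tau s' t) => //.
  rewrite (_ : _ (+) _ = true) ?expr1 ?mulN1r ?opprK //=.
  move: sg2; case: asgn; case: (tau s t); case: asgn; case: (tau s' t'); case: bsgn; case: (tau s s'); case: (tau t t'); case: odd => //.
have [k1 m1 [f1 E1]] := spair_value (det_pathok v1) tg.
have [k2 m2 [f2 E2]] := spair_value (rev_pathok v3 v4) tg.
rewrite gamma_value E1 E2 in main.
(* The smoothing with free ends gets coefficient 1, the other one the monomial of its tightening. *)
suff : free_path n0 n1 p (w1 ++ w3) q \/ free_path n0 n1 p (w1 ++ inv (d :: w2) ++ w3) q.
  case=> [/f1 K|/f2 K]; [left; exists k2 | right; exists k1] => //; rewrite expr0 main K; ring.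
have rne : w1 ++ inv (d :: w2) ++ w3 != [::].
  by case: (w1) => //; rewrite inv_cons; case: (inv w2).
have hrev e : head e (inv (d :: w2) ++ w3) = opp (last d w2).
  by have := head_inv d w2 e; case E: (inv (d :: w2)) => [|f u] //; move: E; rewrite inv_cons; case: (inv w2).
have lrev e : last e (inv (d :: w2)) = opp d by exact: rev_last_inv.
clear main f1 f2 E1 E2 m1 m2 cr sg1 sg2 td dp2 a1 a2 b3 i1 i2 i3.
rewrite (@free_pathE _ _ _ _ _ d rne); move: hd lt; rewrite /w.
case W1: w1 => [|e1 u1] /=; case W3: w3 => [|e3 u3] /=.
(* Both ends lie at corners of this triangle and the detached arc is a side of it. It is not free
   only for different tags and one cyclic order of [p] and [q], and then the reversed arc is
   free. *)
- rewrite !cats0 => dE lE.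
  have lastr : last d (inv (d :: w2)) = opp d by apply: lrev.
  have := hrev d; rewrite W3 cats0 => ->; rewrite lastr oppK lE dE.
  case: (n0) (n1) => -[] /=; do ?[by left].
  + rewrite ?orbF ?andbT; case: (eqVneq q (nx p)) => [->|_]; last by left.
    by right; rewrite /free_end nx_nx !eqxx !orbT.
  + rewrite ?andbT; case: (eqVneq p (nx q)) => [->|_]; last by left.
    by right; rewrite /free_end nx_nx !eqxx !orbT.
(* Only the start lies in this triangle. The two smoothings leave [p] across the two sides incident
   to it, so that [free_one] applies; the other end is unchanged. *)
- move=> dE; rewrite last_cat /= => lE; have := hrev d; rewrite W3 => ->.
  rewrite last_cat /= lE !free_nx !andbT.
  have sE : s = (p, false) by rewrite /s W1.
  have tE : t' = (e3, true) by rewrite /t' W3.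
  move: v1 v2 v3 v4 v6; rewrite sE tE /s' /t /traverse /same_tri !place_eqE !andbF !andbT dE /=.
  move=> /eqP p1 /andP[_ n2] /eqP p3 /andP[_ n4] /andP[_ n5].
  rewrite eq_sym in n4; rewrite eq_sym in n5.
  by have /orP[] := free_one n0 (esym p1) (esym p3) n4 n2 n5; [left|right].
- rewrite !cats0 last_cat /= => hE lE.
  rewrite last_cat lrev oppK hE !free_nx /=.
  have sE : s = (opp (last e1 u1), true) by rewrite /s W1; exact: (endplace_cons (p, false) e1 u1).
  have tE : t' = (q, false) by rewrite /t' W3.
  move: v1 v2 v3 v4 v5; rewrite sE tE /s' /t /traverse /same_tri !place_eqE !andbF !andbT lE /=.
  move=> /eqP p1 /andP[_ n2] /andP[_ n3] /eqP p4 /andP[_ n5].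
  rewrite eq_sym in n2.
  rewrite -hE; by have /orP[] := free_one n1 p1 p4 n3 n2 n5; [left|right].
(* With no end in this triangle, [s], [t], [s'] and [t'] would be four distinct sides of it. *)
move: v1 v2 v3 v4 v5 v6.
have -> : s = (opp (last e1 u1), true) by rewrite /s W1; exact: (endplace_cons (p, false) e1 u1).
have -> : t' = (e3, true) by rewrite /t' W3.
rewrite /s' /t /traverse /same_tri !place_eqE !andbT /=.
move=> /andP[/eqP q1 n1'] /andP[/eqP q2 n2'] /andP[/eqP q3 n3'] /andP[/eqP q4 n4'] /andP[_ n5'] /andP[_ n6'].
move: n1' n2' n3' n4' n5' n6'.
have /esym/triangle_cases := q4; have /triangle_cases := q2.
have /triangle_cases := etrans q1 (esym q4).
by do 3?[case=> ->]; rewrite ?eqxx.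
Qed.

Lemma spair_backtrack u (c : seq side) v :
  spair n0 n1 p (u ++ inv c ++ c ++ v) q =
  (-1) ^+ (ps p (u ++ inv c ++ c ++ v) q (+) odd (size c) (+) ps p (u ++ v) q)
  * yword Y c * spair n0 n1 p (u ++ v) q.
Proof.
rewrite /spair pairing_backtrack // !signr_addb signr_odd.
set a := (-1) ^+ psign _ (u ++ inv c ++ c ++ v) _; set b := (-1) ^+ psign _ _ _.
have bb : b * b = 1 by rewrite /b -expr2 sqrr_sign.
set z := (-1) ^+ size _; set P := pairing _ _ _ _ _.
transitivity (- a * z * yword Y c * P * (b * b)); last by ring.
by rewrite bb; ring.
Qed.

Lemma xarc_reduce u v : reduce u = reduce v ->
  xarc x y (IPath p u q) (n0, n1) = xarc x y (IPath p v q) (n0, n1).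
Proof. by move=> E; rewrite /xarc /tighten /= E. Qed.

Lemma free_det : (exists w3', w3 = d :: w3') -> free_path n0 n1 p (w1 ++ w3) q.
Proof.
case=> w3' E; rewrite (@free_pathE _ _ _ _ _ d); last by rewrite E; case: (w1).
have -> : head d (w1 ++ w3) = nx p by rewrite -hd /w E; case: (w1).
have -> : opp (last d (w1 ++ w3)) = nx q by rewrite -lt /w E !last_cat.
by rewrite !free_nx.
Qed.

(* Both strands continue into the same side: the reversed middle part cancels  *)
(* against the final part as long as these two run in parallel.                *)
Lemma skein_parallel : (exists w3', w3 = d :: w3') -> ccw t s s' || ccw t s' s ->
  skein_value n0 n1 p q w1 (d :: w2) w3
    (ccw t s s' != right_of t ((d :: w2) ++ inv w1) p w3 q).
Proof.
move=> w3E cr; have tt' : t' = t by rewrite /t'; case: w3E => w3' ->.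
have [[i1 i2 i3] [a1 v5 a2 v6 b3]] := pieces.
have [vs vs'] : traverse s s' /\ traverse t s'.
  by case/orP: cr => /ccw_traverse[h1 h2 h3]; split; rewrite // traverse_sym.
have vt : traverse s' t by rewrite traverse_sym.
have td : turn (last d w2) d by rewrite -traverse_turn.
have [dw _] := andP okw.
have dp2 : dualpath (d :: w2) by apply: (dualpath_catl (dualpath_catr dw)).
have trw1 : traverses (p, false) w1 s' by rewrite -[w1]cats0 traverses_cat2 a1 /= -/s vs.
set P := (d :: w2) ++ inv w1.
have bP : bsgn P (p, false) = asgn (opp d, true) w2 (+) asgn (p, false) w1 (+) tau s s' (+) ~~ odd (size w1).
  rewrite /P /= psign_cat2.
  have -> : endplace (opp d, true) w2 = s' by exact: (endplace_cons (d, true) d w2).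
  rewrite psign_inv // -{1}[w1]cats0 psign_cat2 /= -/s.
  by rewrite !addbA.
have tP : btr P (p, false).
  rewrite /P /= traverses_cat2 a2.
  have -> : endplace (opp d, true) w2 = s' by exact: (endplace_cons (d, true) d w2).
  by rewrite traverses_inv.
have [c [P' [Q' [PE QE ne]]]] := common_prefix P w3.
rewrite /P in PE; rewrite -/P in PE.
have [c' cE] : exists c' : seq side, c = d :: c'.
  case: c PE QE => [|f c'] PE QE.
    case: w3E => w3' E; have QE' : Q' = d :: w3' by rewrite -E QE.
    have PE' : P' = P by rewrite PE.
    by move: ne; rewrite /parted QE' PE' /P /= eqxx.
  by exists c'; move: PE => [<-].
subst c; have RP := @right_of_prefix _ t (d :: c') P' Q' p q ne.
rewrite PE QE RP.
set bb := endplace t (d :: c').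
have bbE : bb = endplace (opp d, true) c' by [].
set e1 := exitp P' (p, false); set e2 := exitp Q' (q, false).
have bP' : bsgn P (p, false) = asgn (opp d, true) c' (+) (tau bb e1 (+) bsgn P' (p, false)).
  by rewrite PE /= psign_cat2 psignE.
have bQ' : bsgn w3 (q, false) = asgn (opp d, true) c' (+) (tau bb e2 (+) bsgn Q' (q, false)).
  by rewrite QE /= psign_cat2 psignE.
have [tb1 tP'] : traverse bb e1 /\ btr P' (p, false).
  by move: tP; rewrite PE /= traverses_cat2 traversesE => /and3P[].
have [tb2 tQ'] : traverse bb e2 /\ btr Q' (q, false).
  by move: b3; rewrite QE /= traverses_cat2 traversesE => /and3P[].
have revE : w1 ++ inv (d :: w2) ++ w3 = inv P' ++ inv (d :: c') ++ (d :: c') ++ Q'.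
  by rewrite catA -{1}[w1]invK -inv_cat -/P PE inv_cat -catA QE.
have redE : xarc x y (IPath p (w1 ++ inv (d :: w2) ++ w3) q) (n0, n1) =
            xarc x y (IPath p (inv P' ++ Q') q) (n0, n1).
  by apply: xarc_reduce; rewrite revE reduce_backtrack.
have intP : all (@interior T) P by rewrite /P all_cat i2 all_interior_inv i1.
have iP' : all (@interior T) P' by move: intP; rewrite PE all_cat => /andP[].
have iQ' : all (@interior T) Q' by move: i3; rewrite QE all_cat => /andP[].
have ic : all (@interior T) (d :: c') by move: i3; rewrite QE all_cat => /andP[].
have rev_value : exists2 k, mono y k &
    spair n0 n1 p (inv P' ++ Q') q = k * xarc x y (IPath p (inv P' ++ Q') q) (n0, n1) /\
    (traverse e1 e2 \/ spair n0 n1 p (inv P' ++ Q') q = 0).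
  (* The parts beyond the common stretch have equal exits only if both are empty and end at the same
     corner. The reversed arc is then a point of value 0, and no sign has to be determined. *)
  have [e12|ne12] := eqVneq e1 e2.
    have [PQ pq] : inv P' ++ Q' = [::] /\ q = p.
      move: e12 ne; rewrite /parted /e1 /e2; case: (P') => [|f u]; case: (Q') => [|g v] //= [-> ] //.
      by rewrite eqxx.
    have S0 : spair n0 n1 p (inv P' ++ Q') q = 0.
      by rewrite PQ /spair (pairing_same x y tg pq) mulr0.
    exists 1; [exact: mono1 | split; last by right].
    by rewrite S0 PQ /xarc /tighten /= pq eqxx mulr0.
  have v12 : traverse e1 e2.
    move: tb1 tb2; rewrite /traverse /same_tri => /andP[/eqP<- _] /andP[/eqP<- _].
    by rewrite eqxx.
  have okr : pathok p (inv P' ++ Q') q.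
    case: (eqVneq (inv P' ++ Q') [::]) => [E|nn].
      rewrite E /pathok /=; move: v12; rewrite /e1 /e2.
      move: E; case: (P') => [|f u]; last by rewrite inv_cons; case: (inv u).
      by move=> /= ->; rewrite /traverse /same_tri => /andP[].
    rewrite pathok_traversesE // all_cat all_interior_inv iP' iQ'.
    by rewrite traverses_cat2 atr_inv tP' endplace_inv traversesE -/e1 -/e2 v12 tQ'.
  have [k mk [_ E]] := spair_value okr tg; exists k => //; split=> //; by left.
have [k mk [kE k0]] := rev_value.
have std : traverse s t' by rewrite tt'.
have [k1 m1 [f1 E1]] := spair_value (det_pathok std) tg.
rewrite f1 ?mul1r in E1; last exact: free_det.
(* The detached arc keeps the first and last side of the given arc and is free. The reversed arc
   pays [yword] for cancelling the common stretch and [k] for tightening the rest. *)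
left; exists (yword Y (d :: c') * k).
  by apply: monoM => //; exists (d :: c').
rewrite -QE; transitivity (spair n0 n1 p w q); first by rewrite gamma_value.
rewrite [LHS](skein_spair n0 n1 p q w1 (d :: w2) w3) -/w.
rewrite (trace_asgn y X0 Xopp) // (xloop_taut X0 Xopp Yopp) // -/s' E1.
rewrite revE spair_backtrack -revE redE.
congr (_ + _).
  rewrite psign_gamma psign_det tt' [asgn s' _]/= -/t mulrA -signr_addb.
  rewrite (_ : _ (+) _ = false) ?expr0 ?mul1r 1?mulrC //.
  by case: asgn; case: asgn; case: (tau s t); case: (tau s' t); case: bsgn.
set xr := xarc _ _ _ _ in kE k0 *.
case: k0 => [v12|S0]; last by rewrite S0 in kE; rewrite S0 [RHS]mulrCA -!mulrA -kE !mulr0 oppr0.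
rewrite kE; set b1 := (_ (+) _ (+) ps p (w1 ++ inv (d :: w2) ++ w3) q).
set b2 := (_ (+) _ (+) ps p (inv P' ++ Q') q).
(* The sign from Cayley-Hamilton and the sign of the cancelled stretch differ exactly when the
   orientations at its two ends agree. The minus sign of the skein relation then disappears; in the
   other case it is the sign of the kink. *)
have sg : b1 (+) b2 = (ccw t s s' == ccw bb e1 e2).
  have vts : traverse t s by rewrite traverse_sym.
  have psPi : ps p (inv P' ++ Q') q =
      bsgn P' (p, false) (+) odd (size P') (+) (tau e1 e2 (+) bsgn Q' (q, false)).
    by rewrite psign_cat2 endplace_inv psignE -/e1 -/e2 asgn_inv.
  have psG := psign_gamma; rewrite /w tt' in psG.
  rewrite /b1 /b2 psG psPi; move: (ps p (w1 ++ inv (d :: w2) ++ w3) q) => R.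
  rewrite (ccw_tau vts vs' vs) (ccw_tau tb1 tb2 v12) (tau_sym v5) (tau_sym vs') (tau_sym tb2).
  have szP : odd (size w2) (+) odd (size w1) = odd (size c') (+) odd (size P').
    have := congr1 (odd \o size) PE; rewrite /P /= !size_cat !oddD size_inv.
    by move/negb_inj.
  have szP' : odd (size P') = odd (size w2) (+) odd (size w1) (+) odd (size c').
    by rewrite szP addbC addKb.
  rewrite [size (d :: w2)]/= [size (d :: c')]/= !oddS szP'.
  have B1 : bsgn P' (p, false) = asgn (opp d, true) c' (+) tau bb e1 (+) (asgn (opp d, true) w2 (+) asgn (p, false) w1 (+) tau s s' (+) ~~ odd (size w1)).
    by rewrite -bP bP'; case: (asgn _ _); case: (tau bb e1); case: (bsgn _ _).
  rewrite B1 bQ'.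
  exact: xor_parallel.
transitivity (- (-1) ^+ (b1 (+) b2) * (yword Y (d :: c') * k * xr)).
  by rewrite signr_addb; ring.
rewrite sg; case: (ccw t s s'); case: (ccw bb e1 e2); rewrite /= ?expr0 ?expr1; ring.
Qed.

(** The strands run together in opposite directions, so the middle part is a shorter loop conjugated
    by the common stretch [c]. The detached loop pays for pulling off this tail, while the reversed
    arc begins and ends with the same sides as the given arc and is free. *)
Lemma skein_antiparallel : opp (last d w2) = d ->
  (ccw t s t' && right_of t ((d :: w2) ++ w3) q (inv (d :: w2) ++ inv w1) p) ||
  (ccw t t' s && right_of t (inv (d :: w2) ++ inv w1) p ((d :: w2) ++ w3) q) ->
  skein_value n0 n1 p q w1 (d :: w2) w3 false.
Proof.
move=> ld cr; have ss : s' = t by rewrite /s' ld.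
have [[i1 i2 i3] [a1 v5 a2 v6 b3]] := pieces.
rewrite ss in v6.
have [dw _] := andP okw.
have dp2 : dualpath (d :: w2) by apply: (dualpath_catl (dualpath_catr dw)).
have [c [e [v [E te]]]] : exists (c : seq side) e v, d :: w2 = c ++ (e :: v) ++ inv c /\ turn (last e v) e.
  by apply: closed_word_conj; rewrite // ld.
have [c' cE] : exists c' : seq side, c = d :: c'.
  case: c E => [|f c'] E; last by exists c'; move: E => [->].
  by move: E te; rewrite cats0 => -[<- <-]; rewrite turnE ld !eqxx.
subst c; have w2E : w2 = c' ++ (e :: v) ++ inv (d :: c') by move: E => [].
set bb := endplace t (d :: c').
set q1 : place T := (e, true); set q2 : place T := (opp (last e v), true).
have bbE : bb = (opp (last d c'), true) by exact: endplace_cons.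
have invE : inv (d :: w2) = (d :: c') ++ inv (e :: v) ++ inv (d :: c').
  by rewrite E !inv_cat invK -catA.
have hv : exists u : seq side, inv (e :: v) = opp (last e v) :: u.
  by exists (inv (belast e v)); rewrite lastI inv_rcons.
have ne : e != opp (last e v) by move: te; rewrite turnE => /andP[].
have {}cr : (ccw t s t' && ccw bb q1 q2) || (ccw t t' s && ccw bb q2 q1).
  case: hv => u uE; move: cr; rewrite invE E -!catA.
  rewrite !right_of_prefix ?uE /parted //=; by rewrite eq_sym.
have okl : dualpath ((d :: c') ++ (e :: v) ++ inv (d :: c')) by rewrite -E.
have ac : atr (opp d, true) c' by move: a2; rewrite w2E atr_cat => /andP[].
have [tb1 tv tb2] : [/\ traverse bb q1, atr (opp e, true) v & traverse q2 bb].
  move: a2; rewrite w2E atr_cat => /andP[_]; rewrite -[endplace _ c']/bb cat_cons /= -/q1 => /andP[-> ].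
  rewrite atr_cat => /andP[-> ].
  have -> : endplace (opp e, true) v = q2 by exact: (endplace_cons q1 e v).
  by have [-> _] := inner_inv q2 ac; rewrite -bbE.
have tq : traverse q2 q1 by rewrite traverse_turn.
have I2 : asgn (opp d, true) w2 = asgn (opp d, true) c' (+) (tau bb q1 (+) asgn (opp e, true) v
     (+) (tau q2 bb (+) asgn (opp d, true) c' (+) odd (size c'))).
  rewrite w2E asgn_cat -[endplace _ c']/bb; congr (_ (+) _).
  rewrite cat_cons /= -/q1 asgn_cat.
  have -> : endplace (opp e, true) v = q2 by exact: (endplace_cons q1 e v).
  by have [_ ->] := inner_inv q2 ac; rewrite -bbE !addbA.
have std : traverse s t'.
  by case/orP: cr => /andP[/ccw_traverse[h1 h2 h3] _] //; rewrite traverse_sym.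
have vts : traverse t s by rewrite traverse_sym.
(* Crossing means that the orientations at the two ends of the common stretch agree; [ccw_tau] turns
   this into one equation between signs. *)
have sgn : tau s t (+) tau s t' (+) tau t t' = ~~ (tau bb q1 (+) tau q2 bb (+) tau q2 q1).
  have tq12 : traverse q1 q2 by rewrite traverse_sym.
  have tb12 : traverse bb q2 by rewrite traverse_sym.
  have c1 := ccw_tau vts v6 std; have c2 := ccw_tau v6 vts (_ : traverse t' s).
  have c3 := ccw_tau tb1 tb12 tq12; have c4 := ccw_tau tb12 tb1 tq.
  rewrite traverse_sym in std; have {}c2 := c2 std; rewrite traverse_sym in std.
  move: cr; rewrite c1 c2 c3 c4 (tau_sym v5) (tau_sym v6) (tau_sym std) (tau_sym tb2) (tau_sym tb1) (tau_sym tq).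
  by case: (tau s t); case: (tau s t'); case: (tau t t'); case: (tau bb q1); case: (tau q2 bb); case: (tau q2 q1).
have trE : trm (wordm (d :: w2)) = (-1) ^+ (odd (size (d :: c')) (+) (tau q2 q1 (+) asgn (opp e, true) v))
      * yword Y (d :: c') * xloop x y (d :: w2).
  have dpe : dualpath (e :: v) by apply: (dualpath_catl (dualpath_catr okl)).
  rewrite E trace_conj // (xloop_conj X0 Xopp Yopp) // (trace_asgn y X0 Xopp) //.
  by rewrite signr_addb signr_odd [asgn _ (e :: v)]/= -/q1 -/q2; ring.
have rp : pathok p (w1 ++ inv (d :: w2) ++ w3) q by apply: rev_pathok; rewrite ?ss.
have [k1 m1 [_ E1]] := spair_value (det_pathok std) tg.
have [k2 m2 [f2 E2]] := spair_value rp tg.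
rewrite f2 ?mul1r in E2; last first.
  rewrite (@free_pathE _ _ _ _ _ d); last by rewrite invE; case: (w1).
  have -> : head d (w1 ++ inv (d :: w2) ++ w3) = nx p.
    by rewrite -hd /w invE; case: (w1).
  have -> : opp (last d (w1 ++ inv (d :: w2) ++ w3)) = nx q.
    rewrite -lt /w !last_cat; congr (opp _).
    by rewrite rev_last_inv /= -[last d w2]oppK ld.
  by rewrite !free_nx.
(* [yword] is the price of removing the tail of the loop, [k1] that of tightening the detached
   arc. *)
right; exists (yword Y (d :: c') * k1).
  apply: monoM => //; exists (d :: c') => //.
  by move: i2; rewrite E all_cat => /andP[].
transitivity (spair n0 n1 p w q); first by rewrite gamma_value.
rewrite [LHS](skein_spair n0 n1 p q w1 (d :: w2) w3) -/w trE E1 E2.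
rewrite expr0 mul1r [RHS]addrC; congr (_ + _).
  rewrite !mulrA -signr_addb (_ : _ (+) _ = false) ?expr0 ?mul1r; first by ring.
  rewrite psign_gamma psign_det ss I2 /=; move: sgn; set B := bsgn _ _.
  by case: (asgn (p, false) w1); case: B; case: (asgn (opp d, true) c'); case: (asgn (opp e, true) v); case: (odd (size c'));
    case: (tau s t); case: (tau s t'); case: (tau t t'); case: (tau bb q1); case: (tau q2 bb); case: (tau q2 q1).
rewrite (_ : _ (+) _ = true) ?expr1 ?mulN1r ?opprK //.
rewrite psign_gamma psign_rev ss /=; set B := bsgn _ _.
by case: (asgn (p, false) w1); case: B; case: (asgn (opp d, true) w2); case: (odd _); case: (tau s t); case: (tau t t').
Qed.

End Pieces.
End Skein.

(** * Excluding the sphere with three punctures *)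

Section ThreePunctures.
Variable T : tsurface.
Local Notation side := (side T).
Implicit Types (c d e : side).

Lemma rho_sym : connect_sym (frel (@rho T)).
Proof. exact: fconnect_sym (@rho_inj T). Qed.

(* Two self-folded triangles with a common outer side form a sphere with three *)
(* punctures.                                                                  *)
Lemma encloses_both d : admissible_surface T -> interior d ->
  encloses d -> encloses (opp d) -> False.
Proof.
case=> conn _ sph _ di /eqP hd /eqP he; set e := opp d in he *.
have od : opp (pv d) = nx d by rewrite -hd oppK.
have oe : opp (pv e) = nx e by rewrite -he oppK.
have oeE : opp e = d by rewrite /e oppK.
have de1 : d.1 <> e.1.
  move=> E; have /triangle_cases := esym E; rewrite -/e => -[] E'.
  - by have := opp_neq di; rewrite -/e E' eqxx.
  - by move: oeE; rewrite E' hd => /eqP; rewrite pv_neq.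
  - by move: oeE; rewrite E' od => /eqP; rewrite nx_neq.
(* The six sides of the two triangles are glued among themselves, so connectedness leaves no other
   triangle. *)
have closed a b : connect [rel a b : side | (a.1 == b.1) || (b == opp a)] a b ->
    (a.1 == d.1) || (a.1 == e.1) -> (b.1 == d.1) || (b.1 == e.1).
  case/connectP=> s; elim: s a => [|f s IH] a /=; first by move=> _ ->.
  case/andP=> af /IH {}IH /IH {}IH Ha; apply: IH.
  case/orP: af => [/eqP<- //|/eqP->].
  by case/orP: Ha => /eqP /triangle_cases[]->;
    rewrite ?hd ?od ?he ?oe ?oeE -/e ?nx1 ?pv1 ?eqxx ?orbT.
have two c : (c.1 == d.1) || (c.1 == e.1).
  by apply: closed (conn d c) _; rewrite eqxx.
have six c : c \in [:: d; nx d; pv d; e; nx e; pv e].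
  by case/orP: (two c) => /eqP/triangle_cases[]->; rewrite !inE eqxx ?orbT.
have int c : interior c.
  have := six c; rewrite !inE => /or4P[/eqP->|/eqP->|/eqP->|/or3P[] /eqP->] //.
  - by apply: contraT => /opp_boundary; rewrite hd => /eqP; rewrite pv_nx_neq.
  - by apply: contraT => /opp_boundary; rewrite od => /eqP; rewrite nx_pv_neq.
  - by rewrite interior_opp.
  - by apply: contraT => /opp_boundary; rewrite he => /eqP; rewrite pv_nx_neq.
  - by apply: contraT => /opp_boundary; rewrite oe => /eqP; rewrite nx_pv_neq.
have pun c : puncture c by apply/allP=> f _.
have ntri2 : ntri T = 2%N.
  rewrite -[ntri T]card_ord; have /eq_card-> : 'I_(ntri T) =i [set d.1; e.1].
    by move=> t; rewrite !inE (two (t, ord0)).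
  by rewrite cards2; case: eqP.
(* The six sides are counted by their labels, each arc occurring twice. *)
have narc3 : narc T = 3%N.
  have : (\sum_(k < narc T) 2 = \sum_(c : side) 1)%N.
    transitivity (\sum_(k < narc T) \sum_(c : side | label c == Some k) 1)%N.
      by apply: eq_bigr => k _; rewrite sum1dep_card labelP.
    rewrite (exchange_big_dep xpredT) //=; apply: eq_bigr => c _.
    have := int c; rewrite /interior; case: (label c) => // k _.
    by rewrite (eq_bigl (pred1 k)) ?big_pred1_eq // => k'; rewrite /= eq_sym.
  rewrite sum_nat_const card_ord sum1_card card_prod !card_ord ntri2.
  by case: (narc T) => [|[|[|[|n]]]] //; rewrite !mulSn.
have nb0 : nboundaries T = 0%N.
  by apply: eq_card0 => c; apply/negP => /andP[_]; rewrite !inE => /negP; apply; apply: pun.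
have fix1 a b : rho a = a -> fconnect (@rho T) a b -> b = a.
  by move=> E /iter_findex <-; elim: findex => [//|n IH]; rewrite iterS IH.
have rpd : rho (pv d) = pv d by rewrite /rho od nx_nx.
have rpe : rho (pv e) = pv e by rewrite /rho oe nx_nx.
have c1 : fconnect (@rho T) d (nx e) by have := fconnect1 (@rho T) d.
have c2 : fconnect (@rho T) d e.
  by apply: connect_trans c1 _; have := fconnect1 (@rho T) (nx e); rewrite {2}/rho he nx_pv.
have c3 : fconnect (@rho T) d (nx d).
  by apply: connect_trans c2 _; have := fconnect1 (@rho T) e; rewrite {2}/rho oeE.
(* The corners [pv d] and [pv e] inside the two self-folded triangles are fixed by [rho], and the
   other four corners form one cycle. *)
have np3 : npunctures T = 3%N.
  pose r := fingraph.root (frel (@rho T)).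
  have rE a b : (r a == r b) = fconnect (@rho T) a b by apply: fingraph.root_connect rho_sym _ _.
  have card3 : #|[set r d; r (pv d); r (pv e)]| = 3%N.
    rewrite -setUA cardsU1 cards2 !inE !rE.
    rewrite [fconnect _ d (pv d)]rho_sym [fconnect _ d (pv e)]rho_sym.
    have -> : fconnect (@rho T) (pv d) d = false by apply/negP=> /(fix1 _ _ rpd)/eqP; rewrite neq_pv.
    have -> : fconnect (@rho T) (pv e) d = false.
      by apply/negP=> /(fix1 _ _ rpe)/(congr1 fst)/de1.
    have -> // : fconnect (@rho T) (pv d) (pv e) = false.
    by apply/negP=> /(fix1 _ _ rpd)/(congr1 fst) /= E; case: de1.
  apply: etrans card3; apply: eq_card => c; apply/andP/idP => [[/eqP rc _]|].
    rewrite !inE -{1 2 3}rc -/(r c) !rE.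
    have := six c; rewrite !inE => /or4P[/eqP->|/eqP->|/eqP->|/or3P[] /eqP->];
    by rewrite ?connect0 ?orbT // [fconnect _ _ d]rho_sym ?c1 ?c2 ?c3.
  rewrite !inE => H; split; last exact: pun.
  by case/orP: H => [/orP[]|] /eqP->; apply/eqP; apply: fingraph.root_root; exact: rho_sym.
by move: sph; rewrite /planar np3 nb0 ntri2 narc3.
Qed.

End ThreePunctures.

(** * The weights of sides in terms of the seed *)

Section SeedVariables.
Variable T : tsurface.
Local Notation side := (side T).
Implicit Types (c d e : side).
Variables (F : fieldType) (x y : 'I_(narc T) -> F).

Lemma xlab_opp d : xlab x (opp d) = xlab x d.
Proof. by rewrite /xlab label_opp. Qed.

(** [xside] tests [d] before [opp d]. The order is immaterial because the two sides of an arc cannot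
    both enclose a radius, and it is here that admissibility of the surface enters. *)
Lemma xside_opp d : admissible_surface T -> xside x (opp d) = xside x d.
Proof.
move=> adm; have [di|/opp_boundary-> //] := boolP (interior d).
rewrite /xside xlab_opp oppK; congr (_ * _).
case e1: (encloses d); case e2: (encloses (opp d)) => //.
by case: (encloses_both adm di).
Qed.

Lemma yside_opp d : yside y (opp d) = yside y d.
Proof.
have yo c : ylab y (opp c) = ylab y c by rewrite /ylab label_opp.
have no : interior d -> opp d != d by case/opp_spec.
rewrite /yside oppK yo; case: (boolP (interior d)) => [di|/opp_boundary -> //].
have [E|n1] := eqVneq (opp d) (nx d).
  by rewrite E nx_nx neq_pv pv_nx eqxx.
have [E|n2] := eqVneq (opp d) (pv d).
  by rewrite E nx_pv eqxx pv_pv.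
have -> : (d == nx (opp d)) = false.
  by apply: contraNF n2 => /eqP{2}->; rewrite pv_nx.
have -> // : (d == pv (opp d)) = false.
by apply: contraNF n1 => /eqP{2}->; rewrite nx_pv.
Qed.

Lemma yside_ytile d k : label d = Some k -> yside y d = ytile y k.
Proof.
move=> dk; rewrite /ytile; case: pickP => [e /eqP ek|/(_ d)/eqP//].
have di : interior d by rewrite /interior dk.
have [_ _ /(_ e)] := opp_spec di.
by rewrite dk => /(_ ek)[]->; rewrite ?yside_opp.
Qed.

Lemma yword_ytile w : all (@interior T) w ->
  yword (yside y) w =
    \prod_(k < narc T) ytile y k ^+ count (fun d => label d == Some k) w.
Proof.
elim: w => [|d w IH] /=; first by rewrite /yword big_nil big1.
case/andP=> di /IH {}IH; rewrite /yword big_cons -/(yword _ w) IH.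
move: di; rewrite /interior; case dk: (label d) => [k|] // _.
rewrite (yside_ytile dk) [RHS](bigD1 k) //= [in LHS](bigD1 k) //= eqxx exprS mulrA.
congr (_ * _); apply: eq_bigr => k' /negbTE nk.
by rewrite [Some k == _]eq_sym (inj_eq (@Some_inj _)) nk.
Qed.

End SeedVariables.

Lemma xvar_neq0 (T : tsurface) k : xvar (T := T) k != 0.
Proof.
rewrite /xvar tofrac_eq0; apply/eqP => /(congr1 (mpoly.mcoeff (mpoly.mnm1 (lshift (narc T) k)))).
by rewrite mpoly.mcoeffX eqxx mpoly.mcoeff0 => /eqP; rewrite oner_eq0.
Qed.

Lemma xside_neq0 (T : tsurface) d : xside (xvar (T := T)) d != 0.
Proof.
have x0 e : xlab (xvar (T := T)) e != 0.
  by rewrite /xlab; case: (label e) => [k|]; rewrite ?xvar_neq0 ?oner_neq0.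
by rewrite /xside mulf_neq0 //; do 2?case: ifP => _; rewrite ?x0 ?oner_neq0.
Qed.

Lemma cat_take_middle (U : Type) (w : seq U) i j : (i <= j)%N ->
  take i w ++ drop i (take j w) = take j w.
Proof. by move=> ij; rewrite -{2}(cat_take_drop i (take j w)) take_takel. Qed.

(** * From the combinatorial description of a crossing to the skein relation *)

Section Crossing.
Variables (T : tsurface) (F : fieldType) (x y : 'I_(narc T) -> F).
Hypothesis X0 : forall d, xside x d != 0.
Hypothesis Xopp : forall d, xside x (opp d) = xside x d.

Local Arguments right_of : simpl never.

Lemma exit_endplace (w : seq (side T)) p : exit (inv w, p) = endplace (p, false) w.
Proof. by rewrite -{2}[w]invK endplace_inv /exit; case: (inv w). Qed.

Lemma skein_crossing g n i j :
  generalized_arc g -> tagging g n -> self_crossing g i j ->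
  skein_value x y n.1 n.2 (org g) (dst g)
    (initial_part g i) (middle_part g i j) (final_part g j) (kinked g i j).
Proof.
case: g => p w q arc tag /andP[/andP[ij jw]].
have Yopp := @yside_opp T F y.
rewrite /kinked /backward /forward /initial_part /middle_part /final_part.
rewrite [org _]/= [dst _]/= [word _]/= in ij jw *.
have [d [w2 [w1E ME fE wE]]] : exists d w2, [/\ take j w = take i w ++ (d :: w2), drop i (take j w) = d :: w2, drop i w = (d :: w2) ++ drop j w & w = take i w ++ (d :: w2) ++ drop j w].
  have E := esym (cat_take_middle w (ltnW ij)).
  have : (0 < size (drop i (take j w)))%N by rewrite size_drop size_takel // subn_gt0.
  case M: (drop i (take j w)) => [|d w2] // _; exists d, w2; rewrite -M.
  have E2 : drop i w = drop i (take j w) ++ drop j w.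
    by rewrite -{1}(cat_take_drop j w) drop_cat size_takel // ij.
  by split=> //; rewrite catA -E cat_take_drop.
rewrite ME fE w1E; move: (take i w) (drop j w) wE => w1 w3 wE {ME fE w1E ij jw i j}.
rewrite {}wE {w} in arc tag *; set w := w1 ++ _ in arc *.
have [hd lt ok] : [/\ head d w = nx p, opp (last d w) = nx q & pathok p w q].
  move: arc; case: w (size_cat w1 ((d :: w2) ++ w3) : size w = _) => [|e v _].
    by rewrite addnS.
  rewrite /generalized_arc /pathok /dualpath /=.
  by case/and4P=> -> -> /eqP-> /eqP->; rewrite nx_pv nx_pv !eqxx.
rewrite {}/w in arc hd lt ok *.
have tg : tagok n.1 n.2 p q by case: tag.
have last3 d' w3' : w3 = d' :: w3' -> d' != opp (last d w2).
  move=> E; move: ok => /andP[/dualpath_catr + _].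
  by rewrite E dualpath_catE /= turnE => /and3P[_ /andP[]].
have xw c u : exit (u, c) = exitp u (c, false) by case: u.
have par w3' : w3 = d :: w3' -> _ := fun E => skein_parallel X0 Xopp Yopp ok tg hd lt (ex_intro _ w3' E).
have anti := skein_antiparallel X0 Xopp Yopp ok tg hd lt.
have chords := skein_chords X0 Xopp Yopp ok tg hd lt erefl.
have hinv : ohead (inv (w1 ++ d :: w2)) = Some (opp (last d w2)).
  by rewrite inv_cat lastI inv_rcons.
(* If the strands do not continue into a common side, they cross inside the triangle unless, read in
   opposite directions, they share the side [d]; the latter is the antiparallel case. *)
have noK : (if Some d == ohead w3 then Some d else None) = None ->
    (strands_cross (inv w1, p) ((d :: w2) ++ w3, q) (inv (w1 ++ d :: w2), p) (w3, q)
    || strands_cross (inv w1, p) ((d :: w2) ++ w3, q) (w3, q) (inv (w1 ++ d :: w2), p)) ->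
    skein_value x y n.1 n.2 p q w1 (d :: w2) w3 false.
  rewrite /strands_cross !exit_endplace !xw /first_side /= hinv endplace_cat endplace_cons => -> /orP[/chords//|].
  have [E|_] := eqVneq (Some d) (Some (opp (last d w2))); last by rewrite orbC => /chords.
  by case: E => /esym/anti; rewrite inv_cat.
rewrite /first_side /=.
move: noK; have [K _|_ noK] := eqVneq (Some d) (ohead w3); last exact: (noK erefl).
case: w3 K par last3 {anti chords ok hd lt tg tag arc} => // _ w3 [<-] par last3.
have ne : d != opp (last d w2) by apply: last3 erefl.
rewrite /strands_cross !exit_endplace !xw /first_side /= hinv endplace_cat endplace_cons eqxx.
have -> : (Some d == Some (opp (last d w2))) = false by apply: negbTE.
(* Read in opposite directions, the two strands now have the place of [d] in common, and chords with
   a common end do not cross. Only the parallel reading remains. *)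
have c1 z : ccw z (d, true) (d, true) = false by apply/negP => /ccw_neq[_ _]; rewrite eqxx.
have c2 z : ccw (d, true) (d, true) z = false by apply/negP => /ccw_neq[]; rewrite eqxx.
rewrite c1 c2 /= andbF !orbF => H; apply: (par _ erefl).
by case/orP: H => /andP[-> _]; rewrite ?orbT.
Qed.
End Crossing.

Theorem theorem4p5p1 (T : tsurface) (admT : admissible_surface T)
    (gamma : ipath T) (notches : bool * bool)
    (arc_gamma : generalized_arc gamma)
    (tag_gamma : tagging gamma notches)
    (notched_gamma : notches.1 || notches.2)
    (i j : nat) (crossing_ij : self_crossing gamma i j) :
  exists c1 c2 : multicurve T,
    ((c1, c2) = (smooth_detach gamma notches i j,
                 smooth_reverse gamma notches i j) \/
     (c1, c2) = (smooth_reverse gamma notches i j,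
                 smooth_detach gamma notches i j)) /\
    exists e : 'I_(narc T) -> nat,
      xarc (xvar (T:=T)) (yvar (T:=T)) gamma notches =
      xmulti (xvar (T:=T)) (yvar (T:=T)) c1 +
      (\prod_(k < narc T) ytile (yvar (T:=T)) k ^+ e k) *
      xmulti (xvar (T:=T)) (yvar (T:=T)) c2.
Proof.
have Xopp d : xside (xvar (T := T)) (opp d) = xside (xvar (T := T)) d.
  exact: xside_opp.
have xdet : xmulti (xvar (T:=T)) (yvar (T:=T)) (smooth_detach gamma notches i j) =
    xarc (xvar (T:=T)) (yvar (T:=T)) (IPath (org gamma)
      (initial_part gamma i ++ final_part gamma j) (dst gamma)) notches *
    xloop (xvar (T:=T)) (yvar (T:=T)) (middle_part gamma i j).
  by rewrite /xmulti /smooth_detach !big_cons big_nil mulr1 /= expr0 mul1r.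
have xrev : xmulti (xvar (T:=T)) (yvar (T:=T)) (smooth_reverse gamma notches i j) =
    (-1) ^+ kinked gamma i j *
    xarc (xvar (T:=T)) (yvar (T:=T)) (IPath (org gamma) (initial_part gamma i ++
      inv (middle_part gamma i j) ++ final_part gamma j) (dst gamma)) notches.
  by rewrite /xmulti /smooth_reverse big_cons big_nil mulr1.
have gE : gamma = IPath (org gamma) (initial_part gamma i ++
    middle_part gamma i j ++ final_part gamma j) (dst gamma).
  case/andP: crossing_ij => /andP[/ltnW ij _] _; case: (gamma) => p w q.
  by rewrite /= /initial_part /middle_part /final_part /= catA cat_take_middle // cat_take_drop.
have := skein_crossing (yvar (T := T)) (xside_neq0 (T := T)) Xopp arc_gamma tag_gamma crossing_ij.
rewrite /skein_value -surjective_pairing -xdet -xrev -gE.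
case=> -[_ [w iw ->] ->]; rewrite yword_ytile //.
  exists (smooth_detach gamma notches i j), (smooth_reverse gamma notches i j).
  by split; [left | eexists].
exists (smooth_reverse gamma notches i j), (smooth_detach gamma notches i j).
by split; [right | eexists].
Qed.
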